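(* Let $K$ be a global function field of odd characteristic with full field of constants $\mathbb{F}_q$, let $X$ be its set of places, and let $\mathfrak{S}\subset X$ be a finite (possibly empty) set of places. Consider the following procedure. 1. Find a set of places $\mathfrak{B}=\{\mathfrak{b}_1,\dots,\mathfrak{b}_n\}$, disjoint from $\mathfrak{S}$, that forms a basis of $\operatorname{Pic}X/2\operatorname{Pic}X$, and a finite set $\mathfrak{B}'=\{\mathfrak{b}_{n+1},\dots,\mathfrak{b}_m\}\subset X$, disjoint from $\mathfrak{B}\cup\mathfrak{S}$, such that the classes of the places in $\mathfrak{B}\cup\mathfrak{B}'$ generate $\operatorname{Pic}X$. 2. Construct a basis $\mathscr{B}=\{\beta_1,\dots,\beta_n\}$ of $\mathbb{E}$ compatible with $\mathfrak{B}$. 3. For each $\mathfrak{s}\in\mathfrak{S}$ compute the coordinates $c_1,\dots,c_n\in\{0,1\}$ of $[\mathfrak{s}]+2\operatorname{Pic}X$ with respect to the basis $\mathfrak{B}$, using $(-1)^{c_j}=\left(\frac{\beta_j}{\mathfrak{s}}\right)$. 4. Using these coordinates find a maximal subset $\mathfrak{S}'=\{\mathfrak{s}_1,\dots,\mathfrak{s}_s\}$ of $\mathfrak{S}$ that is linearly independent in $\operatorname{Pic}X/2\operatorname{Pic}X$. 5. If $\mathfrak{S}'=\mathfrak{S}$, output $\mathscr{B}$ and terminate. 6. Let $V$ be the $\mathbb{F}_2$-span of $\{[\mathfrak{s}]+2\operatorname{Pic}X : \mathfrak{s}\in\mathfrak{S}'\}$. 7. For every $\mathfrak{p}\in\mathfrak{S}\setminus\mathfrak{S}'$: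 find the coordinates $\varepsilon_1,\dots,\varepsilon_s\in\{0,1\}$ of $[\mathfrak{p}]+2\operatorname{Pic}X$ in $V$ with respect to the basis $\mathfrak{S}'$; set $\mathfrak{T}:=\{\mathfrak{s}_i : \varepsilon_i=1\}=\{\mathfrak{t}_1,\dots,\mathfrak{t}_t\}$; compute the kernel of the homomorphism $\psi:\mathbb{Z}^{1+t+m}\to\operatorname{Pic}X$, $$\psi(v_0,\dots,v_{t+m})=v_0[\mathfrak{p}]+\sum_{1\le i\le t}v_i[\mathfrak{t}_i]+\sum_{1\le i\le m}2v_{t+i}[\mathfrak{b}_i];$$ find $v=(v_0,\dots,v_{t+m})\in\ker\psi$ with $v_0$ odd; let $\lambda$ be a generator of the Riemann--Roch space $\mathcal{L}\bigl(v_0\mathfrak{p}+\sum_{1\le i\le t}v_i\mathfrak{t}_i+\sum_{1\le i\le m}2v_{t+i}\mathfrak{b}_i\bigr)$; and set $\lambda_\mathfrak{p}:=\lambda\cdot\prod_{i\le n}\beta_i^{e_i}$, where $e_i\in\{0,1\}$ and $(-1)^{e_i}=\left(\frac{\lambda}{\mathfrak{b}_i}\right)$. 8. Output $\mathscr{B}\cup\{\lambda_\mathfrak{p} : \mathfrak{p}\in\mathfrak{S}\setminus\mathfrak{S}'\}$. Then the procedure is correct: its steps can be carried out, and its output is a basis over $\mathbb{F}_2$ of the group $\mathbb{E}_\mathfrak{S}$ of $\mathfrak{S}$-singular elements of $K$ modulo squares.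
   Context: $K$ is a global function field of odd characteristic with full constant field $\mathbb{F}_q$ ($q$ a power of an odd prime). $X$ is the set of places of $K$, viewed as a smooth complete curve over $\mathbb{F}_q$. For $\mathfrak{p}\in X$, $\operatorname{ord}_\mathfrak{p}$ is the normalized valuation and $K_\mathfrak{p}$ the completion. $\operatorname{Pic}X$ is the group of divisor classes and $[\mathcal{D}]$ the class of the divisor $\mathcal{D}$. The Riemann--Roch space is $\mathcal{L}(\mathcal{D})=\{\lambda\in K^\times : \operatorname{div}_X\lambda\ge-\mathcal{D}\}\cup\{0\}$, a vector space over $\mathbb{F}_q$. For a finite set $\mathfrak{S}\subset X$, an element $\lambda\in K^\times$ is $\mathfrak{S}$-singular if $\operatorname{ord}_\mathfrak{p}\lambda$ is even for every $\mathfrak{p}\in X\setminus\mathfrak{S}$. The group of $\mathfrak{S}$-singular elements modulo squares is $\mathbb{E}_\mathfrak{S}=\{\lambda\in K^\times/K^{\times2} : \operatorname{ord}_\mathfrak{p}\lambda\equiv0\pmod2\text{ for }\mathfrak{p}\in X\setminus\mathfrak{S}\}$, a finite $\mathbb{F}_2$-vector space; $\mathbb{E}:=\mathbb{E}_\emptyset$. Elements of $K^\times$ are identified with their square classes where appropriate. For $\lambda\in K^\times$ (or its square class), $\left(\frac{\lambda}{\mathfrak{p}}\right)$ equals $1$ if $\lambda$ is a square in $K_\mathfrak{p}$, $0$ if $\operatorname{ord}_\mathfrak{p}\lambda$ is odd, and $-1$ if $\operatorname{ord}_\mathfrak{p}\lambda$ is even but $\lambda$ is not a square in $K_\mathfrak{p}$.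 Distinct places are said to be linearly independent (to form a basis) in $\operatorname{Pic}X/2\operatorname{Pic}X$ if the family of cosets of their classes modulo $2\operatorname{Pic}X$ is linearly independent over $\mathbb{F}_2$ (forms a basis). Sets $\{\mathfrak{b}_1,\dots,\mathfrak{b}_n\}\subset X$ and $\{\beta_1,\dots,\beta_n\}\subset\mathbb{E}$ are compatible if $\left(\frac{\beta_i}{\mathfrak{b}_i}\right)=-1$ for all $i$ and $\left(\frac{\beta_i}{\mathfrak{b}_j}\right)=1$ for all $i\ne j$. *)

(* Defs.v *)
From HB Require Import structures.
From mathcomp Require Import all_boot all_order all_algebra fieldext.
From mathcomp Require Import finmap boolp classical_sets functions.
From mathcomp.multinomials Require Import freeg.

Set Implicit Arguments.
Unset Strict Implicit.
Unset Printing Implicit Defensive.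

Import Order.TTheory GRing.Theory Num.Theory.
Local Open Scope fset_scope.
Local Open Scope quotient_scope.
Local Open Scope ring_scope.

(* A global function field over F = F_q is a finite extension K of the field  *)
(* F(X) of rational functions, i.e. K : fieldExtType {fraction {poly F}}.     *)

Definition const (F : finFieldType) (K : fieldExtType {fraction {poly F}})
  (c : F) : K := (FracField.tofrac c%:P)%:A.

Definition full_constant_field (F : finFieldType)
    (K : fieldExtType {fraction {poly F}}) : Prop :=
  forall x : K, algebraicOver (@const F K) x -> exists c : F, x = const K c.

(* Places are represented by their normalized (surjective) discrete           *)
(* valuations.  Triviality on the constants need not be required: they have   *)
(* finite multiplicative order.  The value at 0 is a convention that makes a  *)
(* place determined by its valuation on K^*.                                  *)
Record place (K : fieldType) := Place {
  ord :> K -> int;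
  ord_zero : ord 0 = 0;
  ordM : forall x y, x != 0 -> y != 0 -> ord (x * y) = ord x + ord y;
  ordD : forall x y, x != 0 -> y != 0 -> x + y != 0 ->
    Num.min (ord x) (ord y) <= ord (x + y);
  ord_uniformizer : exists2 x, x != 0 & ord x = 1
}.

HB.instance Definition _ (K : fieldType) := gen_eqMixin (place K).
HB.instance Definition _ (K : fieldType) := gen_choiceMixin (place K).

Section Completion.
Variables (K : fieldType) (p : place K).
Implicit Types (x y : K) (N M : int) (u w : nat -> K).

(* x lies in the N-th power of the maximal ideal at p *)
Definition small N x := (x == 0) || (N <= ord p x).

Lemma ord1 : ord p 1 = 0.
Proof.
have := ordM p (oner_neq0 K) (oner_neq0 K); rewrite mulr1 => /eqP.
by rewrite -subr_eq0 opprD addNKr oppr_eq0 => /eqP.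
Qed.

Lemma ordN1 : ord p (-1) = 0.
Proof.
have n1 : (-1 : K) != 0 by rewrite oppr_eq0 oner_neq0.
have := ordM p n1 n1; rewrite mulrNN mulr1 ord1 -mulr2n => /esym/eqP.
by rewrite mulrn_eq0 /= => /eqP.
Qed.

Lemma smallM N M x y : small N x -> small M y -> small (N + M) (x * y).
Proof.
rewrite /small mulf_eq0; have [//|x0 /= hx] := eqVneq x 0.
have [//|y0 /= hy] := eqVneq y 0.
by rewrite ordM // lerD.
Qed.

Lemma smallN N x : small N x -> small N (- x).
Proof.
rewrite -[- x]mulN1r -{2}[N]add0r; apply: smallM.
by rewrite /small ordN1 lexx orbT.
Qed.

Lemma smallD N x y : small N x -> small N y -> small N (x + y).
Proof.
rewrite /small; have [->|x0 /= hx] := eqVneq x 0; first by rewrite add0r.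
have [->|y0 /= hy] := eqVneq y 0; first by rewrite addr0 hx orbT.
have [//|xy0 /=] := eqVneq (x + y) 0.
by apply: le_trans (ordD p x0 y0 xy0); rewrite le_min hx hy.
Qed.

Lemma smallB N x y : small N x -> small N y -> small N (x - y).
Proof. by move=> hx /smallN; apply: smallD. Qed.

Lemma smallW N M x : N <= M -> small M x -> small N x.
Proof. by move=> NM /orP[h|h]; rewrite /small ?h // (le_trans NM h) orbT. Qed.

Lemma small0 N : small N 0. Proof. by rewrite /small eqxx. Qed.

Definition cauchy_seq u : Prop :=
  forall N, exists n0, forall m n, (n0 <= m)%N -> (n0 <= n)%N ->
    small N (u m - u n).

Definition null_seq u : Prop :=
  forall N, exists n0, forall n, (n0 <= n)%N -> small N (u n).

Lemma cauchy_bounded u : cauchy_seq u -> exists N, forall n, small N (u n).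
Proof.
move=> /(_ 0)[n0 hn0].
have [N hN] : exists N, forall n, (n < n0.+1)%N -> small N (u n).
  elim: n0.+1 => [|n [N hN]]; first by exists 0.
  exists (Num.min N (ord p (u n))) => m; rewrite ltnS leq_eqVlt => /orP[/eqP->|].
    by rewrite /small ge_min lexx !orbT.
  by move=> /hN; apply: smallW; rewrite ge_min lexx.
exists (Num.min N 0) => n; have [ltn|len] := ltnP n n0.+1.
  by apply: smallW (hN _ ltn); rewrite ge_min lexx.
rewrite -[u n](subrK (u n0)); apply: smallD.
  by apply: smallW (hn0 _ _ (ltnW len) (leqnn _)); rewrite ge_min lexx orbT.
by apply: smallW (hN _ (leqnn _)); rewrite ge_min lexx.
Qed.

Definition cauchy : {pred nat -> K} := [pred u | `[< cauchy_seq u >]].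

Lemma cauchy_cst x : cauchy_seq (fun=> x).
Proof. by move=> N; exists 0%N => m n _ _; rewrite subrr small0. Qed.

Lemma cauchy_subring : subring_closed cauchy.
Proof.
split=> [|u w|u w]; rewrite ?inE.
- exact: (cauchy_cst 1).
- move=> hu hw N.
  have [a ha] := hu N; have [b hb] := hw N; exists (maxn a b) => m n.
  rewrite !geq_max => /andP[am bm] /andP[an bn].
  have -> : (u - w) m - (u - w) n = (u m - u n) - (w m - w n).
    by rewrite !fctE /= !opprD !opprK addrACA.
  by apply: smallB; [exact: ha|exact: hb].
- move=> hu hw N.
  have [A hA] := cauchy_bounded hu; have [B hB] := cauchy_bounded hw.
  have [a ha] := hu (N - B); have [b hb] := hw (N - A).
  exists (maxn a b) => m n; rewrite !geq_max => /andP[am bm] /andP[an bn].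
  have -> : (u * w) m - (u * w) n = (u m - u n) * w m + u n * (w m - w n).
    by rewrite !fctE /= mulrBl mulrBr addrA subrK.
  apply: smallD.
    by rewrite -[N](subrK B); apply: smallM; [exact: ha|exact: hB].
  by rewrite -[N](subrKC A); apply: smallM; [exact: hA|exact: hb].
Qed.

HB.instance Definition _ :=
  GRing.isSubringClosed.Build (nat -> K) cauchy cauchy_subring.

Definition cauchy_ring := {u : nat -> K | u \in cauchy}.

HB.instance Definition _ := SubChoice.on cauchy_ring.
HB.instance Definition _ :=
  [SubChoice_isSubComNzRing of cauchy_ring by <:].

Definition null : {pred cauchy_ring} :=
  [pred u : cauchy_ring | `[< null_seq (val u) >]].

Lemma null_ideal : idealr_closed null.
Proof.
split; rewrite ?inE.
- by move=> N; exists 0%N => n _; exact: small0.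
- apply/negP; rewrite inE => /(_ 1)[n0 /(_ n0 (leqnn _))].
  by rewrite /small /= [_ n0]/(1 : K) oner_eq0 ord1.
- move=> a u w; rewrite !inE => hu hw N.
  have : val a \in cauchy by exact: valP.
  rewrite inE => /cauchy_bounded[A hA].
  have [m hm] := hu (N - A); have [n hn] := hw N.
  exists (maxn m n) => k; rewrite geq_max => /andP[mk nk].
  apply: smallD; last exact: hn.
  by rewrite -[N](subrKC A); apply: smallM; [exact: hA|exact: hm].
Qed.

HB.instance Definition _ := isIdealr.Build cauchy_ring null null_ideal.

Definition completion := {ideal_quot null}.
HB.instance Definition _ := GRing.ComNzRing.on completion.

Lemma cst_cauchy x : (fun=> x) \in cauchy.
Proof. by apply/asboolP; exact: cauchy_cst. Qed.

Definition to_completion x : completion :=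
  \pi_completion (exist (fun u => u \in cauchy) _ (cst_cauchy x)).

End Completion.

(* The group K^*, written additively: \val (x + y) = \val x * \val y. *)
Section MultiplicativeGroup.
Variable K : fieldType.

Definition mulgrp := {x : K | x != 0}.
HB.instance Definition _ := SubChoice.on mulgrp.

Lemma mulgrpM_subproof (x y : mulgrp) : val x * val y != 0.
Proof. by rewrite mulf_neq0 ?(valP x) ?(valP y). Qed.

Lemma mulgrpV_subproof (x : mulgrp) : (val x)^-1 != 0.
Proof. by rewrite invr_eq0 (valP x). Qed.

Definition mulgrp1 : mulgrp := exist _ 1 (oner_neq0 K).
Definition mulgrpM (x y : mulgrp) : mulgrp := exist (fun z => z != 0) _ (mulgrpM_subproof x y).
Definition mulgrpV (x : mulgrp) : mulgrp := exist (fun z => z != 0) _ (mulgrpV_subproof x).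

Lemma mulgrpA : associative mulgrpM.
Proof. by move=> x y z; apply: val_inj; rewrite /= mulrA. Qed.
Lemma mulgrpC : commutative mulgrpM.
Proof. by move=> x y; apply: val_inj; rewrite /= mulrC. Qed.
Lemma mulgrp1M : left_id mulgrp1 mulgrpM.
Proof. by move=> x; apply: val_inj; rewrite /= mul1r. Qed.
Lemma mulgrpVM : left_inverse mulgrp1 mulgrpV mulgrpM.
Proof. by move=> x; apply: val_inj; rewrite /= mulVf ?(valP x). Qed.

HB.instance Definition _ :=
  GRing.isZmodule.Build mulgrp mulgrpA mulgrpC mulgrp1M mulgrpVM.

End MultiplicativeGroup.

(* V / 2V as a vector space over F_2 *)
Section Mod2.
Variable V : zmodType.

Definition twice : {pred V} := [pred x | `[< exists y, x = y *+ 2 >]].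

Lemma twice_zmod_closed : zmod_closed twice.
Proof.
split=> [|x y]; rewrite !inE; first by exists 0; rewrite mul0rn.
by move=> [a ->] [b ->]; exists (a - b); rewrite mulrnBl.
Qed.

HB.instance Definition _ := GRing.isZmodClosed.Build V twice twice_zmod_closed.

Definition mod2 := Quotient.quot twice.
HB.instance Definition _ := Choice.on mod2.
HB.instance Definition _ := GRing.Zmodule.on mod2.

Definition to_mod2 (x : V) : mod2 := \pi_(Quotient.quot twice) x.

Lemma mod2_mulr2n (x : mod2) : x *+ 2 = 0.
Proof.
rewrite -[x]reprK -raddfMn -[RHS](raddf0 \pi_(Quotient.quot twice)).
apply/eqP; rewrite -Quotient.idealrBE subr0 inE.
by exists (repr x).
Qed.

Definition scale_mod2 (c : 'F_2) (x : mod2) : mod2 := x *+ c.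

Lemma mod2_mulrn_mod (x : mod2) n : x *+ (n %% 2)%N = x *+ n.
Proof.
by rewrite {2}(divn_eq n 2) mulrnDr mulnC mulrnA mod2_mulr2n mul0rn add0r.
Qed.

Lemma scale_mod2A a b (x : mod2) :
  scale_mod2 a (scale_mod2 b x) = scale_mod2 (a * b) x.
Proof. by rewrite /scale_mod2 -mulrnA mulnC -[LHS]mod2_mulrn_mod. Qed.
Lemma scale_mod21 : left_id 1 scale_mod2.
Proof. by []. Qed.
Lemma scale_mod2Dr : right_distributive scale_mod2 +%R.
Proof. by move=> a x y; rewrite /scale_mod2 mulrnDl. Qed.
Lemma scale_mod2Dl (x : mod2) : {morph scale_mod2^~ x : a b / a + b}.
Proof. by move=> a b; rewrite /scale_mod2 -mulrnDr -[RHS]mod2_mulrn_mod. Qed.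

HB.instance Definition _ := GRing.Zmodule_isLmodule.Build 'F_2 mod2
  scale_mod2A scale_mod21 scale_mod2Dr scale_mod2Dl.

End Mod2.

Section LinearAlgebra.
Variables (F : fieldType) (V : lmodType F).

Definition lin_indep (I : finType) (v : I -> V) : Prop :=
  forall c : I -> F, \sum_i c i *: v i = 0 -> forall i, c i = 0.

(* the family v is a basis of the subspace U *)
Definition is_basis (U : set V) (I : finType) (v : I -> V) : Prop :=
  [/\ forall i, U (v i), lin_indep v &
      forall x, U x -> exists c : I -> F, x = \sum_i c i *: v i].

End LinearAlgebra.

Section Divisors.
Variable K : fieldType.

Definition divisor := {freeg (place K)}.

Definition is_div (l : K) (D : divisor) : Prop :=
  forall p, coeff p D = ord p l.

Definition principal : {pred divisor} :=
  [pred D | `[< exists2 l : K, l != 0 & is_div l D >]].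

Lemma ordV (p : place K) x : x != 0 -> ord p x^-1 = - ord p x.
Proof.
move=> x0; have := ordM p x0; move=> /(_ x^-1); rewrite invr_eq0 => /(_ x0).
by rewrite mulfV // ord1 => /esym/eqP; rewrite addrC addr_eq0 => /eqP.
Qed.

Lemma principal_zmod_closed : zmod_closed principal.
Proof.
split=> [|D E]; rewrite !inE.
  by exists 1; rewrite ?oner_neq0// => p; rewrite coeff0 ord1.
move=> [l l0 hl] [m m0 hm]; exists (l * m^-1); first by rewrite mulf_neq0 ?invr_eq0.
by move=> p; rewrite coeffB hl hm ordM ?invr_eq0// ordV.
Qed.

HB.instance Definition _ :=
  GRing.isZmodClosed.Build divisor principal principal_zmod_closed.

Definition Pic := Quotient.quot principal.
HB.instance Definition _ := Choice.on Pic.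
HB.instance Definition _ := GRing.Zmodule.on Pic.

Definition div_class (D : divisor) : Pic := \pi_(Quotient.quot principal) D.

Definition place_class (p : place K) : Pic := div_class << p >>.

Definition place_class2 (p : place K) : mod2 Pic := to_mod2 (place_class p).

Definition RiemannRoch (D : divisor) : set K :=
  [set l | l = 0 \/ forall p, - coeff p D <= ord p l].

End Divisors.

Section SingularElements.
Variable K : fieldType.

Definition sqclass := mod2 (mulgrp K).
HB.instance Definition _ := GRing.Lmodule.on sqclass.

Definition is_square_at (p : place K) (l : K) : Prop :=
  exists y : completion p, y ^+ 2 = to_completion p l.

Definition legendre (l : mulgrp K) (p : place K) : int :=
  if `[< is_square_at p (val l) >] then 1
  else if (2 %| ord p (val l))%Z then -1 else 0.

(* The symbol of a square class is that of any representative: see            *)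
(* legendre_classE below.                                                     *)
Definition legendre_class (x : sqclass) (p : place K) : int :=
  legendre (repr x) p.

Lemma to_completionM p : {morph @to_completion K p : x y / x * y}.
Proof.
move=> x y; rewrite -[RHS](rmorphM \pi_{ideal_quot (@null K p)}).
by congr \pi; exact: val_inj.
Qed.

Lemma is_square_atM2 p l m : m != 0 ->
  is_square_at p (l * m ^+ 2) <-> is_square_at p l.
Proof.
have sqM a b : is_square_at p a -> is_square_at p (a * b ^+ 2).
  move=> [y hy]; exists (y * to_completion p b).
  by rewrite exprMn hy expr2 -!to_completionM -expr2.
move=> m0; split=> [/(@sqM _ m^-1)|/sqM//].
by rewrite -mulrA -exprMn mulfV // expr1n mulr1.
Qed.

Lemma legendre_classE l p : legendre_class (to_mod2 l) p = legendre l p.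
Proof.
have : repr (to_mod2 l) - l \in @twice (mulgrp K).
  by rewrite Quotient.idealrBE reprK.
rewrite inE => -[m /eqP]; rewrite subr_eq addrC => /eqP hm.
rewrite /legendre_class hm.
have m0 := valP m.
have vE : val (l + m *+ 2) = val l * val m ^+ 2 by [].
have ordE : (2 %| ord p (val (l + m *+ 2)))%Z = (2 %| ord p (val l))%Z.
  rewrite vE expr2 ordM ?mulf_neq0 ?(valP l) // ordM // -mulr2n.
  rewrite [LHS]rpredDr //; apply/dvdzP; exists (p (val m)).
  by rewrite mulr_natr.
by rewrite /legendre ordE vE (asbool_equiv_eq (is_square_atM2 p (val l) m0)).
Qed.

Definition singular (S : {fset place K}) : set sqclass :=
  [set x | exists2 l : mulgrp K, x = to_mod2 l &
     forall p, p \notin S -> (2 %| ord p (val l))%Z].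

End SingularElements.

(* Nondeterministic procedures.  [outcome m a] says that a is a possible      *)
(* result of m; [feasible m] says that m can be carried out to its end, no    *)
(* matter how its choices are made.                                           *)
Record proc (A : Type) := Proc {
  feasible : Prop;
  outcome : A -> Prop
}.

Definition ret (A : Type) (a : A) : proc A :=
  {| feasible := True; outcome := fun b => b = a |}.

Definition find (A : Type) (P : A -> Prop) : proc A :=
  {| feasible := exists a, P a; outcome := P |}.

(* the claim P has to hold at this stage of the procedure *)
Definition assert (P : Prop) : proc unit :=
  {| feasible := P; outcome := fun=> True |}.

Definition bind (A B : Type) (m : proc A) (f : A -> proc B) : proc B :=
  {| feasible := feasible m /\ forall a, outcome m a -> feasible (f a);
     outcome := fun b => exists2 a, outcome m a & outcome (f a) b |}.

(* run f independently for every element of A, and collect the results *)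
Definition for_every (I : choiceType) (B : Type) (A : {fset I})
    (f : I -> proc B) : proc (I -> B) :=
  {| feasible := forall i, i \in A -> feasible (f i);
     outcome := fun g => forall i, i \in A -> outcome (f i) (g i) |}.

Notation "x <~ m ;; k" := (bind m (fun x => k))
  (at level 100, m at level 99, right associativity,
   format "'[v' x  <~  m ;; '/' k ']'").

Definition correct (A : Type) (m : proc A) (Q : A -> Prop) : Prop :=
  feasible m /\ forall a, outcome m a -> Q a.

Section Steps.
Variables (K : fieldType) (S : {fset place K}).

(* The list b_1, ..., b_m with m = dimB + numB': first B, then B'. *)
Record places := Places {
  dimB : nat;
  numB' : nat;
  pl :> 'I_(dimB + numB') -> place K
}.

Definition placeB (b : places) (i : 'I_(dimB b)) : place K :=
  b (lshift (numB' b) i).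

Definition generating_places (b : places) : Prop :=
  [/\ injective b,
      forall i, b i \notin S,
      is_basis [set: mod2 (Pic K)] (fun i => place_class2 (@placeB b i)) &
      forall x : Pic K, exists c : 'I_(dimB b + numB' b) -> int,
        x = \sum_i place_class (b i) *~ c i].

Definition compatible (n : nat) (b : 'I_n -> place K)
    (beta : 'I_n -> sqclass K) : Prop :=
  (forall i, legendre_class (beta i) (b i) = -1) /\
  (forall i j, i != j -> legendre_class (beta i) (b j) = 1).

Definition max_lin_indep (S' : {fset place K}) : Prop :=
  let indep (A : {fset place K}) :=
    lin_indep (fun s : A => place_class2 (val s)) in
  [/\ S' `<=` S, indep S' &
      forall A : {fset place K},
        S' `<=` A -> A `<=` S -> indep A -> A = S'].

(* Z^(1+t+m), its coordinates being indexed by p, T and B followed by B' *)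
Definition exponents (T : {fset place K}) (m : nat) : Type :=
  (int * {ffun T -> int} * {ffun 'I_m -> int})%type.

Definition psi (p : place K) (T : {fset place K}) (m : nat)
    (b : 'I_m -> place K) (v : exponents T m) : Pic K :=
  let: (v0, vT, vb) := v in
  place_class p *~ v0 + \sum_(t : T) place_class (val t) *~ vT t +
    \sum_(i < m) place_class (b i) *~ (2 * vb i).

Definition exponents_div (p : place K) (T : {fset place K}) (m : nat)
    (b : 'I_m -> place K) (v : exponents T m) : divisor K :=
  let: (v0, vT, vb) := v in
  << v0 *g p >> + \sum_(t : T) << vT t *g val t >> +
    \sum_(i < m) << 2 * vb i *g b i >>.

End Steps.

Arguments placeB {K} b i.

Section Procedure.
Variables (F : finFieldType) (K : fieldExtType {fraction {poly F}}).
Variable S : {fset place K}.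

Definition RR_generator (D : divisor K) (l : mulgrp K) : Prop :=
  RiemannRoch D = [set x | exists c : F, x = const K c * val l]%classic.

Definition lambda (b : places K) (beta : 'I_(dimB b) -> sqclass K)
    (S' : {fset place K}) (p : place K) : proc (sqclass K) :=
  eps <~ find (fun eps : S' -> 'F_2 =>
    place_class2 p = \sum_(s : S') eps s *: place_class2 (val s)) ;;
  let T := [fset val s | s : S' & eps s == 1] in
  v <~ find (fun v : exponents T (dimB b + numB' b) =>
    psi p b v = 0 /\ ~~ (2 %| v.1.1)%Z) ;;
  l <~ find (RR_generator (exponents_div p b v)) ;;
  e <~ find (fun e : 'I_(dimB b) -> 'F_2 =>
    forall i, (-1) ^+ e i = legendre l (placeB b i)) ;;
  ret (to_mod2 l + \sum_i e i *: beta i).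

(* The union of the two families is returned as a list, so that a repeated    *)
(* element would make it linearly dependent.                                  *)
Definition procedure : proc (seq (sqclass K)) :=
  b <~ find (generating_places S) ;;
  beta <~ find (fun beta : 'I_(dimB b) -> sqclass K =>
    is_basis (singular fset0) beta /\ compatible (placeB b) beta) ;;
  c <~ find (fun c : place K -> 'I_(dimB b) -> 'F_2 =>
    forall s, s \in S -> forall j, (-1) ^+ c s j = legendre_class (beta j) s) ;;
  _ <~ assert (forall s, s \in S ->
    place_class2 s = \sum_j c s j *: place_class2 (placeB b j)) ;;
  S' <~ find (max_lin_indep S) ;;
  if S' == S then ret (codom beta)
  else
    lam <~ for_every (S `\` S') (lambda beta S') ;;
    ret (codom beta ++ [seq lam p | p <- S `\` S']).

End Procedure.

(* Main.v *)
(** The symbol at p of an element x with even divisor only depends, as a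
    function of p, on the class of p in Pic X / 2 Pic X (reciprocity): for y
    in K^*, Zolotarev's lemma identifies the product of the symbols of x over
    the zeros of y with the signature of multiplication by x on O / yO, that
    is, with the quadratic character of the value at y = 0 of the norm of x to
    F_q(y).  The poles of y give the value at y = oo of the same norm, which
    is a constant times a square because div x is even.
    Moreover x is a square if it is one at every place: otherwise all places
    split in K(sqrt x), and pairs of effective divisors of K provide about
    m q^m effective divisors of degree m of that field, whereas the finiteness
    of its class number only allows for O(q^m).
    Thus the symbols at b_1, ..., b_n embed E into F_2^n.  Since the classes
    of order 2 in Pic^0 produce at least 2^n elements of E, this is a
    bijection: compatible bases exist and read off coordinates in
    Pic X / 2 Pic X.  Finally lambda_p has odd order at p and even order at
    the other places outside S', and an S'-singular element has an even
    divisor since S' is independent. *)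

From HB Require Import structures.
From mathcomp Require Import all_boot all_order all_fingroup all_algebra all_solvable all_field.
From mathcomp Require Import finmap boolp.
From mathcomp Require classical_sets.
From mathcomp.multinomials Require Import freeg.
From mathcomp Require Import zify ring.
Require Import Defs.

Set Implicit Arguments.
Unset Strict Implicit.
Unset Printing Implicit Defensive.

Import Order.TTheory GRing.Theory Num.Theory.
Local Open Scope quotient_scope.
Local Open Scope ring_scope.

(** * Places and weak approximation *)

Section PlaceTheory.
Variables (K : fieldType).
Implicit Types (p q : place K) (x y z : K) (N M : int).

(** Places are bare valuations on [K], so the theory of function fields is built on the way:
    existence of places, residue degrees, degree 0 of principal divisors, an inequality of Riemann.
    Dimensions over F_q are replaced by cardinalities: an index is the size of a transversal, and a
    bound on l(D) is a bound on the number of elements of L(D). The subfields F_q(t) are predicates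
    on [K] with varying t, so that norms to F_q(y) and F_q(1/y) are determinants of the same matrix
    over [K]. The norm of an even x is a constant times a square because, above an irreducible P(t),
    x becomes a unit after multiplication by a square; hence P divides the norm to an even power.
    The bound 2^n rests on an exact balance: the parity of the degree costs a factor 2 in the count
    of the 2-torsion of Pic^0, and a nonsquare constant gives it back. In step 7 the divisor
    attached to v is principal because v lies in the kernel of psi, so its Riemann-Roch space is a
    line. The order of lambda at p is odd because v_0 is, and the b_i contribute even orders only,
    none of them on S. *)

Lemma placeP p q : ord p =1 ord q -> p = q.
Proof.
case: p q => [f a b c d] [g a' b' c' d'] /= /funext e; subst g.
by congr Place; exact: Prop_irrelevance.
Qed.

Lemma smallE p N x : x != 0 -> small p N x = (N <= ord p x).
Proof. by rewrite /small => /negbTE ->. Qed.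

Lemma small_ord p x : small p (ord p x) x.
Proof. by rewrite /small lexx orbT. Qed.

Lemma ordN p x : ord p (- x) = ord p x.
Proof.
have [->|x0] := eqVneq x 0; first by rewrite oppr0.
by rewrite -mulN1r ordM ?oppr_eq0 ?oner_neq0 // ordN1 add0r.
Qed.

Lemma ordX p x n : x != 0 -> ord p (x ^+ n) = ord p x *+ n.
Proof.
move=> x0; elim: n => [|n IH]; first by rewrite expr0 ord1 mulr0n.
by rewrite exprS ordM ?expf_neq0 // IH mulrS.
Qed.

Lemma ordXz p x (n : int) : x != 0 -> ord p (x ^ n) = ord p x * n.
Proof.
move=> x0; case: n => n.
  by rewrite -exprnP ordX // -mulr_natr natz.
by rewrite NegzE -exprz_inv -exprnP ordX ?invr_eq0 // ordV // mulNrn mulrN -mulr_natr natz.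
Qed.

Lemma ord_div p x y : x != 0 -> y != 0 -> ord p (x / y) = ord p x - ord p y.
Proof. by move=> x0 y0; rewrite ordM ?invr_eq0 // ordV. Qed.

Lemma small_sum p N (I : Type) (r : seq I) (P : pred I) (f : I -> K) :
  (forall i, P i -> small p N (f i)) -> small p N (\sum_(i <- r | P i) f i).
Proof. by move=> h; apply: (big_ind (fun x : K => small p N x)) => //; [exact: small0|exact: smallD]. Qed.

Lemma smallX p N x n : small p N x -> small p (N *+ n) (x ^+ n).
Proof.
move=> h; elim: n => [|n IH]; first by rewrite mulr0n /small ord1 lexx orbT.
by rewrite mulrS exprS; apply: smallM.
Qed.

Lemma small_prodn p N (I : finType) (f : I -> K) :
  (forall i, small p N (f i)) -> small p (N *+ #|I|) (\prod_i f i).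
Proof.
move=> h; rewrite -sum1_card; apply: (big_ind2 (fun n x => small p (N *+ n) x)) => //.
- by rewrite mulr0n /small ord1 lexx orbT.
- by move=> m x n y hx hy; rewrite mulrnDr; apply: smallM.
Qed.

Lemma small1 p : small p 0 1.
Proof. by rewrite /small ord1 lexx orbT. Qed.

Lemma smallMl p N x y : small p 0 x -> small p N y -> small p N (x * y).
Proof. by move=> hx hy; rewrite -[N]add0r; apply: smallM. Qed.

Lemma ordD_lt p x y : x != 0 -> (y == 0) || (ord p x < ord p y) ->
  x + y != 0 /\ ord p (x + y) = ord p x.
Proof.
move=> x0; have [->|y0 /= lt] := eqVneq y 0; first by rewrite addr0.
have xy0 : x + y != 0.
  apply/eqP => /eqP; rewrite addr_eq0 => /eqP e.
  by move: lt; rewrite e ordN ltxx.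
split=> //; apply/le_anti/andP; split.
  have := ordD p xy0 (_ : - y != 0); rewrite oppr_eq0 addrK ordN => /(_ y0 x0).
  by rewrite ge_min => /orP[//|]; rewrite leNgt lt.
by apply: le_trans (ordD p x0 y0 xy0); rewrite le_min lexx ltW.
Qed.

Lemma ord_small_add p x y : x != 0 -> small p (ord p x + 1) y ->
  x + y != 0 /\ ord p (x + y) = ord p x.
Proof.
move=> x0 /orP h; apply: ordD_lt => //; case: h => [->//|h].
by apply/orP; right; lia.
Qed.

(** If the valuation ring of [p] were contained in that of [q], then [x / u ^ ord p x] would be a
    unit at both places, so [ord q] would be [ord q u] times [ord p]; since [ord q] takes the value
    1, the factor is 1. *)
Lemma place_sep p q : p <> q -> exists x, [/\ x != 0, 0 <= ord p x & ord q x < 0].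
Proof.
move=> npq; apply: contrapT => H; apply: npq.
have sub x : x != 0 -> 0 <= ord p x -> 0 <= ord q x.
  move=> x0 px; rewrite leNgt; apply/negP => qx; apply: H; exists x; split=> //.
have [u u0 pu] := ord_uniformizer p.
have key x : x != 0 -> ord q x = ord p x * ord q u.
  move=> x0; have ux0 : u ^ ord p x != 0 by rewrite expfz_neq0.
  have y0 : x / u ^ ord p x != 0 by rewrite mulf_neq0 ?invr_eq0.
  have py : ord p (x / u ^ ord p x) = 0 by rewrite ord_div // ordXz // pu mul1r subrr.
  have := sub _ y0; rewrite py lexx => /(_ isT) q1.
  have := sub (x / u ^ ord p x)^-1; rewrite invr_eq0 ordV // py oppr0 lexx => /(_ y0 isT).
  rewrite ordV // oppr_ge0 => q2.
  have /eqP : ord q (x / u ^ ord p x) = 0 by apply/le_anti; rewrite q1 q2.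
  by rewrite ord_div // ordXz // subr_eq0 mulrC => /eqP.
have [v v0 qv] := ord_uniformizer q.
have qu0 : 0 <= ord q u by apply: sub => //; rewrite pu.
have qu1 : ord q u = 1.
  move: (key v v0) qu0; rewrite qv; move: (ord p v) (ord q u) => a b e hb.
  have : (b %| 1)%Z by apply/dvdzP; exists a.
  by rewrite dvdz1 => /eqP; lia.
apply: placeP => x; have [->|x0] := eqVneq x 0; first by rewrite !ord_zero.
by rewrite key // qu1 mulr1.
Qed.

Lemma place_sep2 p q : p <> q -> exists z, [/\ z != 0, 0 < ord p z & ord q z < 0].
Proof.
move=> npq; have [x [x0 px qx]] := place_sep npq.
have [y [y0 qy py]] := place_sep (nesym npq).
exists (x / y); rewrite mulf_neq0 ?invr_eq0 // !ord_div //; split=> //; lia.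
Qed.

Lemma place_sep_seq p (s : seq (place K)) : p \notin s ->
  exists z, [/\ z != 0, 0 < ord p z & forall q, q \in s -> ord q z < 0].
Proof.
elim: s => [|q s IH].
  have [u u0 pu] := ord_uniformizer p.
  by move=> _; exists u; split=> //; rewrite pu.
rewrite inE negb_or => /andP[/eqP npq /IH[z [z0 pz sz]]].
have [w [w0 pw qw]] := place_sep2 npq.
have [qz|qz] := ltP (ord q z) 0.
  by exists z; split=> // q'; rewrite inE => /orP[/eqP->|/sz].
pose B := (\sum_(q' <- s) `|ord q' z|%N)%N.
(* [r] exceeds every [|ord q' z|], so at an old place [z] and [w ^+ r] have different orders: a
   nonzero multiple of [r] is too large, and 0 is not negative. *)
pose r := B.+1.
have wr0 : w ^+ r != 0 by rewrite expf_neq0.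
have rB q' : q' \in s -> (`|ord q' z| < r)%N.
  by move=> h; rewrite ltnS /B (big_rem q') //= leq_addr.
have qwr : ord q (w ^+ r) < 0 by rewrite ordX // /r mulrS; lia.
have [e1 e2] : z + w ^+ r != 0 /\ ord q (z + w ^+ r) = ord q (w ^+ r).
  by rewrite addrC; apply: ordD_lt => //; rewrite (negbTE z0) /=; lia.
exists (z + w ^+ r); split=> //.
- apply: lt_le_trans (ordD p z0 wr0 e1); rewrite lt_min pz ordX // /r mulrS; lia.
- move=> q'; rewrite inE => /orP[/eqP->|hq]; first by rewrite e2.
  have h1 := rB _ hq; have h2 := sz _ hq.
  have e : ord q' (w ^+ r) = ord q' w * r%:Z by rewrite ordX // -mulr_natr natz.
  have [lt|ge] := ltP (ord q' (w ^+ r)) (ord q' z).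
    have [|_] := @ordD_lt q' (w ^+ r) z wr0; first by rewrite lt orbT.
    by rewrite addrC => ->; apply: lt_trans lt h2.
  have [|_ ->//] := @ordD_lt q' z (w ^+ r) z0.
  rewrite lt_neqAle ge andbT; apply/orP; right.
  apply/eqP => ee; rewrite ee e abszM absz_nat in h1 h2.
  move: h1; rewrite ltnNge leq_pmull // absz_gt0.
  by apply/eqP => w00; rewrite w00 mul0r ltxx in h2.
Qed.

(** For positive [N] the witness is [1 / (1 + z ^+ N)]: close to 1 at [p], where [z] vanishes, and
    close to 0 at the poles of [z]. *)
Lemma ex_indicator p (s : seq (place K)) (N : nat) : p \notin s ->
  exists y, small p N%:Z (y - 1) /\ forall q, q \in s -> small q N%:Z y.
Proof.
move=> ps; have [z [z0 pz sz]] := place_sep_seq ps.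
pose w := z ^+ N; pose d := 1 + w.
have w0 : w != 0 by rewrite expf_neq0.
have [->|N0] := posnP N.
  exists 1; rewrite subrr small0; split=> // q _; exact: small1.
have pw : N%:Z <= ord p w by rewrite ordX // -mulr_natr natz; nia.
have [d0 pd] : d != 0 /\ ord p d = 0.
  have [|d0 e] := @ordD_lt p 1 w (oner_neq0 K).
    by rewrite ord1; apply/orP; right; lia.
  by split=> //; rewrite /d e ord1.
exists d^-1; split.
  have -> : d^-1 - 1 = - (w / d) by rewrite /d in d0 *; field.
  apply: smallN; rewrite smallE ?mulf_neq0 ?invr_eq0 // ord_div // pd; lia.
move=> q /sz qz; rewrite smallE ?invr_eq0 // ordV //.
have qw : ord q w <= - N%:Z by rewrite ordX // -mulr_natr natz; nia.
have [|_] := @ordD_lt q w 1 w0; first by rewrite ord1; apply/orP; right; lia.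
by rewrite addrC -/d => ->; lia.
Qed.

Theorem weak_approximation (s : seq (place K)) (x : place K -> K) N : uniq s ->
  exists y, forall p, p \in s -> small p N (y - x p).
Proof.
(* [M] absorbs the orders of the targets [x p] at all places of [s]: an error of order [M] in the
   indicator [e p] still has order at least [N] after multiplication by [x p]. *)
move=> us; pose M := (`|N| + \sum_(p <- s) \sum_(q <- s) `|ord q (x p)|)%N.
have bM p q : p \in s -> q \in s -> (`|N| + `|ord q (x p)| <= M)%N.
  move=> ps qs; rewrite leq_add2l (big_rem p) //= (big_rem q) //=.
  by rewrite -addnA leq_addr.
have /choice[e he] p : exists e, p \in s ->
    small p M%:Z (e - 1) /\ forall q, q \in rem p s -> small q M%:Z e.
  have [ps|ps] := boolP (p \in s); last by exists 0.
  have [|e he] := @ex_indicator p (rem p s) M; last by exists e.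
  by rewrite mem_rem_uniqF.
have mulM p q a : p \in s -> q \in s -> small q M a -> small q N (a * x p).
  move=> ps qs ha; have := smallM ha (small_ord q (x p)).
  by apply: smallW; have := bM _ _ ps qs; lia.
exists (\sum_(p <- s) e p * x p) => q qs.
rewrite (big_rem q) //= addrAC -[X in _ - X]mul1r -mulrBl.
apply: smallD; first by apply: mulM => //; case: (he q qs).
rewrite big_seq; apply: small_sum => p prem.
have ps : p \in s := mem_rem prem.
apply: mulM => //; have [_] := he p ps; apply.
move: prem; rewrite !mem_rem_uniq // !inE => /andP[npq _].
by rewrite eq_sym npq.
Qed.

(** Approximating elements [u p] of order [f p] to a precision beyond all the [f p] preserves their
    orders. *)
Lemma ex_ord_prescribed (s : seq (place K)) (f : place K -> int) : uniq s ->
  exists2 x, x != 0 & forall p, p \in s -> ord p x = f p.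
Proof.
move=> us; pose M := (\sum_(p <- s) `|f p|)%N.
have /choice[u hu] p : exists u, u != 0 /\ ord p u = f p.
  have [v v0 pv] := ord_uniformizer p; exists (v ^ f p).
  by rewrite expfz_neq0 // ordXz // pv mul1r.
have [y hy] := weak_approximation u (M.+1)%:Z us.
have key p : p \in s -> y != 0 /\ ord p y = f p.
  move=> ps; have [u0 pu] := hu p; rewrite -pu -[y](subrK (u p)) addrC.
  apply: ord_small_add => //; apply: smallW (hy _ ps); rewrite pu.
  by have : (`|f p| <= M)%N; [rewrite /M (big_rem p) //= leq_addr|lia].
have [->|/negP] := eqVneq s [::]; first by exists 1; rewrite ?oner_neq0.
case: s us M hy key => // p s us M hy key _; exists y => [|q /key[]//].
by case: (key p (mem_head _ _)).
Qed.
End PlaceTheory.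

(** * Finite maxima, pigeonhole and counting in abelian groups *)

Lemma ex_max_nat (P : nat -> Prop) N : (exists n, P n) ->
  (forall n, P n -> (n <= N)%N) -> exists2 n, P n & forall m, P m -> (m <= n)%N.
Proof.
move=> [n0 hn0] hN.
have e : exists n, `[< P n >] by exists n0; apply/asboolP.
have b n : `[< P n >] -> (n <= N)%N by move=> /asboolP/hN.
case: (ex_maxnP e b) => n /asboolP hn hm; exists n => // m Pm.
by apply: hm; apply/asboolP.
Qed.

Lemma pigeonhole_fiber (T T' : finType) (f : T -> T') : (0 < #|T'|)%N ->
  exists i, (#|T| <= #|T'| * #|[set x | f x == i]|)%N.
Proof.
move=> T'0; have [i0 _] := (card_gt0P T'0).
pose m := \max_(i : T') #|[set x | f x == i]|.
have [i hi] : exists i, m = #|[set x | f x == i]|.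
  rewrite /m; case: (@bigop.eq_bigmax T' (fun i => #|[set x | f x == i]|) T'0) => i ->.
  by exists i.
exists i; rewrite -hi -sum1_card (partition_big f predT) //= -sum_nat_const.
apply: leq_sum => j _; rewrite sum1dep_card.
exact: (@bigop.leq_bigmax T' (fun i => #|[set x | f x == i]|) j).
Qed.

Lemma card_le_fibers (T T' : finType) (f : T -> T') B :
  (forall i, (#|[set x | f x == i]| <= B)%N) -> (#|T| <= #|T'| * B)%N.
Proof.
move=> h; rewrite -sum1_card (partition_big f predT) //= -sum_nat_const.
apply: leq_sum => j _; by rewrite sum1dep_card; exact: h.
Qed.

Section Counting.
Variable A : zmodType.
Implicit Types U V W : A -> Prop.

Definition subgrp V := V 0 /\ forall x y, V x -> V y -> V (x - y).

Lemma subgrpN V x : subgrp V -> V x -> V (- x).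
Proof. by move=> [V0 VB] hx; rewrite -sub0r; apply: VB. Qed.

Lemma subgrpD V x y : subgrp V -> V x -> V y -> V (x + y).
Proof. by move=> hV hx hy; rewrite -[y]opprK; apply: (proj2 hV) => //; apply: subgrpN. Qed.

Lemma subgrp_swap V x y : subgrp V -> V (x - y) -> V (y - x).
Proof. by move=> hV /(subgrpN hV); rewrite opprB. Qed.

Lemma subgrp_trans V y x z : subgrp V -> V (x - y) -> V (y - z) -> V (x - z).
Proof. by move=> hV h1 h2; rewrite -[x](subrK y) -addrA; apply: subgrpD. Qed.

Lemma subgrp_sum V (I : Type) (r : seq I) (P : pred I) (f : I -> A) : subgrp V ->
  (forall i, P i -> V (f i)) -> V (\sum_(i <- r | P i) f i).
Proof.
move=> hV h; apply: (big_ind V) => //; first by case: hV.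
by move=> x y; exact: subgrpD.
Qed.

(** Bounds on a cardinality that make sense without knowing that the set is finite. *)
Definition atmost U (B : nat) := forall (T : finType) (r : T -> A),
  injective r -> (forall i, U (r i)) -> (#|T| <= B)%N.

Definition atleast U (B : nat) := exists (T : finType) (r : T -> A),
  [/\ injective r, forall i, U (r i) & (B <= #|T|)%N].

Definition separates V (T : Type) (r : T -> A) := forall i j, V (r i - r j) -> i = j.

Definition covers U V (T : Type) (r : T -> A) := forall x, U x -> exists i, V (x - r i).

(** A system of representatives of [U] modulo [V]; by [transversal_card] the size of a finite one
    plays the role of the index. *)
Definition transversal_of U V (T : Type) (r : T -> A) :=
  [/\ forall i, U (r i), separates V r & covers U V r].

Lemma atmost_atleast U m n : atmost U m -> atleast U n -> (n <= m)%N.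
Proof. by move=> h [T [r [ri rU nT]]]; apply: leq_trans nT (h _ _ ri rU). Qed.

Lemma atleastW U U' m n : (forall x, U x -> U' x) -> (n <= m)%N ->
  atleast U m -> atleast U' n.
Proof.
move=> s nm [T [r [ri rU mT]]]; exists T, r; split=> // [i|]; first exact: s.
exact: leq_trans mT.
Qed.

Lemma separates_covers_card U V (T T' : finType) (r : T -> A) (r' : T' -> A) :
  subgrp V -> (forall i, U (r i)) -> separates V r -> covers U V r' -> (#|T| <= #|T'|)%N.
Proof.
move=> hV rU sr /(_ _ (rU _)) c.
have [f hf] := choice c.
apply: (@leq_card _ _ f) => i j eij; apply: sr.
by apply: (subgrp_trans hV (hf i)); rewrite eij; apply: subgrp_swap.
Qed.

Lemma transversal_card U V (T T' : finType) (r : T -> A) (r' : T' -> A) :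
  subgrp V -> transversal_of U V r -> transversal_of U V r' -> #|T| = #|T'|.
Proof.
move=> hV [a1 b1 c1] [a2 b2 c2]; apply/eqP; rewrite eqn_leq.
by rewrite (separates_covers_card hV a1 b1 c2) (separates_covers_card hV a2 b2 c1).
Qed.

(** The elements of [U] fall into at most [#|T'|] classes modulo [W], and subtracting a fixed
    element of a class embeds that class into [V]. *)
Lemma atmost_ext U V W (T' : finType) (r' : T' -> A) B : subgrp W ->
  covers U W r' -> (forall x y, U x -> U y -> W (x - y) -> V (x - y)) ->
  atmost V B -> atmost U (#|T'| * B).
Proof.
move=> hW c UWV aV T r ri rU.
have [f hf] := choice (fun i => c _ (rU i)).
apply: (@card_le_fibers _ _ f) => i.
have [->|/set0Pn[x0]] := eqVneq [set x | f x == i] set0; first by rewrite cards0.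
rewrite inE => /eqP fx0.
have := aV {x | x \in [set x | f x == i]} (fun x => r (val x) - r x0).
rewrite card_sig; apply=> [x y /(addIr _)/ri|x]; first exact: val_inj.
apply: UWV => //; apply: (subgrp_trans hW (hf _)).
by case: x => x /=; rewrite inE => /eqP ->; rewrite -fx0; apply: subgrp_swap.
Qed.

(** The count of [atmost_ext] read backwards: by pigeonhole one class modulo [W] contains at least
    [B] elements of [U]. *)
Lemma atleast_sub U V W (T' : finType) (r' : T' -> A) B : subgrp W -> (0 < #|T'|)%N ->
  covers U W r' -> (forall x y, U x -> U y -> W (x - y) -> V (x - y)) -> V 0 ->
  atleast U (#|T'| * B) -> atleast V B.
Proof.
move=> hW T'0 c UWV V0 [T [r [ri rU hT]]].
have [f hf] := choice (fun i => c _ (rU i)).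
have [i hi] := pigeonhole_fiber f T'0.
have hB : (B <= #|[set x | f x == i]|)%N.
  by rewrite -(leq_pmul2l T'0); apply: leq_trans hT hi.
have [e0|/set0Pn[x0]] := eqVneq [set x | f x == i] set0.
  exists void, (fun=> 0); split=> [[]|//|].
  by move: hB; rewrite e0 cards0 card_void.
rewrite inE => /eqP fx0.
exists {x | x \in [set x | f x == i]}, (fun x => r (val x) - r x0); split.
- by move=> x y /(addIr _)/ri; exact: val_inj.
- move=> x; apply: UWV => //; apply: (subgrp_trans hW (hf _)).
  by case: x => x /=; rewrite inE => /eqP ->; rewrite -fx0; apply: subgrp_swap.
- by rewrite card_sig.
Qed.

Lemma atleast_nonzero V : atleast V 2 -> exists2 x, V x & x != 0.
Proof.
move=> [T [r [ri rV hT]]].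
have /card_gt1P[x [y [_ _ nxy]]] : (1 < #|T|)%N by [].
have [e|e] := eqVneq (r x) 0; last by exists (r x).
by exists (r y) => //; rewrite -e eq_sym; apply: contra_neq nxy => /ri.
Qed.

End Counting.

(** * Vector spaces over the finite constant field *)

Section FiniteFieldSpaces.
Variables (F : finFieldType) (K : fieldType) (kap : {rmorphism F -> K}).
Implicit Types U V : K -> Prop.

Definition Fsub V := subgrp V /\ forall c x, V x -> V (kap c * x).

Definition lincomb d (u : 'I_d -> K) (c : 'cV[F]_d) : K := \sum_i kap (c i 0) * u i.

Lemma lincombB d (u : 'I_d -> K) c c' : lincomb u (c - c') = lincomb u c - lincomb u c'.
Proof. by rewrite /lincomb -sumrB; apply: eq_bigr => i _; rewrite !mxE rmorphB mulrBl. Qed.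

Lemma lincomb0 d (u : 'I_d -> K) : lincomb u 0 = 0.
Proof. by rewrite /lincomb big1 // => i _; rewrite mxE rmorph0 mul0r. Qed.

Lemma Fsub_lincomb V d (u : 'I_d -> K) c : Fsub V -> (forall i, V (u i)) -> V (lincomb u c).
Proof. by move=> [hV sV] hu; apply: subgrp_sum => // i _; apply: sV. Qed.

Definition indep_mod V d (u : 'I_d -> K) := forall c, V (lincomb u c) -> c = 0.

Lemma card_cV d : #|{: 'cV[F]_d}| = (#|F| ^ d)%N.
Proof. by rewrite card_mx muln1. Qed.

Lemma indep_separates V d (u : 'I_d -> K) : indep_mod V u -> separates V (lincomb u).
Proof. by move=> h i j; rewrite -lincombB => /h/eqP; rewrite subr_eq0 => /eqP. Qed.

(** An independent family of maximal length spans: a further [x] gives a relation modulo [V], whose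
    coefficient at [x] cannot vanish and is divided out. *)
Lemma Fsub_basis U V N : Fsub U -> Fsub V ->
  (forall d (u : 'I_d -> K), (forall i, U (u i)) -> indep_mod V u -> (d <= N)%N) ->
  exists d (u : 'I_d -> K), [/\ (d <= N)%N, forall i, U (u i), indep_mod V u &
    transversal_of U V (lincomb u)].
Proof.
move=> hU hV hN.
pose P d := exists u : 'I_d -> K, (forall i, U (u i)) /\ indep_mod V u.
have [||d [u [uU iu]] dmax] := @ex_max_nat P N.
- exists 0%N; exists (fun=> 0); split=> [i|c _]; first by case: (proj1 hU).
  by apply/matrixP => -[].
- by move=> n [u [h1 h2]]; exact: hN h1 h2.
exists d, u; split=> //; first exact: hN uU iu.
split; [by move=> c; apply: Fsub_lincomb|exact: indep_separates|].
move=> x Ux; apply: contrapT => nx.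
suff /dmax : P d.+1 by rewrite ltnn.
exists (fun i => if unlift ord0 i is Some j then u j else x); split.
  by move=> i; case: unliftP => [j|] _.
move=> c; rewrite /lincomb big_ord_recl /= unlift_none.
under eq_bigr => i _ do rewrite liftK.
move=> h.
have c0 : c ord0 0 = 0.
  apply/eqP/negPn/negP => c0; apply: nx.
  exists (- (c ord0 0)^-1 *: \col_i c (fintype.lift ord0 i) 0).
  have := proj2 hV (c ord0 0)^-1 _ h; congr V.
  rewrite mulrDr mulrA -rmorphM mulVf // rmorph1 mul1r; congr (_ + _).
  rewrite mulr_sumr /lincomb -sumrN; apply: eq_bigr => i _.
  by rewrite !mxE rmorphM rmorphN !mulNr opprK mulrA.
have /iu e : V (lincomb u (\col_i c (fintype.lift ord0 i) 0)).
  move: h; rewrite c0 rmorph0 mul0r add0r; congr V.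
  by apply: eq_bigr => i _; rewrite mxE.
apply/matrixP => i j; rewrite (zmodp.ord1 j) mxE; case: (unliftP ord0 i) => [k ->|->//].
by have /matrixP/(_ k 0) := e; rewrite !mxE.
Qed.

End FiniteFieldSpaces.

(** * Function fields in one variable *)

Section FunctionField.
Variables (F : finFieldType) (K : fieldType) (kap : {rmorphism F -> K}).
Implicit Types (t x y z : K).

Definition pev t (a : {poly F}) : K := horner_eval t (map_poly kap a).

HB.instance Definition _ t := GRing.RMorphism.copy (pev t) (horner_eval t \o map_poly kap).

Arguments pev t a : simpl never.

Lemma pevC t c : pev t c%:P = kap c.
Proof. by rewrite /pev map_polyC /= /horner_eval hornerC. Qed.

Lemma pevX t : pev t 'X = t.
Proof. by rewrite /pev map_polyX /horner_eval hornerX. Qed.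

Lemma pevZ t c a : pev t (c *: a) = kap c * pev t a.
Proof. by rewrite -mul_polyC rmorphM /= pevC. Qed.

Lemma pevE t a : pev t a = \sum_(i < size a) kap a`_i * t ^+ i.
Proof.
rewrite -{1}[a]coefK poly_def rmorph_sum; apply: eq_bigr => i _.
by rewrite /= pevZ rmorphXn /= pevX.
Qed.

Definition transc t := forall a, pev t a = 0 -> a = 0.

(** Linear algebra over F(t) with denominators cleared: for transcendental [t], the notions [tindep]
    and [tspan] below are independence and generation over F(t). *)
Definition tcomb t d (u : 'I_d -> K) (a : 'I_d -> {poly F}) := \sum_i pev t (a i) * u i.

Definition tindep t d (u : 'I_d -> K) :=
  forall a, tcomb t u a = 0 -> forall i, a i = 0.

Definition tspan t d (u : 'I_d -> K) :=
  forall z, exists b a, pev t b != 0 /\ pev t b * z = tcomb t u a.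

(** No particular [t] is singled out, because degrees and norms are taken with respect to varying
    rational subfields. *)
Definition ffield := exists t n (w : 'I_n -> K), transc t /\ tspan t w.

Definition lattice t d (u : 'I_d -> K) l x :=
  exists a : 'I_d -> {poly F}, (forall i, (size (a i) <= l)%N) /\ x = tcomb t u a.

Section Lattice.
Variables (t : K) (n : nat) (w : 'I_n -> K).
Local Notation Lat := (lattice t w).

Lemma latticeW l l' x : (l <= l')%N -> Lat l x -> Lat l' x.
Proof. by move=> ll [a [ha ->]]; exists a; split=> // i; apply: leq_trans ll. Qed.

Lemma lattice0 l : Lat l 0.
Proof.
exists (fun=> 0); split=> [i|]; first by rewrite size_poly0.
by rewrite /tcomb big1 // => i _; rewrite rmorph0 mul0r.
Qed.

Lemma latticeD l x y : Lat l x -> Lat l y -> Lat l (x + y).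
Proof.
move=> [a [ha ->]] [b [hb ->]]; exists (fun i => a i + b i); split.
  by move=> i; apply: leq_trans (size_polyD _ _) _; rewrite geq_max ha hb.
by rewrite /tcomb -big_split; apply: eq_bigr => i _; rewrite rmorphD mulrDl.
Qed.

Lemma lattice_sum l (I : Type) (r : seq I) (P : pred I) (f : I -> K) :
  (forall i, P i -> Lat l (f i)) -> Lat l (\sum_(i <- r | P i) f i).
Proof.
by move=> h; apply: (big_ind (Lat l)) => //; [exact: lattice0|exact: latticeD].
Qed.

Lemma latticeM l (b : {poly F}) x : Lat l x -> Lat (size b + l) (pev t b * x).
Proof.
move=> [a [ha ->]]; exists (fun i => b * a i); split=> [i|].
  apply: leq_trans (size_polyMleq _ _) _; apply: leq_trans (leq_pred _) _.
  by rewrite leq_add2l.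
by rewrite /tcomb mulr_sumr; apply: eq_bigr => i _; rewrite rmorphM mulrA.
Qed.

Lemma latticeZ l c x : Lat l x -> Lat l (kap c * x).
Proof.
move=> [a [ha ->]]; exists (fun i => c *: a i); split=> [i|].
  by apply: leq_trans (size_scale_leq _ _) _.
by rewrite /tcomb mulr_sumr; apply: eq_bigr => i _; rewrite pevZ mulrA.
Qed.

Lemma lattice_denominator m (z : 'I_m -> K) : tspan t w ->
  exists D l, pev t D != 0 /\ forall i, Lat l (pev t D * z i).
Proof.
move=> hw.
have /choice[b hb] i : exists b, pev t b != 0 /\ exists l, Lat l (pev t b * z i).
  have [b [a [b0 e]]] := hw (z i); exists b; split=> //.
  exists (\max_i size (a i))%N; exists a; split=> // j.
  exact: (@bigop.leq_bigmax _ (fun i => size (a i))).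
pose D := \prod_i b i; exists D.
have D0 : pev t D != 0.
  by rewrite rmorph_prod; apply/prodf_neq0 => i _; case: (hb i).
have /choice[l hl] i : exists l, Lat l (pev t D * z i).
  have [_ [l hl]] := hb i.
  exists (size (\prod_(j | j != i) b j)%R + l)%N.
  have -> : D = b i * \prod_(j | j != i) b j by rewrite /D (bigD1 i).
  rewrite rmorphM /= mulrAC mulrC; exact: latticeM.
exists (\max_i l i)%N; split=> // i; apply: latticeW (hl i).
exact: (@bigop.leq_bigmax _ l).
Qed.

Lemma lattice_matrix l x : Lat l x ->
  exists M : 'M[F]_(n, l), x = tcomb t w (fun i => rVpoly (row i M)).
Proof.
move=> [a [ha ->]]; exists (\matrix_i poly_rV (a i)).
by apply: eq_bigr => i _; rewrite rowK poly_rV_K.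
Qed.

Lemma dependent_of_growth t' m (z : 'I_m -> K) c c0 : (n * c < m)%N ->
  (forall s, exists2 E, E != 0 & forall a : 'I_m -> {poly F}, (forall k, (size (a k) <= s)%N) ->
     Lat (c0 + s * c) (E * tcomb t' z a)) -> ~ tindep t' z.
Proof.
move=> ncm growth ind; pose s := (n * c0).+1.
have [E E0 hE] := growth s.
pose P (M : 'M[F]_(m, s)) k := rVpoly (row k M).
have /choice[f hf] M : exists M' : 'M[F]_(n, c0 + s * c),
    E * tcomb t' z (P M) = tcomb t w (fun i => rVpoly (row i M')).
  by apply: lattice_matrix; apply: hE => k; exact: size_poly.
have injf : injective f.
  move=> M N eMN; have : E * tcomb t' z (P M) = E * tcomb t' z (P N) by rewrite !hf eMN.
  move/(mulfI E0)/eqP; rewrite -subr_eq0 -sumrB => /eqP e.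
  apply/row_matrixP => k; apply: (can_inj rVpolyK); apply/eqP; rewrite -subr_eq0.
  apply/eqP; apply: (ind (fun k => P M k - P N k)); rewrite -[RHS]e.
  by apply: eq_bigr => i _; rewrite rmorphB mulrBl.
have := leq_card f injf; rewrite !card_mx leq_exp2l ?finNzRing_gt1 //.
rewrite leqNgt => /negP; apply.
have := leq_mul ncm (leqnn s); rewrite /s; nia.
Qed.

End Lattice.

(** Here [t] is unrelated to the element [t0] provided by [ffield]. Multiplication by
    [pev t0 D1 * t] maps combinations of [w] to combinations of [w] and raises their length by at
    most [c], so polynomials of length s in [t] cost about s c, and the dependence count applies. *)
Lemma ffield_rank_bounded t : ffield ->
  exists r, forall d (u : 'I_d -> K), tindep t u -> (d <= r)%N.
Proof.
move=> [t0 [n [w [_ hw]]]].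
have [D1 [c1 [D10 hD1]]] := lattice_denominator (fun j => t * w j) hw.
pose c := (c1 + size D1)%N; exists (n * c)%N => d z ind.
rewrite leqNgt; apply/negP => ncd.
have [D0 [c0 [D00 hD0]]] := lattice_denominator z hw.
apply: (@dependent_of_growth t0 n w t d z c c0 ncd _ ind) => s.
exists (pev t0 D0 * pev t0 D1 ^+ s); first by rewrite mulf_neq0 ?expf_neq0.
have step1 l x : lattice t0 w l x -> lattice t0 w (l + c) (pev t0 D1 * x).
  by move=> /(latticeM D1); apply: latticeW; rewrite /c; lia.
have step2 l x : lattice t0 w l x -> lattice t0 w (l + c) (pev t0 D1 * (t * x)).
  move=> [a [ha ->]]; rewrite /tcomb !mulr_sumr; apply: lattice_sum => j _.
  rewrite (_ : _ * _ = pev t0 (a j) * (pev t0 D1 * (t * w j))); last by ring.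
  apply: latticeW (latticeM (a j) (hD1 j)); rewrite /c; have := ha j; lia.
have steps l x s' i : (i <= s')%N -> lattice t0 w l x ->
    lattice t0 w (l + s' * c) (pev t0 D1 ^+ s' * (t ^+ i * x)).
  move=> + hx; elim: s' i => [|s' IH] [|i] // his.
  - by rewrite !expr0 !mul1r mul0n addn0.
  - rewrite exprS -mulrA mulSn [(c + _)%N]addnC addnA; apply: step1; exact: IH.
  - rewrite (_ : _ * _ = pev t0 D1 * (t * (pev t0 D1 ^+ s' * (t ^+ i * x)))); last first.
      by rewrite !exprS; ring.
    by rewrite mulSn [(c + _)%N]addnC addnA; apply: step2; exact: IH.
move=> a ha; rewrite mulr_sumr; apply: lattice_sum => k _.
rewrite (pevE t) mulr_suml mulr_sumr; apply: lattice_sum => i _.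
rewrite (_ : _ * _ = kap (a k)`_i * (pev t0 D1 ^+ s * (t ^+ i * (pev t0 D0 * z k)))); last by ring.
by apply/latticeZ/steps => //; apply: ltnW; apply: leq_trans (ha k).
Qed.

Lemma tspan_rank t n (w : 'I_n -> K) d (u : 'I_d -> K) :
  tspan t w -> tindep t u -> (d <= n)%N.
Proof.
move=> hw ind; have [D0 [c0 [D00 hD0]]] := lattice_denominator u hw.
rewrite leqNgt; apply/negP => nd.
apply: (@dependent_of_growth t n w t d u 1 c0 _ _ ind); first by rewrite muln1.
move=> s; exists (pev t D0) => // a ha; rewrite mulr_sumr; apply: lattice_sum => k _.
rewrite mulrCA; apply: latticeW (latticeM _ (hD0 k)).
by have := ha k; lia.
Qed.

(* A common factor 'X of the coefficients can be divided out.                 *)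
Lemma tindep_const t d (u : 'I_d -> K) : t != 0 ->
  (forall a, tcomb t u a = 0 -> forall i, (a i)`_0 = 0) -> tindep t u.
Proof.
move=> t0 hc a.
have [s hs] : exists s, forall i, (size (a i) <= s)%N.
  by exists (\max_i size (a i))%N => i; exact: (@bigop.leq_bigmax _ (fun i => size (a i))).
elim: s a hs => [|s IH] a hs ea i.
  by apply/eqP; rewrite -size_poly_eq0 -leqn0.
have ap k : a k = drop_poly 1 (a k) * 'X.
  apply/polyP => -[|j]; rewrite coefMX /= ?coef_drop_poly ?addn1 //.
  exact: hc.
rewrite ap (IH (fun k => drop_poly 1 (a k))) ?mul0r // => [k|].
  by rewrite size_drop_poly; have := hs k; lia.
apply: (mulIf t0); rewrite mul0r -[RHS]ea mulr_suml; apply: eq_bigr => k _.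
by rewrite [in RHS]ap rmorphM /= pevX; ring.
Qed.

Lemma pev_const_term t a : pev t a = kap a`_0 + pev t (drop_poly 1 a) * t.
Proof.
have {1}-> : a = (a`_0)%:P + drop_poly 1 a * 'X.
  apply/polyP => -[|k]; rewrite coefD coefC coefMX /= ?addr0 ?add0r //.
  by rewrite coef_drop_poly addn1.
by rewrite rmorphD rmorphM /= pevC pevX.
Qed.

Definition tbasis t n (u : 'I_n -> K) := tindep t u /\ tspan t u.

Lemma tindep_max t d (u : 'I_d -> K) : transc t -> tindep t u ->
  (forall d' (v : 'I_d' -> K), tindep t v -> (d' <= d)%N) -> tbasis t u.
Proof.
move=> trt ind dmax; split=> // z.
pose v i := if unlift ord0 i is Some j then u j else z.
have : ~ tindep t v by move/dmax; rewrite ltnn.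
move=> /existsNP[a /not_implyP[]]; rewrite /tcomb big_ord_recl {1}/v unlift_none.
move=> e /existsNP[i /eqP ai].
have e' : pev t (a ord0) * z + tcomb t u (fun i => a (fintype.lift ord0 i)) = 0.
  rewrite -[RHS]e; congr (_ + _); apply: eq_bigr => j _.
  by rewrite /v liftK.
exists (a ord0), (fun i => - a (fintype.lift ord0 i)); split; last first.
  transitivity (- tcomb t u (fun i => a (fintype.lift ord0 i))).
    by apply/eqP; rewrite -addr_eq0 e'.
  by rewrite /tcomb -sumrN; apply: eq_bigr => j _; rewrite rmorphN mulNr.
apply: contra ai => /eqP a0; rewrite a0 mul0r add0r in e'.
have := ind _ e'; case: (unliftP ord0 i) => [j ->|->] h; first by rewrite h.
by apply/eqP; apply: trt.
Qed.

Lemma ex_tbasis t : ffield -> transc t -> exists n (u : 'I_n -> K), tbasis t u.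
Proof.
move=> ffK trt; have [r hr] := ffield_rank_bounded t ffK.
have [||n [u ind] nmax] := @ex_max_nat (fun d => exists u : 'I_d -> K, tindep t u) r.
- by exists 0%N, (fun=> 0) => a _ [].
- by move=> d [u]; exact: hr.
by exists n, u; apply: tindep_max => // d v hv; apply: nmax; exists v.
Qed.

Lemma tbasis_of_tindep t n (u v : 'I_n -> K) : transc t -> tbasis t u -> tindep t v ->
  tbasis t v.
Proof. by move=> trt [_ su] iv; apply: tindep_max => // d w; apply: tspan_rank. Qed.

End FunctionField.

(** * Maximal subrings and valuation rings *)

Section ValuationRings.
Variable K : fieldType.
Implicit Types (A R V : K -> Prop) (x y z : K).

Definition subring_pred A :=
  [/\ A 1, forall x y, A x -> A y -> A (x - y) & forall x y, A x -> A y -> A (x * y)].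

Lemma subring_subgrp A : subring_pred A -> subgrp A.
Proof. by move=> [A1 AB _]; split=> //; rewrite -(subrr 1); apply: AB. Qed.

Lemma subringX A x n : subring_pred A -> A x -> A (x ^+ n).
Proof.
move=> [A1 _ AM] hx; elim: n => [|n IH]; first by rewrite expr0.
by rewrite exprS; apply: AM.
Qed.

(** The elements of A[z] of degree at most [n] in [z]; the degree is recorded because the valuation
    argument below minimizes it. *)
Definition adjoin A z n x :=
  exists g : {poly K}, [/\ (size g <= n.+1)%N, forall i, A g`_i & x = g.[z]].

Lemma adjoin_subring A z : subring_pred A -> subring_pred (fun x => exists n, adjoin A z n x).
Proof.
move=> hA; have [A1 AB AM] := hA; have hA' := subring_subgrp hA.
split.
- exists 0%N, 1; rewrite size_poly1 hornerE; split=> // i.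
  by rewrite coef1; case: eqP => // _; case: hA'.
- move=> x y [n [g [sg Ag ->]]] [m [h [sh Ah ->]]].
  exists (maxn n m), (g - h); split=> [|i|].
  + apply: leq_trans (size_polyD _ _) _; rewrite size_polyN geq_max.
    by rewrite (leq_trans sg) ?ltnS ?leq_maxl // (leq_trans sh) ?ltnS ?leq_maxr.
  + by rewrite coefB; apply: AB.
  + by rewrite !hornerE.
- move=> x y [n [g [sg Ag ->]]] [m [h [sh Ah ->]]].
  exists (n + m)%N, (g * h); split=> [|i|].
  + by apply: leq_trans (size_polyMleq _ _) _; lia.
  + by rewrite coefM; apply: subgrp_sum => // j _; apply: AM.
  + by rewrite hornerM.
Qed.

Lemma adjoin_incl A z x : subring_pred A -> A x -> adjoin A z 0 x.
Proof.
move=> hA Ax; exists x%:P; rewrite hornerC; split=> // [|i].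
  exact: size_polyC_leq1.
by rewrite coefC; case: eqP => // _; case: (subring_subgrp hA).
Qed.

Lemma adjoin_gen A z : subring_pred A -> adjoin A z 1 z.
Proof.
move=> hA; exists 'X; rewrite hornerX size_polyX; split=> // i.
by rewrite coefX; case: eqP => _; [case: hA|case: (subring_subgrp hA)].
Qed.

Lemma ex_maximal_subring A y : subring_pred A -> ~ A y ->
  exists R, [/\ subring_pred R, forall x, A x -> R x, ~ R y &
    forall R', subring_pred R' -> (forall x, R x -> R' x) -> ~ R' y -> forall x, R' x -> R x].
Proof.
move=> hA nAy; pose good R := [/\ subring_pred R, forall x, A x -> R x & ~ R y].
pose P : classical_sets.set (classical_sets.set K) := fun B => (forall x, ~ B x) \/ good B.
have [C CP tC|R [hR Rmax]] := @classical_sets.Zorn_bigcup K P.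
  have [[B CB [b Bb]]|noB] := pselect (exists2 B, C B & exists b, B b); last first.
    by left=> x [B CB Bx]; apply: noB; exists B => //; exists x.
  right; have ne B' b' : C B' -> B' b' -> good B'.
    by move=> CB' Bb'; case: (CP _ CB') => // /(_ b').
  have [[B1 BB BM] AB nBy] := ne _ _ CB Bb.
  split; [split|..].
  - by exists B.
  - move=> u v [B1' C1 u1] [B2' C2 v2].
    have [s|s] := tC _ _ C1 C2.
      by exists B2' => //; case: (ne _ _ C2 v2) => -[_ h _] _ _; apply: h => //; apply: s.
    by exists B1' => //; case: (ne _ _ C1 u1) => -[_ h _] _ _; apply: h => //; apply: s.
  - move=> u v [B1' C1 u1] [B2' C2 v2].
    have [s|s] := tC _ _ C1 C2.
      by exists B2' => //; case: (ne _ _ C2 v2) => -[_ _ h] _ _; apply: h => //; apply: s.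
    by exists B1' => //; case: (ne _ _ C1 u1) => -[_ _ h] _ _; apply: h => //; apply: s.
  - by move=> x Ax; exists B => //; apply: AB.
  - by move=> [B' CB' B'y]; case: (ne _ _ CB' B'y).
have hRg : good R.
  case: hR => // R0; exfalso; apply: (Rmax A); last by right; split.
  split; first by move=> x /R0.
  by move=> /(_ 1) h; apply: (R0 1); apply: h; case: hA.
case: hRg => R1 AR nRy; exists R; split=> // R' hR' RR' nR'y x R'x.
apply: contrapT => nRx; apply: (Rmax R'); first by split=> // /(_ x R'x).
by right; split=> // u /AR /RR'.
Qed.

(** Inverting [1 - y * r] does not produce [y^-1], so by maximality these elements are units of [R].
    If neither [z] nor [z^-1] were in [R], then [y^-1] would lie in both R[z] and R[z^-1]; among the
    expressions of minimal degree, the shorter one lowers the degree of the longer one. *)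
Lemma maximal_subring_valuation R y : subring_pred R -> R y -> ~ R y^-1 ->
  (forall R', subring_pred R' -> (forall x, R x -> R' x) -> ~ R' y^-1 -> forall x, R' x -> R x) ->
  forall z, R z \/ R z^-1.
Proof.
move=> hR Ry nRy Rmax z; have [R1 RB RM] := hR; have hR' := subring_subgrp hR.
have y0 : y != 0 by apply: contra_notN nRy => /eqP e; rewrite e invr0 -e.
have unit1 r : R r -> 1 - y * r != 0 /\ R (1 - y * r)^-1.
  move=> Rr; set w := 1 - _.
  have Rw : R w by apply: RB => //; apply: RM.
  have w0 : w != 0.
    apply: contra_notN nRy; rewrite subr_eq0 => /eqP e.
    by rewrite -[y^-1]mulr1 e mulKf.
  split=> //; pose R' x := exists k, R (x * w ^+ k).
  have hx k : exists2 r', R r' & w ^+ k = 1 - y * r'.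
    elim: k => [|k [r' Rr' e]]; first by exists 0; [case: hR'|rewrite mulr0 subr0].
    exists (r' + r - y * r' * r); last by rewrite exprS e /w; ring.
    by apply: RB; [apply: subgrpD|apply: (RM) => //; apply: RM].
  apply: (Rmax R'); last by exists 1%N; rewrite expr1 mulVf.
  - split.
    + by exists 0%N; rewrite mulr1.
    + move=> u v [k hk] [l hl]; exists (k + l)%N.
      have -> : (u - v) * w ^+ (k + l) = u * w ^+ k * w ^+ l - v * w ^+ l * w ^+ k.
        by rewrite exprD; ring.
      by apply: RB; apply: RM => //; apply: subringX.
    + move=> u v [k hk] [l hl]; exists (k + l)%N.
      by rewrite exprD mulrACA; apply: RM.
  - by move=> u hu; exists 0%N; rewrite mulr1.
  - move=> [k]; have [r' Rr' ->] := hx k.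
    rewrite mulrBr mulr1 mulKf // => h; apply: nRy.
    by rewrite -[y^-1](subrK r'); apply: subgrpD.
apply: contrapT => /not_orP[nz nz'].
have adj u : ~ R u -> exists n, adjoin R u n y^-1.
  move=> nu; apply: contrapT => na; apply: nu.
  apply: (Rmax _ (adjoin_subring u hR)) => //.
    by move=> x Rx; exists 0%N; apply: adjoin_incl.
  by exists 1%N; apply: adjoin_gen.
have minadj u : ~ R u -> exists2 n, adjoin R u n y^-1 &
    forall m, (m < n)%N -> ~ adjoin R u m y^-1.
  move=> /adj[n hn].
  have ex : exists n, `[< adjoin R u n y^-1 >] by exists n; apply/asboolP.
  case: (ex_minnP ex) => m /asboolP hm mm; exists m => // k km /asboolP/mm.
  by rewrite leqNgt km.
wlog: z nz nz' / exists n m, [/\ (m <= n)%N, adjoin R z n y^-1, adjoin R z^-1 m y^-1 &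
    forall k, (k < n)%N -> ~ adjoin R z k y^-1].
  have [n hn mn] := minadj _ nz; have [m hm mm] := minadj _ nz'.
  have [mlen|nltm] := leqP m n; move=> wl.
    by apply: (wl z) => //; exists n, m; split.
  apply: (wl z^-1); rewrite ?invrK //; exists m, n; split=> //.
  exact: ltnW.
move=> [n [m [mn [g [sg Rg eg]] [h [sh Rh eh]] nmin]]].
have z0 : z != 0 by apply: contra_notN nz => /eqP ->; case: hR'.
have n0 : (0 < n)%N.
  rewrite lt0n; apply: contra_notN nRy => /eqP n0.
  move: sg eg; rewrite n0 => /size1_polyC -> ->; rewrite hornerC.
  exact: Rg.
have [w0 Rw] := unit1 _ (Rh 0%N).
pose c j := y * h`_j / (1 - y * h`_0).
have Rc j : R (c j) by apply: (RM) => //; apply: RM.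
(* This is [y^-1 = h.[z^-1]] multiplied by [z ^+ n]. The term in [z ^+ n] coming from the constant
   coefficient of [h] is moved to the left, where the total coefficient is [y^-1] times a unit of
   [R]. *)
have zn : z ^+ n = \sum_(i < n) c (n - i)%N * z ^+ i.
  apply: (mulfI w0); apply: (mulfI (invr_neq0 y0)).
  have e1 : y^-1 * z ^+ n = \sum_(i < n.+1) h`_(n - i) * z ^+ i.
    rewrite eh (horner_coef_wide _ (leq_trans sh (_ : m < n.+1)%N)) ?ltnS // mulr_suml.
    rewrite (reindex_inj rev_ord_inj) /=; apply: eq_bigr => i _.
    rewrite subSS -mulrA; congr (_ * _).
    have /ltnSE ni := ltn_ord i.
    have -> : z ^+ n = z ^+ (n - i) * z ^+ i by rewrite -exprD subnK.
    by rewrite exprVn mulKf ?expf_neq0.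
  rewrite mulrA mulrBr mulr1 mulKf // mulrBl e1 big_ord_recr /= subnn addrK.
  rewrite mulrA !mulr_sumr; apply: eq_bigr => i _.
  by rewrite mulrA; congr (_ * _); rewrite /c; field; rewrite w0.
have /nmin : (n.-1 < n)%N by rewrite prednK.
apply.
exists (\poly_(i < n) (g`_i + g`_n * c (n - i)%N)); split=> [|i|].
- by rewrite prednK // size_poly.
- rewrite coef_poly; case: ltnP => _; last by case: hR'.
  by apply: subgrpD => //; apply: RM.
- rewrite eg (horner_coef_wide _ sg) big_ord_recr /= zn horner_poly mulr_sumr -big_split.
  by apply: eq_bigr => i _ /=; rewrite mulrDl mulrA.
Qed.

End ValuationRings.

(** * Valuation rings of function fields are discrete *)

Section DiscreteValuation.
Variables (F : finFieldType) (K : fieldType) (kap : {rmorphism F -> K}).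
Hypothesis ffK : ffield kap.
Variable V : K -> Prop.
Hypotheses (hV : subring_pred V) (Vval : forall z, V z \/ V z^-1) (Vkap : forall c, V (kap c)).
Implicit Types (x y z : K).

Let hVg := subring_subgrp hV.
Let VM x y : V x -> V y -> V (x * y). Proof. by case: hV => _ _; apply. Qed.
Let V1 : V 1. Proof. by case: hV. Qed.

Let nonunit x := x = 0 \/ (V x /\ ~ V x^-1).

Let nonunitV x : nonunit x -> V x.
Proof. by move=> [->|[]//]; case: (subring_subgrp hV). Qed.

Let nonunitMl x y : V x -> nonunit y -> nonunit (x * y).
Proof.
move=> Vx [->|[Vy ny]]; first by left; rewrite mulr0.
have [->|x0] := eqVneq x 0; first by left; rewrite mul0r.
right; split; first exact: VM.
rewrite invfM => h; apply: ny; rewrite -[y^-1](mulVKf x0).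
exact: VM.
Qed.

Let nonunitD x y : nonunit x -> nonunit y -> nonunit (x + y).
Proof.
wlog Vxy : x y / V (x / y) => [wl hx hy|].
  have [|h] := Vval (x / y); first by move/wl; apply.
  by rewrite addrC; apply: wl => //; rewrite invf_div in h.
have [->|y0] := eqVneq y 0; first by rewrite addr0.
move=> _ hy; have -> : x + y = (x / y + 1) * y by rewrite mulrDl divfK // mul1r.
by apply: nonunitMl => //; apply: subgrpD.
Qed.

Let nonunitN x : nonunit x -> nonunit (- x).
Proof. by rewrite -mulN1r => h; apply: nonunitMl => //; apply: subgrpN. Qed.

Let nonunit_sum (I : Type) (r : seq I) (P : pred I) (f : I -> K) :
  (forall i, P i -> nonunit (f i)) -> nonunit (\sum_(i <- r | P i) f i).
Proof. by move=> h; apply: (big_ind nonunit) => //; left. Qed.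

Let nonunit1 : ~ nonunit 1.
Proof. by move=> [/eqP|[_]]; [rewrite oner_eq0|rewrite invr1]. Qed.

Let Vpev x a : V x -> V (pev kap x a).
Proof.
move=> Vx; rewrite pevE; apply: subgrp_sum => // i _.
by apply: VM => //; apply: subringX.
Qed.

(** In a relation, let [j0] be the last index whose coefficient has a nonzero constant term, and
    divide by [z j0]. Earlier terms become nonunits by the chain condition, later ones because their
    coefficients are divisible by [x], a multiple of [z j0]. The constant term would then be a
    nonunit. The bounded rank over F[x] thus bounds the length of such chains. *)
Let chain_tindep x d (z : 'I_d -> K) : x != 0 -> nonunit x ->
  (forall i, nonunit (z i)) -> (forall i, z i != 0) -> (forall i, V (x / z i)) ->
  (forall i j : 'I_d, (i < j)%N -> nonunit (z i / z j)) -> tindep kap x z.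
Proof.
move=> x0 mx mz z0 Vxz zz; apply: tindep_const => // a ea j.
apply: contrapT => /eqP aj.
have [j0 aj0 jmax] := @arg_maxnP _ j (fun k => (a k)`_0 != 0) (@nat_of_ord d) aj.
suff : nonunit (kap (a j0)`_0).
  move=> h; apply: nonunit1; rewrite -(rmorph1 kap) -(mulVf aj0) rmorphM.
  exact: nonunitMl.
have e : pev kap x (a j0) = - \sum_(k | k != j0) pev kap x (a k) * (z k / z j0).
  move: ea; rewrite /tcomb (bigD1 j0) //= => /(congr1 ( *%R^~ (z j0)^-1)).
  rewrite mul0r mulrDl mulfK // => /eqP; rewrite addr_eq0 => /eqP ->.
  by rewrite mulr_suml; congr (- _); apply: eq_bigr => k _; rewrite mulrA.
have -> : kap (a j0)`_0 = pev kap x (a j0) - pev kap x (drop_poly 1 (a j0)) * x.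
  by rewrite {1}pev_const_term addrK.
apply: nonunitD; last by apply/nonunitN/nonunitMl => //; exact: Vpev (nonunitV mx).
rewrite e; apply/nonunitN/nonunit_sum => k kj.
have [ltkj|ltjk|/val_inj ekj] := ltngtP k j0; last by rewrite ekj eqxx in kj.
  by apply: nonunitMl; [exact: Vpev (nonunitV mx)|exact: zz].
have ak : (a k)`_0 = 0.
  by apply/eqP/negPn/negP => /jmax h; have : (k <= j0)%N := h; rewrite leqNgt ltjk.
rewrite pev_const_term ak rmorph0 add0r.
rewrite (_ : _ * _ = pev kap x (drop_poly 1 (a k)) * (x / z j0) * z k); last by ring.
apply: nonunitMl => //; apply: VM => //; exact: Vpev (nonunitV mx).
Qed.

Variable y0 : K.
Hypotheses (y0_neq0 : y0 != 0) (Vy0 : V y0) (nVy0 : ~ V y0^-1).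

(** Otherwise every nonzero nonunit has a proper divisor that is again a nonunit; iterating from
    [y0] gives arbitrarily long chains of divisors of [y0]. *)
Let ex_generator : exists pi, [/\ pi != 0, nonunit pi & forall z, nonunit z -> V (z / pi)].
Proof.
apply: contrapT => none.
have next z : exists z', z != 0 -> nonunit z -> [/\ z' != 0, nonunit z' & nonunit (z / z')].
  have [zz|nz] := pselect (z != 0 /\ nonunit z); last by exists 0 => h1 h2; case: nz.
  apply: contrapT => H; apply: none; exists z; case: zz => z0 mz; split=> // w mw.
  apply: contrapT => nV; apply: H; exists w => _ _.
  have w0 : w != 0 by apply: contra_notN nV => /eqP ->; rewrite mul0r; case: hVg.
  split=> //; right; rewrite invf_div; split=> //.
  by case: (Vval (w / z)) => //; rewrite invf_div.
have [f hf] := choice next; pose z i := iter i f y0.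
have zok i : z i != 0 /\ nonunit (z i).
  elim: i => [|i [h1 h2]]; first by split=> //; right; split.
  by case: (hf _ h1 h2).
have zz i k : nonunit (z i / z (i + k.+1)%N).
  elim: k => [|k IH].
    by rewrite addn1; case: (hf _ (proj1 (zok i)) (proj2 (zok i))).
  have -> : z i / z (i + k.+2)%N = (z i / z (i + k.+1)%N) * (z (i + k.+1)%N / z (i + k.+2)%N).
    by rewrite mulrA divfK //; case: (zok (i + k.+1)%N).
  apply: nonunitMl; first exact: nonunitV IH.
  by rewrite [(i + k.+2)%N]addnS; case: (hf _ (proj1 (zok (i + k.+1)%N)) (proj2 (zok (i + k.+1)%N))).
have [r hr] := ffield_rank_bounded y0 ffK.
have := hr r.+1 (fun i => z i); rewrite ltnn => h.
suff /h : tindep kap y0 (fun i : 'I_r.+1 => z i) by [].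
apply: chain_tindep => //.
- by right; split.
- by move=> i; case: (zok i).
- by move=> i; case: (zok i).
- move=> [[|i] /= _]; first by rewrite divff.
  by apply: nonunitV; have := zz 0%N i.
- by move=> i j ij; have := zz i (j - i.+1)%N; rewrite addnS -addSn subnKC.
Qed.

Lemma place_of_valuation_ring :
  exists p : place K, forall x, x != 0 -> (0 <= ord p x) <-> V x.
Proof.
have [pi [pi0 mpi hpi]] := ex_generator.
have mpiX k : nonunit (pi ^+ k.+1).
  by rewrite exprS mulrC; apply: nonunitMl => //; apply: subringX => //; apply: nonunitV.
have piXz (k : int) : V (pi ^ k) -> V (pi ^ k)^-1 -> k = 0.
  have aux n : V (pi ^+ n) -> V (pi ^+ n)^-1 -> n = 0%N.
    case: n => // n _ h; case: (mpiX n) => [/eqP|[_ /(_ h)]//].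
    by rewrite expf_eq0 (negbTE pi0) andbF.
  case: k => n; first by move=> h1 h2; rewrite (aux n).
  rewrite NegzE -invr_expz invrK => h1 h2; by have := aux n.+1 h2 h1.
pose unit_at k x := V (x / pi ^ k) /\ V (x / pi ^ k)^-1.
have ex_nat z : z != 0 -> V z -> exists k : nat, unit_at k%:Z z.
  move=> z0 Vz; have [Vz'|nVz'] := pselect (V z^-1).
    by exists 0%N; rewrite /unit_at expr0z divr1.
  have mz : nonunit z by right; split.
  (* If [z] were divisible by all powers of [pi], these powers would form arbitrarily long chains of
     divisors of [z]. *)
  have exk : exists k, `[< ~ V (z / pi ^+ k) >].
    apply: contrapT => /forallNP H.
    have VzX k : V (z / pi ^+ k) by apply: contrapT => h; apply: (H k); apply/asboolP.
    have [r hr] := ffield_rank_bounded z ffK.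
    have := hr r.+1 (fun i => pi ^+ (r.+1 - i)); rewrite ltnn => h.
    suff /h : tindep kap z (fun i : 'I_r.+1 => pi ^+ (r.+1 - i)) by [].
    apply: chain_tindep => //.
    - by move=> i; have := ltn_ord i; rewrite -subn_gt0; case: (_ - _)%N => // n _.
    - by move=> i; rewrite expf_neq0.
    - move=> i j ij.
      have -> : (r.+1 - i = (j - i.+1).+1 + (r.+1 - j))%N by have := ltn_ord j; lia.
      by rewrite exprD mulfK ?expf_neq0.
  case: (ex_minnP exk) => [[|k]] /asboolP nk kmin; first by rewrite expr0 divr1 in nk.
  have Vk : V (z / pi ^+ k).
    by apply: contrapT => h; have : (k < k)%N := kmin _ (asboolT h); rewrite ltnn.
  exists k; split=> //; apply: contrapT => h; apply: nk.
  have := hpi (z / pi ^+ k) (or_intror (conj Vk h)).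
  by rewrite exprSr invfM mulrA.
have ex_int z : z != 0 -> exists k, unit_at k z.
  move=> z0; have [/(ex_nat _ z0)[k hk]|/ex_nat] := Vval z; first by exists k%:Z.
  rewrite invr_eq0 => /(_ z0)[k [h1 h2]]; exists (- k%:Z).
  have e : (z^-1 / pi ^ k)^-1 = z / pi ^ - k%:Z by rewrite -invr_expz invfM !invrK.
  by rewrite /unit_at -e invrK.
have uniq_int z k l : z != 0 -> unit_at k z -> unit_at l z -> k = l.
  move=> z0 [h1 h2] [h3 h4]; apply/eqP; rewrite -subr_eq0; apply/eqP/piXz.
    rewrite expfzDr // -invr_expz.
    rewrite (_ : _ / _ = (z / pi ^ l) * (z / pi ^ k)^-1); first exact: VM.
    by field; rewrite z0 !expfz_neq0.
  rewrite expfzDr // -invr_expz.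
  rewrite (_ : (_ / _)^-1 = (z / pi ^ k) * (z / pi ^ l)^-1); first exact: VM.
  by field; rewrite z0 !expfz_neq0.
have [v hv] : exists v : K -> int, v 0 = 0 /\ forall x, x != 0 -> unit_at (v x) x.
  have /choice[v hv] x : exists k, if x == 0 then k = 0 else unit_at k x.
    by case: eqVneq => [_|/ex_int//]; exists 0.
  exists v; split=> [|x x0]; first by have := hv 0; rewrite eqxx.
  by have := hv x; rewrite (negbTE x0).
case: hv => v0 hv.
have vM x y : x != 0 -> y != 0 -> v (x * y) = v x + v y.
  move=> x0 y'0; apply: (@uniq_int (x * y)); rewrite ?mulf_neq0 //; first by apply: hv; rewrite mulf_neq0.
  have [h1 h2] := hv x x0; have [h3 h4] := hv y y'0.
  rewrite /unit_at expfzDr // invfM mulrACA invfM; split; exact: VM.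
have vV x : x != 0 -> (0 <= v x) <-> V x.
  move=> x0; have [h1 h2] := hv x x0; split.
    case: (v x) h1 h2 => // n h1 _ _; rewrite -[x](@divfK _ (pi ^+ n)) ?expf_neq0 //.
    by apply: VM => //; apply: subringX => //; apply: nonunitV.
  move=> Vx; rewrite leNgt; apply/negP => vx.
  have := @piXz (- v x); rewrite -invr_expz invrK.
  have -> : v x = - (`|v x|%N)%:Z by lia.
  case e : `|v x|%N => [|n]; first by move: vx; have -> : v x = 0 by lia.
  rewrite -invr_expz => H.
  suff : - - n.+1%:Z = 0 by lia.
  apply: H; rewrite ?invrK.
    by apply: (@nonunitV (pi ^+ n.+1)).
  rewrite -exprnP; rewrite (_ : (pi ^+ n.+1)^-1 = x * (x / pi ^ v x)^-1).
    exact: VM.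
  rewrite (_ : v x = - (n.+1)%:Z); last by lia.
  by rewrite -invr_expz invrK invfM mulVKf.
have vD x y : x != 0 -> y != 0 -> x + y != 0 -> Num.min (v x) (v y) <= v (x + y).
  wlog le : x y / v x <= v y => [wl|].
    have /orP[h|h a b c] := le_total (v x) (v y); first exact: wl.
    by rewrite minC addrC; apply: wl => //; rewrite addrC.
  move=> x0 y'0 xy0; rewrite (min_idPl le) -subr_ge0.
  have e : v ((x + y) / x) = v (x + y) - v x.
    by apply/eqP; rewrite eq_sym subr_eq -vM ?mulf_neq0 ?invr_eq0 // divfK.
  rewrite -e; apply/vV; first by rewrite mulf_neq0 ?invr_eq0.
  rewrite mulrDl divff //; apply: subgrpD => //; apply/vV; first by rewrite mulf_neq0 ?invr_eq0.
  have : v (y / x) + v x = v y by rewrite -vM ?mulf_neq0 ?invr_eq0 // divfK.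
  by lia.
have vpi : exists2 x, x != 0 & v x = 1.
  exists pi => //; apply: (@uniq_int pi) => //; first exact: hv.
  by rewrite /unit_at expr1z divff // invr1.
by exists (Place v0 vM vD vpi) => x x0; exact: vV.
Qed.

End DiscreteValuation.

Section PlaceExistence.
Variables (F : finFieldType) (K : fieldType) (kap : {rmorphism F -> K}).
Hypothesis ffK : ffield kap.
Implicit Types (A : K -> Prop) (x : K).

Definition integral_over A x :=
  exists g : {poly K}, [/\ g \is monic, forall i, A g`_i & g.[x] = 0].

(** If [x] belonged to A[x^-1], multiplication by a power of [x] would give an integral equation for
    it. Hence there is a subring maximal among those that contain A[x^-1] and avoid [x], and it is a
    valuation ring. *)
Theorem ex_place_not_integral A x : subring_pred A -> (forall c, A (kap c)) ->
  ~ integral_over A x ->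
  exists p : place K, [/\ forall a, A a -> small p 0 a, x != 0 & ord p x < 0].
Proof.
move=> hA Akap nint; have hA' := subring_subgrp hA.
have x0 : x != 0.
  apply: contra_notN nint => /eqP ->; exists 'X; rewrite monicX hornerX; split=> // i.
  by rewrite coefX; case: eqP => _; [case: hA|case: hA'].
have nadj : ~ exists n, adjoin A x^-1 n x.
  move=> [n [g [sg Ag eg]]]; apply: nint.
  pose h := \poly_(i < n.+1) g`_(n - i).
  exists ('X^(n.+1) - h); split.
  - rewrite monicE lead_coefDl ?lead_coefXn // size_polyN size_polyXn.
    exact: leq_ltn_trans (size_poly _ _) _.
  - move=> i; rewrite coefB coefXn coef_poly.
    apply: (proj2 hA'); first by case: eqP => _; [case: hA|case: hA'].
    by case: ifP => // _; case: hA'.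
  - rewrite !hornerE horner_poly exprS {1}eg (horner_coef_wide _ sg) mulr_suml.
    rewrite (reindex_inj rev_ord_inj) /= -sumrB big1 // => i _.
    rewrite subSS; have /ltnSE ni := ltn_ord i.
    have -> : x ^+ n = x ^+ (n - i) * x ^+ i by rewrite -exprD subnK.
    by rewrite exprVn -mulrA mulKf ?expf_neq0 // subrr.
have hB := adjoin_subring x^-1 hA.
have [R [hR BR nRx Rmax]] := ex_maximal_subring hB nadj.
have Ry : R x^-1 by apply: BR; exists 1%N; apply: adjoin_gen.
have Rval : forall z, R z \/ R z^-1.
  by apply: (@maximal_subring_valuation _ R x^-1) => //; rewrite ?invrK.
have AR a : A a -> R a by move=> Aa; apply: BR; exists 0%N; apply: adjoin_incl.
have [||||p hp] := @place_of_valuation_ring F K kap ffK R hR Rval _ x^-1 _ _ _.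
- by move=> c; apply: AR.
- by rewrite invr_eq0.
- exact: Ry.
- by rewrite invrK.
exists p; split=> // [a Aa|].
  have [->|a0] := eqVneq a 0; first exact: small0.
  by rewrite smallE //; apply/hp => //; apply: AR.
by rewrite ltNge; apply/negP => /(hp _ x0).
Qed.

End PlaceExistence.

(** * Degrees of places *)

Section PlaceDegrees.
Variables (F : finFieldType) (K : fieldType) (kap : {rmorphism F -> K}).
Hypothesis ffK : ffield kap.
Implicit Types (p q : place K) (x y z t : K) (N M : int) (Z : seq (place K)).
Local Notation transc := (transc kap).
Local Notation ev := (pev kap).
Local Notation lcomb := (lincomb kap).

Lemma ord_kap p c : c != 0 -> ord p (kap c) = 0.
Proof.
move=> c0; have kc0 : kap c != 0 by rewrite fmorph_eq0.
have /eqP := congr1 (fun c => ord p (kap c)) (expf_card c).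
rewrite rmorphXn ordX // -mulr_natr natz -subr_eq0 -{2}[ord p _]mulr1 -mulrBr mulf_eq0.
case/orP => [/eqP//|]; rewrite subr_eq0 => /eqP[e].
by have := finNzRing_gt1 F; rewrite e.
Qed.

Lemma small_kap p c : small p 0 (kap c).
Proof.
have [->|c0] := eqVneq c 0; first by rewrite rmorph0 small0.
by rewrite smallE ?fmorph_eq0 // ord_kap.
Qed.

Lemma small_Fsub p N : Fsub kap (small p N).
Proof.
split; first by split=> [|x y]; [exact: small0|exact: smallB].
by move=> c x; apply: smallMl; exact: small_kap.
Qed.

Lemma small_pev p x a : small p 0 x -> small p 0 (ev x a).
Proof.
move=> hx; rewrite pevE; apply: small_sum => i _; apply: smallMl; first exact: small_kap.
by have := smallX i hx; rewrite mul0rn.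
Qed.

Lemma pev_unit p x (a : {poly F}) : small p 1 x -> a`_0 != 0 -> ev x a != 0 /\ ord p (ev x a) = 0.
Proof.
move=> hx a0; have k0 : kap a`_0 != 0 by rewrite fmorph_eq0.
rewrite pev_const_term -(ord_kap p a0); apply: ord_small_add => //.
rewrite ord_kap // add0r; apply: smallMl => //; apply: small_pev.
exact: smallW hx.
Qed.

Lemma transcV x : x != 0 -> transc x -> transc x^-1.
Proof.
move=> x0 trx a e; pose b : {poly F} := \poly_(i < size a) a`_(size a - i.+1).
have b0 : b = 0.
  apply: trx; rewrite /b poly_def rmorph_sum /=.
  transitivity (x ^+ (size a).-1 * ev x^-1 a); last by rewrite e mulr0.
  rewrite pevE mulr_sumr (reindex_inj rev_ord_inj) /=.
  apply: eq_bigr => i _; rewrite pevZ rmorphXn /= pevX mulrCA.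
  have -> : (size a - (size a - i.+1).+1 = i)%N by rewrite subnSK ?subKn // ltnW.
  congr (_ * _).
  rewrite exprVn; have -> : (size a).-1 = (size a - i.+1 + i)%N by have ia : (i < size a)%N := ltn_ord i; lia.
  by rewrite exprD mulfK ?expf_neq0.
apply/polyP => i; rewrite coef0.
have [ia|ai] := ltnP i (size a); last by rewrite nth_default.
have /polyP/(_ (size a - i.+1)%N) := b0; rewrite coef_poly coef0.
by rewrite ifT ?subnSK ?subKn //; lia.
Qed.

(** At a zero of [y] the constant term of a relation vanishes, all other terms having positive
    order; dividing by [y] shortens the relation. Poles are reduced to zeros by inversion. *)
Lemma transc_ord p x : ord p x != 0 -> transc x.
Proof.
have pos y : 0 < ord p y -> transc y.
  move=> hy a e; have y0 : y != 0 by apply: contraTneq hy => ->; rewrite ord_zero.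
  have [s hs] : exists s, (size a <= s)%N by exists (size a).
  elim: s a hs e => [|s IH] a hs e; first by apply/eqP; rewrite -size_poly_eq0 -leqn0.
  have a0 : a`_0 = 0.
    apply/eqP/negPn/negP => /(@pev_unit p y)[]; first by rewrite smallE //; lia.
    by rewrite e eqxx.
  have ap : a = drop_poly 1 a * 'X.
    by apply/polyP => -[|j]; rewrite coefMX /= ?coef_drop_poly ?addn1.
  rewrite ap (IH (drop_poly 1 a)) ?mul0r //.
    by rewrite size_drop_poly; lia.
  apply: (mulIf y0); rewrite mul0r -[RHS]e [in RHS]pev_const_term a0 rmorph0 add0r //.
move=> px; have x0 : x != 0 by apply: contra_neq px => ->; rewrite ord_zero.
have [lt|ge] := ltP 0 (ord p x); first exact: pos.
rewrite -[x]invrK; apply: transcV; rewrite ?invr_eq0 //; apply: pos.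
by rewrite ordV //; lia.
Qed.

Lemma transc_neq0 x : transc x -> x != 0.
Proof.
move=> trx; apply/eqP => x0.
have /trx/eqP : ev x 'X = 0 by rewrite pevX.
by rewrite polyX_eq0.
Qed.

(** A transcendental element is not integral over the ring of constants. *)
Lemma ex_pole x : transc x -> exists p, ord p x < 0.
Proof.
move=> trx; pose A y := exists c, y = kap c.
have hA : subring_pred A.
  split; first by exists 1; rewrite rmorph1.
    by move=> _ _ [c ->] [d ->]; exists (c - d); rewrite rmorphB.
  by move=> _ _ [c ->] [d ->]; exists (c * d); rewrite rmorphM.
have [||p [_ _ px]] := @ex_place_not_integral F K kap ffK A x hA.
- by move=> c; exists c.
- move=> [g [mg Ag gx]]; have [f hf] := choice Ag.
  pose a := \poly_(i < size g) f i.
  have ea : map_poly kap a = g.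
    apply/polyP => i; rewrite coef_map coef_poly; case: ltnP => h; first by rewrite hf.
    by rewrite nth_default //; exact: rmorph0.
  have /trx a0 : ev x a = 0 by rewrite /pev /horner_eval ea.
  by move: mg; rewrite -ea a0 rmorph0 monicE lead_coef0 eq_sym oner_eq0.
by exists p.
Qed.

Lemma ex_place : inhabited (place K).
Proof. by case: ffK => t [n [w [/ex_pole[p _] _]]]; exists. Qed.

(** Riemann-Roch condition imposed at the places of [Z] only, with the usual sign: a larger [D]
    gives a larger space. [D = 0] gives the semilocal ring of [Z]. *)
Definition semilocal Z (D : place K -> int) z := forall p, p \in Z -> small p (- D p) z.

Lemma semilocal_Fsub Z D : Fsub kap (semilocal Z D).
Proof.
split; first split; first by move=> p _; exact: small0.
  by move=> x y hx hy p pZ; apply: smallB; [exact: hx|exact: hy].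
by move=> c x hx p pZ; apply: (proj2 (small_Fsub p _)); apply: hx.
Qed.

(** The constant terms of a relation over F[x] form a relation over [F] modulo [x] times the
    semilocal ring. *)
Lemma indep_mod_tindep Z x d (u : 'I_d -> K) : x != 0 ->
  (forall p, p \in Z -> 0 < ord p x) -> (forall i, semilocal Z (fun=> 0) (u i)) ->
  indep_mod kap (semilocal Z (fun p => - ord p x)) u -> tindep kap x u.
Proof.
move=> x0 hx hu ind; apply: tindep_const => // a ea i.
suff /ind/matrixP/(_ i 0) : semilocal Z (fun p => - ord p x) (lcomb u (\col_i (a i)`_0)).
  by rewrite !mxE.
have -> : lcomb u (\col_i (a i)`_0) = - (x * \sum_j ev x (drop_poly 1 (a j)) * u j).
  apply/eqP; rewrite -addr_eq0 -[X in _ == X]ea mulr_sumr -big_split; apply/eqP.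
  apply: eq_bigr => j _; rewrite mxE [in RHS]pev_const_term mulrDl; congr (_ + _).
  by rewrite mulrA [x * _]mulrC.
move=> p pZ; rewrite opprK; apply: smallN; rewrite -[ord p x]addr0; apply: smallM.
  exact: small_ord.
have px := hx p pZ; apply: small_sum => j _; apply: smallMl.
  by apply: small_pev; rewrite smallE // ltW.
by have := hu j p pZ; rewrite oppr0.
Qed.

Lemma semilocal_basis Z x : x != 0 -> (forall p, p \in Z -> 0 < ord p x) ->
  exists d (u : 'I_d -> K), [/\ forall i, semilocal Z (fun=> 0) (u i), tindep kap x u &
    transversal_of (semilocal Z (fun=> 0)) (semilocal Z (fun p => - ord p x)) (lcomb u)].
Proof.
move=> x0 hx; have [r hr] := ffield_rank_bounded x ffK.
have [|d [u [_ uO iu tu]]] := Fsub_basis (N := r) (semilocal_Fsub Z (fun=> 0))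
   (semilocal_Fsub Z (fun p => - ord p x)).
  by move=> d u uO iu; apply: hr (indep_mod_tindep x0 hx uO iu).
by exists d, u; split=> //; apply: indep_mod_tindep iu.
Qed.

Definition is_residue_basis p d (u : 'I_d -> K) :=
  transversal_of (small p 0) (small p 1) (lcomb u).

(** The degree of the residue field over [F], as the length of a chosen basis; all bases have the
    same length [d], since q^d counts the residue classes. *)
Definition degp p : nat := classical_sets.xget 0%N (fun d => exists u : 'I_d -> K, is_residue_basis p u).

Lemma degpP p : exists u : 'I_(degp p) -> K, is_residue_basis p u.
Proof.
apply: (@classical_sets.xgetPex _ 0%N (fun d => exists u : 'I_d -> K, is_residue_basis p u)).
have [x x0 px] := ord_uniformizer p.
have [|d [u [hu _ tu]]] := @semilocal_basis [:: p] x x0.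
  by move=> q; rewrite inE => /eqP ->; rewrite px.
exists d, u; have [h1 h2 h3] := tu; split.
- by move=> c; have := h1 c p (mem_head _ _); rewrite oppr0.
- move=> c c' h; apply: h2 => q; rewrite inE => /eqP ->.
  by rewrite opprK px.
- move=> y hy; have [|c hc] := h3 y; first by move=> q; rewrite inE oppr0 => /eqP ->.
  by exists c; have := hc p (mem_head _ _); rewrite opprK px.
Qed.

Lemma degp_gt0 p : (0 < degp p)%N.
Proof.
have [u [_ _ h]] := degpP p; rewrite lt0n; apply/eqP => d0.
have [c] := h 1 (small1 p); have -> : lcomb u c = 0.
  by rewrite /lincomb big1 // => -[i hi]; exfalso; rewrite d0 in hi.
by rewrite subr0 /small oner_eq0 ord1.
Qed.

Lemma place_layer p N : exists r : 'cV[F]_(degp p) -> K,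
  transversal_of (small p N) (small p (N + 1)) r.
Proof.
have [u [h1 h2 h3]] := degpP p; have [x x0 px] := ord_uniformizer p.
have xN0 (M : int) : x ^ M != 0 by rewrite expfz_neq0.
have sx (M : int) : small p M (x ^ M) by rewrite smallE // ordXz // px mul1r.
have mul_ M N' y : small p N' (x ^ M * y) <-> small p (N' - M) y.
  split=> h.
    rewrite -[y](mulKf (xN0 M)) invr_expz addrC; exact: smallM.
  by rewrite -[N'](subrKC M); exact: smallM.
exists (fun c => x ^ N * lcomb u c); split.
- by move=> c; apply/mul_; rewrite subrr.
- move=> c c'; rewrite -mulrBr => /mul_; rewrite addrC addKr; exact: h2.
- move=> y hy; have [|c hc] := h3 (x ^ (- N) * y); first by apply/mul_; rewrite opprK add0r.
  exists c; rewrite -[y](mulVKf (xN0 N)) invr_expz -mulrBr; apply/mul_.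
  by rewrite addrC addKr.
Qed.

Lemma transversal_comp (U V W : K -> Prop) (T1 T2 : finType) (r1 : T1 -> K) (r2 : T2 -> K) :
  subgrp U -> subgrp V -> subgrp W -> (forall x, V x -> U x) -> (forall x, W x -> V x) ->
  transversal_of U V r1 -> transversal_of V W r2 ->
  transversal_of U W (fun c : T1 * T2 => r1 c.1 + r2 c.2).
Proof.
move=> hU hV hW VU WV [a1 b1 c1] [a2 b2 c2]; split.
- by move=> c; apply: subgrpD => //; apply: VU.
- move=> [i1 i2] [j1 j2] /= h.
  have e : i1 = j1.
    apply: b1; rewrite (_ : _ - _ = (r1 i1 + r2 i2 - (r1 j1 + r2 j2)) + (r2 j2 - r2 i2)); last by ring.
    by apply: subgrpD => //; [exact: WV|apply: (proj2 hV)].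
  congr pair => //; apply: b2; move: h; rewrite e; congr W; ring.
- move=> x /c1[i hi]; have [j hj] := c2 _ hi; exists (i, j) => /=.
  by rewrite opprD addrA.
Qed.

(** Weak approximation replaces representatives of one layer at [p] by elements that are small at
    the other places of [Z]. *)
Lemma semilocal_step Z (D : place K -> int) p : uniq Z -> p \in Z ->
  exists (T : finType) (r : T -> K), #|T| = (#|F| ^ degp p)%N /\
    transversal_of (semilocal Z (fun q => D q + (q == p)%:Z)) (semilocal Z D) r.
Proof.
move=> uZ pZ; have [r [h1 h2 h3]] := place_layer p (- D p - 1).
pose M := \sum_(q <- Z) `|D q|.
have DM q : q \in Z -> - D q <= M /\ - D q - 1 <= M.
  move=> qZ; have : `|D q| <= M.
    by rewrite /M (big_rem q) //= lerDl sumr_ge0.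
  by split; lia.
have /choice[s hs] c : exists y, small p M (y - r c) /\ forall q, q \in Z -> q != p -> small q M y.
  have [y hy] := weak_approximation (fun q => if q == p then r c else 0) M uZ.
  exists y; split; first by have := hy p pZ; rewrite eqxx.
  by move=> q qZ qp; have := hy q qZ; rewrite (negbTE qp) subr0.
rewrite subrK in h2 h3.
exists _, s; split; first exact: card_cV.
split.
- move=> c q qZ; have [e|qp] := eqVneq q p.
    rewrite e /= -[s c](subrK (r c)) opprD; apply: smallD; last exact: h1.
    by apply: smallW (proj1 (hs c)); case: (DM p pZ).
  by rewrite addr0; apply: smallW (proj2 (hs c) q qZ qp); case: (DM q qZ).
- move=> c c' h; apply: h2.
  rewrite (_ : _ - _ = (s c - s c') - (s c - r c) + (s c' - r c')); last by ring.
  apply: smallD; first apply: smallB; first exact: h.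
    by apply: smallW (proj1 (hs c)); case: (DM p pZ).
  by apply: smallW (proj1 (hs c')); case: (DM p pZ).
- move=> y hy; have [|c hc] := h3 y; first by have := hy p pZ; rewrite eqxx opprD.
  exists c => q qZ; have [->|qp] := eqVneq q p.
    rewrite (_ : _ - _ = (y - r c) - (s c - r c)); last by ring.
    apply: smallB => //.
    by apply: smallW (proj1 (hs c)); case: (DM p pZ).
  apply: smallB; first by have := hy q qZ; rewrite (negbTE qp) addr0.
  by apply: smallW (proj2 (hs c) q qZ qp); case: (DM q qZ).
Qed.

Lemma semilocal_index Z (D : place K -> int) (E : place K -> nat) : uniq Z ->
  exists (T : finType) (r : T -> K), #|T| = (#|F| ^ (\sum_(p <- Z) E p * degp p))%N /\
    transversal_of (semilocal Z (fun q => D q + (E q)%:Z)) (semilocal Z D) r.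
Proof.
move=> uZ.
have sub (D1 D2 : place K -> int) : (forall q, D1 q <= D2 q) -> forall x, semilocal Z D1 x -> semilocal Z D2 x.
  by move=> h x hx q qZ; apply: smallW (hx q qZ); rewrite lerN2.
have sg D1 : subgrp (semilocal Z D1) by case: (semilocal_Fsub Z D1).
have stepn (D1 : place K -> int) p (n : nat) : p \in Z -> exists (T : finType) (r : T -> K),
    #|T| = (#|F| ^ (n * degp p))%N /\
    transversal_of (semilocal Z (fun q => D1 q + ((q == p) * n)%N%:Z)) (semilocal Z D1) r.
  move=> pZ; elim: n => [|n [T [r [cT hT]]]].
    exists unit, (fun=> 0); rewrite card_unit mul0n expn0; split=> //; split=> //.
    - by move=> _; case: (sg (fun q => D1 q + ((q == p) * 0)%N%:Z)).
    - by move=> [] [].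
    - move=> x hx; exists tt; rewrite subr0; by apply: sub hx => q; rewrite ?muln0 ?mul0n addr0.
  have [T' [r' [cT' hT']]] := semilocal_step (fun q => D1 q + ((q == p) * n)%N%:Z) uZ pZ.
  exists (T' * T)%type, (fun c => r' c.1 + r c.2); split.
    by rewrite card_prod cT cT' -expnD mulSn.
  have <- : (fun q => D1 q + ((q == p) * n)%N%:Z + (q == p)%:Z) = (fun q => D1 q + ((q == p) * n.+1)%N%:Z).
    by apply: funext => q; case: (q == p); lia.
  by apply: transversal_comp hT' hT => //; apply: sub => q; lia.
have main (s : seq (place K)) (D1 : place K -> int) : uniq s -> {subset s <= Z} -> exists (T : finType) (r : T -> K),
    #|T| = (#|F| ^ (\sum_(p <- s) E p * degp p))%N /\
    transversal_of (semilocal Z (fun q => D1 q + ((q \in s) * E q)%N%:Z)) (semilocal Z D1) r.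
  elim: s D1 => [|p s IH] D1.
    move=> _ _; exists unit, (fun=> 0); rewrite card_unit big_nil expn0; split=> //; split=> //.
    - by move=> _; case: (sg (fun q => D1 q + ((q \in [::]) * E q)%N%:Z)).
    - by move=> [] [].
    - move=> x hx; exists tt; rewrite subr0; by apply: sub hx => q; rewrite ?muln0 ?mul0n addr0.
  move=> /= /andP[ps us] sZ.
  have [T [r [cT hT]]] := IH D1 us (fun q qs => sZ q (@mem_behead _ (p :: s) q qs)).
  have [T' [r' [cT' hT']]] := stepn (fun q => D1 q + ((q \in s) * E q)%N%:Z) p (E p) (sZ p (mem_head _ _)).
  exists (T' * T)%type, (fun c => r' c.1 + r c.2); split.
    by rewrite card_prod cT cT' -expnD big_cons.
  have <- : (fun q => D1 q + ((q \in s) * E q)%N%:Z + ((q == p) * E p)%N%:Z) =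
         (fun q => D1 q + ((q \in p :: s) * E q)%N%:Z).
    apply: funext => q; rewrite inE; case: eqVneq => [->|_] /=; last by rewrite mul0n addr0.
    by rewrite (negbTE ps) mul0n !mul1n addr0.
  by apply: transversal_comp hT' hT => //; apply: sub => q; lia.
have [T [r [cT hT]]] := main Z D uZ (fun q qZ => qZ).
exists T, r; split=> //; have [a b c] := hT.
have e x : semilocal Z (fun q => D q + (E q)%:Z) x <->
           semilocal Z (fun q => D q + ((q \in Z) * E q)%N%:Z) x.
  by split=> h q qZ; have := h q qZ; rewrite qZ mul1n.
by split=> // [i|x /e]; [apply/e; apply: a|exact: c].
Qed.

(** The semilocal ring modulo [x] is counted twice: by layers, which gives the sum of the [ord p x]
    weighted by degrees, and by a basis over [F], which is independent over F[x]. This is the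
    inequality sum e f <= [K : F(x)]. *)
Lemma semilocal_lattice Z x : uniq Z -> x != 0 -> (forall p, p \in Z -> 0 < ord p x) ->
  exists u : 'I_(\sum_(p <- Z) `|ord p x|%N * degp p) -> K,
  [/\ forall i, semilocal Z (fun=> 0) (u i), tindep kap x u &
    transversal_of (semilocal Z (fun=> 0)) (semilocal Z (fun p => - ord p x)) (lcomb u)].
Proof.
move=> uZ x0 hx; have [d [u [uO iu tu]]] := semilocal_basis x0 hx.
have [T [r [cT hT]]] := semilocal_index (fun p => - ord p x) (fun p => `|ord p x|%N) uZ.
suff -> : (\sum_(p <- Z) `|ord p x|%N * degp p)%N = d by exists u.
have e y : semilocal Z (fun=> 0) y <-> semilocal Z (fun q => - ord q x + (`|ord q x|%N)%:Z) y.
  split=> h q qZ; have := h q qZ; have := hx q qZ => ?;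
  by rewrite (_ : - ord q x + (`|ord q x|%N)%:Z = 0) //; lia.
have : #|T| = #|{: 'cV[F]_d}|.
  apply: transversal_card (proj1 (semilocal_Fsub Z (fun p => - ord p x))) hT _.
  by have [a b c] := tu; split=> [i|//|y hy]; [apply/e; apply: a|exact: b|apply: c; apply/e].
by rewrite cT card_cV => /eqP; rewrite eqn_exp2l ?finNzRing_gt1 // => /eqP.
Qed.

(** Each zero contributes at least 1 to the length of a family independent over F[x], so the number
    of zeros is bounded and a largest set of them is complete. *)
Lemma ex_zeros x : exists Z : seq (place K), uniq Z /\ forall p, (p \in Z) = (0 < ord p x).
Proof.
have [->|x0] := eqVneq x 0.
  by exists [::]; split=> // p; rewrite ord_zero.
have [r hr] := ffield_rank_bounded x ffK.
pose P n := exists Z : seq (place K), [/\ uniq Z, forall p, p \in Z -> 0 < ord p x & size Z = n].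
have [||n [Z [uZ hZ sZ]] nmax] := @ex_max_nat P r.
- by exists 0%N; exists [::].
- move=> n [Z [uZ hZ <-]]; have [u [_ iu _]] := semilocal_lattice uZ x0 hZ.
  apply: leq_trans (hr _ _ iu); rewrite -sum1_size big_seq [leqRHS]big_seq.
  apply: leq_sum => p pZ; rewrite muln_gt0 degp_gt0 andbT absz_gt0.
  by rewrite gt_eqF // hZ.
exists Z; split=> // p; apply/idP/idP => [/hZ//|px].
apply/negPn/negP => pZ; have /nmax : P n.+1; last by rewrite ltnn.
exists (p :: Z); rewrite /= pZ sZ; split=> // q; rewrite inE => /orP[/eqP->//|/hZ//].
Qed.

Definition zeros x : seq (place K) := projT1 (cid (ex_zeros x)).

Lemma zeros_uniq x : uniq (zeros x).
Proof. by rewrite /zeros; case: cid => Z []. Qed.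

Lemma mem_zeros x p : (p \in zeros x) = (0 < ord p x).
Proof. by rewrite /zeros; case: cid => Z []. Qed.

Lemma mem_poles x p : (p \in zeros x^-1) = (ord p x < 0).
Proof.
rewrite mem_zeros; have [->|x0] := eqVneq x 0; first by rewrite invr0 ord_zero.
by rewrite ordV // oppr_gt0.
Qed.

Definition zdeg x := (\sum_(p <- zeros x) `|ord p x|%N * degp p)%N.

Lemma zeros_lattice x : x != 0 -> exists u : 'I_(zdeg x) -> K,
  [/\ forall i, semilocal (zeros x) (fun=> 0) (u i), tindep kap x u &
    transversal_of (semilocal (zeros x) (fun=> 0)) (semilocal (zeros x) (fun p => - ord p x)) (lcomb u)].
Proof.
move=> x0; apply: semilocal_lattice => // [|p]; first exact: zeros_uniq.
by rewrite mem_zeros.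
Qed.

End PlaceDegrees.

(** * The Riemann inequality and the class number *)

Section Divisors.
Variables (F : finFieldType) (K : fieldType) (kap : {rmorphism F -> K}).
Hypothesis ffK : ffield kap.
Implicit Types (p q : place K) (x y z t : K) (D E : divisor K).
Local Notation deg1 := (degp kap).
Local Notation zer := (zeros ffK).

Definition ddeg D : int := fglift (fun p => (deg1 p)%:Z : int^o) D.

Arguments ddeg D%_ring_scope.

Lemma ddeg_is_additive : {morph ddeg : D E / D - E}.
Proof. exact: (@lift_is_additive _ (place K) int^o). Qed.

HB.instance Definition _ :=
  GRing.isZmodMorphism.Build (divisor K) int ddeg ddeg_is_additive.

Lemma ddegU k p : ddeg << k *g p >> = k * (deg1 p)%:Z.
Proof. by rewrite /ddeg liftU. Qed.

Lemma ddegE D : ddeg D = \sum_(p <- dom D) coeff p D * (deg1 p)%:Z.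
Proof.
rewrite -{1}[D]freeg_sumE raddf_sum; apply: eq_bigr => p _; exact: ddegU.
Qed.

Lemma coeff_sumU (s : seq (place K)) (f : place K -> int) p : uniq s ->
  coeff p (\sum_(q <- s) << f q *g q >>) = if p \in s then f p else 0.
Proof.
move=> us; rewrite raddf_sum /=; case: ifPn => ps.
  rewrite (big_rem p) //= coeffU eqxx mulr1 big_seq big1 ?addr0 // => q.
  rewrite mem_rem_uniq // inE => /andP[qp _].
  by rewrite coeffU (negbTE qp) mulr0.
rewrite big_seq big1 // => q qs; rewrite coeffU.
have [e|_] := eqVneq q p; last by rewrite mulr0.
by rewrite -e qs in ps.
Qed.

Definition zdiv x : divisor K := \sum_(p <- zer x) << ord p x *g p >>.

Lemma coeff_zdiv p x : coeff p (zdiv x) = Num.max 0 (ord p x).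
Proof.
rewrite coeff_sumU ?zeros_uniq // mem_zeros.
by case: ltP => // h; rewrite (max_idPl _).
Qed.

Lemma ddeg_zdiv x : ddeg (zdiv x) = (zdeg ffK x)%:Z.
Proof.
rewrite raddf_sum /zdeg (big_morph Posz PoszD (erefl 0)) big_seq [RHS]big_seq.
apply: eq_bigr => p; rewrite mem_zeros => hp; rewrite [LHS]ddegU PoszM.
by rewrite gez0_abs // ltW.
Qed.

Definition divx x : divisor K := locked (zdiv x - zdiv x^-1).

Lemma coeff_divx p x : coeff p (divx x) = ord p x.
Proof.
rewrite /divx -lock coeffB !coeff_zdiv; have [->|x0] := eqVneq x 0.
  by rewrite invr0 ord_zero subrr.
rewrite ordV //; lia.
Qed.

Lemma divisorP D E : (forall p, coeff p D = coeff p E) -> D = E.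
Proof. by move=> h; apply/eqP/freeg_eqP. Qed.

Lemma divxV x : x != 0 -> divx x^-1 = - divx x.
Proof. by move=> x0; apply: divisorP => p; rewrite coeffN !coeff_divx ordV. Qed.

Definition effective D := forall p, 0 <= coeff p D.

Lemma effective_ofseq D : effective D -> exists s : seq (place K), D = \sum_(p <- s) << p >>.
Proof.
move=> effD; exists (flatten [seq nseq `|coeff p D|%N p | p <- dom D]).
rewrite big_flatten big_map -[LHS]freeg_sumE; apply: eq_bigr => p _.
by rewrite big_nseq iter_addr_0 freegU_muln natz gez0_abs.
Qed.

Lemma effective0 : effective 0.
Proof. by move=> p; rewrite coeff0. Qed.

Lemma effectiveD D E : effective D -> effective E -> effective (D + E).
Proof. by move=> h1 h2 p; rewrite coeffD addr_ge0. Qed.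

Lemma effective_sum (I : Type) (r : seq I) (P : pred I) (f : I -> divisor K) :
  (forall i, P i -> effective (f i)) -> effective (\sum_(i <- r | P i) f i).
Proof. by move=> h; apply: (big_ind effective) => //; [exact: effective0|exact: effectiveD]. Qed.

Lemma effective_zdiv x : effective (zdiv x).
Proof. by move=> p; rewrite coeff_zdiv le_max lexx. Qed.

Lemma effective_place p : effective << p >>.
Proof. by move=> q; rewrite coeffU mul1r; case: eqP. Qed.

Lemma ddeg_effective D : effective D -> 0 <= ddeg D.
Proof. by move=> h; rewrite ddegE sumr_ge0 // => p _; rewrite mulr_ge0. Qed.

Lemma effective_bound D : exists2 E, effective E & effective (E - D).
Proof.
exists (\sum_(p <- dom D) << `|coeff p D| *g p >>) => p.
  by rewrite coeff_sumU ?uniq_dom //; case: ifP.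
rewrite coeffB coeff_sumU ?uniq_dom // mem_dom.
by case: eqVneq => [->|_] //=; lia.
Qed.

Definition LL D z := forall p, small p (- coeff p D) z.

Lemma LL_subgrp D : subgrp (LL D).
Proof.
split=> [p|x y hx hy p]; first exact: small0.
by apply: smallB.
Qed.

Lemma LL_mul D x z : x != 0 -> LL D z <-> LL (D - divx x) (x * z).
Proof.
move=> x0; split=> h p; have := h p; rewrite coeffB coeff_divx.
  by move=> hp; rewrite opprB; apply: smallM => //; exact: small_ord.
rewrite opprB => /(smallM (small_ord p x^-1)); rewrite ordV // mulKf //.
by apply: smallW; lia.
Qed.

(** Elements of L(D + p) are distinguished modulo L(D) by their leading part at [p], which ranges
    over one layer. *)
Lemma LL_covers D p : exists r : 'cV[F]_(deg1 p) -> K,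
  covers (LL (D + << p >>)) (small p (- coeff p D)) r /\
  forall x y, LL (D + << p >>) x -> LL (D + << p >>) y -> small p (- coeff p D) (x - y) -> LL D (x - y).
Proof.
have [r [_ _ h3]] := place_layer ffK p (- coeff p D - 1); exists r; rewrite subrK in h3.
split=> [x hx|x y hx hy hp q].
  by apply: h3; have := hx p; rewrite coeffD coeffU eqxx mul1r opprD.
have [->//|qp] := eqVneq q p.
by have := smallB (hx q) (hy q); rewrite coeffD coeffU eq_sym (negbTE qp) mulr0 addr0.
Qed.

Lemma card_ddegS E p : effective E ->
  (#|F| ^ `|ddeg (E + << p >>)|%N = #|{: 'cV[F]_(deg1 p)}| * #|F| ^ `|ddeg E|%N)%N.
Proof.
move=> effE; rewrite card_cV -expnD raddfD /= ddegU mul1r; congr (_ ^ _)%N.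
by have := ddeg_effective effE; lia.
Qed.

Lemma LL_atmost D E B : effective E -> atmost (LL D) B ->
  atmost (LL (D + E)) (#|F| ^ `|ddeg E|%N * B).
Proof.
move=> effE hB; have [s ->] := effective_ofseq effE.
elim: s => [|p s IH]; first by rewrite big_nil addr0 raddf0 mul1n.
rewrite big_cons [<< p >> + _]addrC.
rewrite card_ddegS; last by apply: effective_sum => q _; exact: effective_place.
have [r [cov dif]] := LL_covers (D + \sum_(q <- s) << q >>) p.
rewrite addrA -mulnA; apply: atmost_ext cov dif IH.
by case: (small_Fsub kap p (- coeff p (D + \sum_(q <- s) << q >>))).
Qed.

Lemma LL_atleast D E B : effective E ->
  atleast (LL (D + E)) (#|F| ^ `|ddeg E|%N * B) -> atleast (LL D) B.
Proof.
move=> effE; have [s ->] := effective_ofseq effE.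
elim: s => [|p s IH]; first by rewrite big_nil addr0 raddf0 mul1n.
rewrite big_cons [<< p >> + _]addrC.
rewrite card_ddegS; last by apply: effective_sum => q _; exact: effective_place.
have [r [cov dif]] := LL_covers (D + \sum_(q <- s) << q >>) p.
rewrite addrA -mulnA => h; apply: IH.
apply: atleast_sub cov dif _ h.
- by case: (small_Fsub kap p (- coeff p (D + \sum_(q <- s) << q >>))).
- by apply/card_gt0P; exists 0.
- by case: (LL_subgrp (D + \sum_(q <- s) << q >>)).
Qed.

Lemma LL_neg_place p z : LL (- << p >>) z -> z = 0.
Proof.
move=> h; apply: contrapT => /eqP z0.
have hp q : 0 <= ord q z.
  have := h q; rewrite smallE // coeffN opprK coeffU mul1r.
  by apply: le_trans; case: eqP.
have : transc kap z.
  apply: (transc_ord (p := p)); have := h p; rewrite smallE // coeffN opprK coeffU mul1r eqxx.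
  by move=> ?; rewrite gt_eqF //; lia.
by case/(ex_pole ffK) => q; rewrite ltNge hp.
Qed.

(** Start from L(- p0) = 0 for a single place and add [E + p0]; hence [c] is the degree of [p0]. *)
Lemma LL_bounded : exists c, forall E, effective E -> atmost (LL E) (#|F| ^ (`|ddeg E|%N + c)).
Proof.
have [p0] := ex_place ffK; exists (deg1 p0) => E effE.
have eff' : effective (E + << p0 >>) by apply: effectiveD => //; exact: effective_place.
have := @LL_atmost (- << p0 >>) (E + << p0 >>) 1 eff'.
rewrite addrC addrK muln1 card_ddegS // card_cV expnD mulnC; apply.
move=> T r ri rU; apply: leq_trans (_ : #|{: unit}| <= 1)%N; last by rewrite card_unit.
apply: (@leq_card _ _ (fun=> tt)) => i j _; apply: ri.
by rewrite (LL_neg_place (rU i)) (LL_neg_place (rU j)).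
Qed.

(** Combinations of [u] with coefficients of degree at most [l] in [t] have their poles bounded by
    [l] times the poles of [t] plus a fixed divisor [C] containing the poles of the [u i]. *)
Lemma LL_multiples t n (u : 'I_n -> K) : tindep kap t u ->
  exists2 C, effective C & forall l, atleast (LL (zdiv t^-1 *+ l + C)) (#|F| ^ (n * l.+1)).
Proof.
move=> iu; pose C := \sum_i zdiv (u i)^-1.
have Cu p i : small p (- coeff p C) (u i).
  have [->|u0] := eqVneq (u i) 0; first exact: small0.
  rewrite smallE // /C (bigD1 i) //= coeffD coeff_zdiv ordV //.
  set C' := (X in _ + coeff p X).
  have h : effective C' by apply: effective_sum => j _; exact: effective_zdiv.
  by have := h p; lia.
exists C; first by apply: effective_sum => i _; exact: effective_zdiv.
move=> l; exists 'M[F]_(n, l.+1), (fun M => tcomb kap t u (fun i => rVpoly (row i M))).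
split.
- move=> M N /eqP; rewrite -subr_eq0 -sumrB => /eqP e.
  apply/row_matrixP => i; apply: (can_inj rVpolyK); apply/eqP; rewrite -subr_eq0.
  apply/eqP; apply: (iu (fun k => rVpoly (row k M) - rVpoly (row k N))); rewrite -[RHS]e.
  by apply: eq_bigr => j _; rewrite rmorphB mulrBl.
- move=> M p; apply: small_sum => i _; rewrite coeffD opprD; apply: smallM; last exact: Cu.
  rewrite coeffMn coeff_zdiv pevE; apply: small_sum => j _.
  apply: smallMl; first exact: small_kap.
  have jl : (j <= l)%N by rewrite -ltnS; apply: leq_trans (ltn_ord j) (size_poly _ _).
  have := smallX j (small_ord p t); apply: smallW; rewrite -mulNrn.
  have [->|t0] := eqVneq t 0; first by rewrite invr0 ord_zero /Num.max ltxx oppr0 !mul0rn.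
  rewrite ordV // -mulr_natr natz mulNr -mulr_natr natz.
  have [a0|a0] := leP 0 (ord p t).
    by rewrite (max_idPl _) ?oppr_le0 // mul0r oppr0 mulr_ge0.
  by rewrite (max_idPr _) ?oppr_ge0 ?(ltW a0) // mulNr opprK; apply: ler_wnM2l; rewrite ?(ltW a0).
- by rewrite card_mx.
Qed.

(** The length of a basis bounds the degree of the zeros from above by [zeros_lattice]. It bounds
    the degree of the poles from below, comparing [LL_multiples] with [LL_bounded] for large [l].
    Applied to [t] and to [t^-1], this gives a cycle of inequalities, hence equalities. *)
Lemma tbasis_zdeg t n (u : 'I_n -> K) : transc kap t -> tbasis kap t u ->
  zdeg ffK t = n /\ zdeg ffK t^-1 = n.
Proof.
have upper x m (v : 'I_m -> K) : transc kap x -> tbasis kap x v -> (zdeg ffK x <= m)%N.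
  move=> trx [_ sv]; have [w [_ iw _]] := zeros_lattice ffK (transc_neq0 trx).
  exact: tspan_rank sv iw.
have lower x m (v : 'I_m -> K) : transc kap x -> tbasis kap x v -> (m <= zdeg ffK x^-1)%N.
  move=> trx [iv _]; have [C effC hC] := LL_multiples iv.
  have [c hc] := LL_bounded; rewrite leqNgt; apply/negP => lt.
  pose l := (`|ddeg C| + c)%N; have := hC l.
  have effA : effective (zdiv x^-1 *+ l + C).
    apply: effectiveD => // p; rewrite coeffMn mulrn_wge0 //; exact: effective_zdiv.
  move/(atmost_atleast (hc _ effA)); rewrite leq_exp2l ?finNzRing_gt1 //.
  rewrite raddfD raddfMn /= ddeg_zdiv; have := ddeg_effective effC.
  rewrite /l -mulr_natr natz -PoszM; nia.
move=> trt bt; have trt' := transcV (transc_neq0 trt) trt.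
have [n' [u' bt']] := ex_tbasis ffK trt'.
have := upper _ _ _ trt bt; have := lower _ _ _ trt bt.
have := upper _ _ _ trt' bt'; have := lower _ _ _ trt' bt'; rewrite invrK; lia.
Qed.

Lemma ddeg_divx x : ddeg (divx x) = 0.
Proof.
have [[p px]|h] := pselect (exists p, ord p x != 0); last first.
  have -> : divx x = 0; last exact: raddf0.
  apply: divisorP => p; rewrite coeff_divx coeff0; apply/eqP.
  by apply: contrapT => hp; apply: h; exists p; apply/negP.
have trx := transc_ord (kap := kap) px.
have [n [u bu]] := ex_tbasis ffK trx.
by rewrite /divx -lock raddfB /= !ddeg_zdiv; have [-> ->] := tbasis_zdeg trx bu; rewrite subrr.
Qed.

(** The constant [g] is the degree of the divisor [C] of [LL_multiples], not the genus. A function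
    [z] with D - div z <= l A + C compares [D] with multiples of [A], for which many functions are
    known. *)
Theorem Riemann_inequality :
  exists g : nat, forall D (m : nat), m%:Z + g%:Z <= ddeg D -> atleast (LL D) (#|F| ^ m).
Proof.
have [t [_ [_ [trt _]]]] := ffK; have [n [u bu]] := ex_tbasis ffK trt.
have [_ dA] := tbasis_zdeg trt bu; have [C effC hC] := LL_multiples (proj1 bu).
pose A := zdiv t^-1; have ddA l : ddeg (A *+ l + C) = (n * l)%N%:Z + ddeg C.
  by rewrite raddfD raddfMn /= ddeg_zdiv dA -mulr_natr natz PoszM.
have dC := ddeg_effective effC.
exists `|ddeg C|%N => D m hm.
have [E effE hE] := effective_bound D; have dE := ddeg_effective effE.
have n0 : (0 < n)%N.
  rewrite -dA /zdeg; have [p pt] := ex_pole ffK trt.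
  rewrite (big_rem p) ?mem_poles //= addn_gt0 muln_gt0 degp_gt0 // andbT absz_gt0.
  by rewrite ordV ?oppr_eq0 ?(lt_eqF pt) //; exact: transc_neq0 trt.
(* Large enough for L(l A + C - E) to contain a nonzero [z]; as E >= D, this [z] satisfies D - div z
   <= l A + C. *)
pose l := (`|ddeg E| + `|ddeg D|)%N.
have [z hz z0] : exists2 z, LL (A *+ l + C - E) z & z != 0.
  apply: atleast_nonzero; apply: (@LL_atleast _ E) => //; rewrite subrK.
  apply: atleastW (hC l) => //; apply: leq_trans (_ : #|F| ^ `|ddeg E|.+1 <= _)%N.
    by rewrite expnSr leq_mul2l finNzRing_gt1 orbT.
  rewrite leq_exp2l ?finNzRing_gt1 //; rewrite /l; nia.
have effG : effective (A *+ l + C - (D - divx z)).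
  move=> p; have := hz p; have := hE p; rewrite smallE // !(coeffB, coeffD) coeff_divx; lia.
have h : atleast (LL (D - divx z)) (#|F| ^ m).
  apply: (@LL_atleast _ _ _ effG); rewrite subrKC.
  apply: atleastW (hC l) => //; rewrite -expnD leq_exp2l ?finNzRing_gt1 //.
  rewrite raddfB /= raddfB /= ddA ddeg_divx; rewrite /l; nia.
case: h => T [r [ri rL hT]]; exists T, (fun i => z^-1 * r i); split=> //.
  by move=> i j /(mulfI (invr_neq0 z0))/ri.
move=> i; apply/(LL_mul D _ z0); rewrite mulVKf //; exact: rL.
Qed.

(** The q^(d+1) polynomials of degree at most [d] in [t] cannot all have distinct residues in a
    field with at most q^d elements. So a place of degree at most [d] is a pole of [t] or a zero of
    one of finitely many nonzero functions. *)
Lemma finitely_many_places (d : nat) : exists s : seq (place K), forall p, (deg1 p <= d)%N -> p \in s.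
Proof.
have [t [_ [_ [trt _]]]] := ffK.
exists (zer t^-1 ++ flatten [seq zer (pev kap t (rVpoly v)) | v : 'rV[F]_d.+1]) => p pd.
rewrite mem_cat mem_poles; apply/orP.
have [pt|pt] := ltP (ord p t) 0; [by left|right].
have st : small p 0 t by rewrite /small pt orbT.
suff [v v0 hv] : exists2 v : 'rV[F]_d.+1, v != 0 & small p 1 (pev kap t (rVpoly v)).
  apply/flattenP; exists (zer (pev kap t (rVpoly v))); first by apply/imageP; exists v.
  have w0 : pev kap t (rVpoly v) != 0.
    by apply: contra_neq v0 => /trt e; apply: (can_inj rVpolyK); rewrite e linear0.
  by rewrite mem_zeros; move: hv; rewrite smallE //; lia.
have [u [_ _ cov]] := degpP ffK p.
have hs (v : 'rV[F]_d.+1) : small p 0 (pev kap t (rVpoly v)) by apply: small_pev.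
have [f hf] := choice (fun v => cov _ (hs v)).
have : ~ injective f.
  move=> fi; have := leq_card f fi; rewrite card_cV card_mx mul1n.
  by rewrite leq_exp2l ?finNzRing_gt1 // leqNgt ltnS pd.
move=> /existsNP[v /existsNP[w /not_implyP[e /eqP vw]]].
exists (v - w); first by rewrite subr_eq0.
rewrite linearB rmorphB /=.
rewrite (_ : _ - _ = (pev kap t (rVpoly v) - lincomb kap u (f v)) - (pev kap t (rVpoly w) - lincomb kap u (f w))).
  exact: smallB.
by rewrite e; ring.
Qed.

Lemma finitely_many_effective (n : nat) :
  exists Es : seq (divisor K), forall E, effective E -> ddeg E <= n%:Z -> E \in Es.
Proof.
have [s hs] := finitely_many_places n; have [p0] := ex_place ffK.
exists [seq \sum_i << (f i : nat)%:Z *g nth p0 (undup s) i >> | f : {ffun 'I_(size (undup s)) -> 'I_n.+1}].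
move=> E effE dE.
have bE p : coeff p E * (deg1 p)%:Z <= n%:Z.
  apply: le_trans dE; rewrite ddegE.
  have [pE|pE] := boolP (p \in dom E); last first.
    rewrite coeff_outdom // mul0r sumr_ge0 // => q _; exact: mulr_ge0.
  rewrite (big_rem p) //= lerDl sumr_ge0 // => q _; exact: mulr_ge0.
have bc p : (`|coeff p E| < n.+1)%N.
  by have := bE p; have := effE p; have := degp_gt0 ffK p; nia.
apply/imageP; exists [ffun i : 'I__ => inord `|coeff (nth p0 (undup s) i) E|%N] => //.
rewrite (eq_bigr (fun i : 'I_(size (undup s)) => << coeff (nth p0 (undup s) i) E *g nth p0 (undup s) i >>)); last first.
  by move=> i _; rewrite ffunE inordK // gez0_abs.
rewrite -(big_mkord xpredT (fun i => << coeff (nth p0 (undup s) i) E *g nth p0 (undup s) i >>)).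
rewrite -(big_nth p0 xpredT (fun p => << coeff p E *g p >>)).
apply: divisorP => p; rewrite (coeff_sumU (fun q => coeff q E)) ?undup_uniq // mem_undup; case: ifPn => // ps.
apply/eqP; apply: contraNT ps => cp; apply: hs.
by have := bE p; have := effE p; nia.
Qed.

(** For k = g + 1 the divisor [D + k p0] has degree at least g + 1, so it has a nonzero function,
    which carries it to one of finitely many effective divisors of bounded degree. *)
Lemma finite_class_number :
  exists Es : seq (divisor K), forall D, ddeg D = 0 ->
    exists E z, [/\ E \in Es, z != 0 & D = E + divx z].
Proof.
have [g hg] := Riemann_inequality; have [p0] := ex_place ffK.
pose k := g.+1; have [Es hEs] := finitely_many_effective (k * deg1 p0).
exists [seq E - << p0 >> *+ k | E <- Es] => D dD.
have dk : ddeg (<< p0 >> *+ k) = (k * deg1 p0)%N%:Z.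
  by rewrite raddfMn /= ddegU mul1r -mulr_natr natz mulrC PoszM.
have [z hz z0] : exists2 z, LL (D + << p0 >> *+ k) z & z != 0.
  apply: atleast_nonzero; apply: (@atleastW _ (LL (D + << p0 >> *+ k)) _ (#|F| ^ 1)) => //.
    by rewrite expn1 finNzRing_gt1.
  by apply: hg; rewrite raddfD /= dD dk /k; have := degp_gt0 ffK p0; nia.
exists (D + divx z), z^-1; split; rewrite ?invr_eq0 //; last first.
  by rewrite divxV // addrK.
apply/mapP; exists (D + divx z + << p0 >> *+ k); last by rewrite addrK.
apply: hEs.
  by move=> p; have := hz p; rewrite smallE // !coeffD coeff_divx; lia.
by rewrite !raddfD /= dD ddeg_divx dk !add0r.
Qed.

End Divisors.

(** * Local squares *)

Section ResidueField.
Variables (K : fieldType) (p : place K).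

Definition vring : {pred K} := [pred x | small p 0 x].

Lemma vring_subring : subring_closed vring.
Proof.
split=> [|x y|x y]; rewrite ?inE; first exact: small1.
- exact: smallB.
- exact: smallMl.
Qed.

HB.instance Definition _ := GRing.isSubringClosed.Build K vring vring_subring.

Definition vint := {x : K | x \in vring}.
HB.instance Definition _ := SubChoice.on vint.
HB.instance Definition _ := [SubChoice_isSubComNzRing of vint by <:].

Definition vmax : {pred vint} := [pred u : vint | small p 1 (val u)].

Lemma vmax_ideal : idealr_closed vmax.
Proof.
split; rewrite ?inE.
- exact: small0.
- by rewrite /small /= oner_eq0 ord1.
- move=> a u w; rewrite !inE /= => hu hw; apply: smallD => //.
  by apply: smallMl => //; exact: (valP a).
Qed.

HB.instance Definition _ := isIdealr.Build vint vmax vmax_ideal.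

(** The residue field is made an actual field in order to find a primitive root of unity in it. *)
Definition residue := {ideal_quot vmax}.
HB.instance Definition _ := GRing.ComNzRing.on residue.

Definition res (x : K) : residue := \pi_residue (insubd (0 : vint) x).

Lemma res_eq x y : small p 0 x -> small p 0 y -> (res x == res y) = small p 1 (x - y).
Proof.
move=> hx hy; rewrite /res -Quotient.idealrBE inE /=.
by rewrite !val_insubd !inE hx hy.
Qed.

Lemma res1 : res 1 = 1.
Proof.
rewrite -[RHS](rmorph1 \pi_{ideal_quot vmax}); congr \pi; apply: val_inj.
by rewrite val_insubd inE small1.
Qed.

Lemma resM x y : small p 0 x -> small p 0 y -> res (x * y) = res x * res y.
Proof.
move=> hx hy; rewrite -[RHS](rmorphM \pi_{ideal_quot vmax}); congr \pi; apply: val_inj.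
by rewrite /= !val_insubd !inE hx hy smallMl.
Qed.

Lemma res_surj (a : residue) : exists2 x, small p 0 x & a = res x.
Proof.
exists (val (generic_quotient.repr a)); first exact: (valP (generic_quotient.repr a)).
by rewrite /res valKd reprK.
Qed.

Lemma res_eq0 x : small p 0 x -> (res x == 0) = small p 1 x.
Proof.
move=> hx; have -> : 0 = res 0.
  rewrite -[LHS](rmorph0 \pi_{ideal_quot vmax}); congr \pi; apply: val_inj.
  by rewrite val_insubd inE small0.
by rewrite res_eq ?small0 // subr0.
Qed.

Definition residue_inv (a : residue) : residue := classical_sets.xget 0 (fun b => b * a = 1).

Lemma residue_mulV (a : residue) : a != 0 -> residue_inv a * a = 1.
Proof.
move=> a0; apply: (@classical_sets.xgetPex _ 0 (fun b => b * a = 1)).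
have [x hx e] := res_surj a; rewrite e res_eq0 // in a0.
have x0 : x != 0 by apply: contraNneq a0 => ->; exact: small0.
have px : ord p x = 0 by move: hx a0; rewrite !smallE //; lia.
have hx' : small p 0 x^-1 by rewrite smallE ?invr_eq0 // ordV // px.
by exists (res x^-1); rewrite e -resM // mulVf // res1.
Qed.

Lemma residue_inv0 : residue_inv 0 = 0.
Proof.
rewrite /residue_inv; apply: classical_sets.xgetPN => b /eqP.
by rewrite mulr0 eq_sym oner_eq0.
Qed.

HB.instance Definition _ :=
  GRing.ComNzRing_isField.Build residue residue_mulV residue_inv0.

End ResidueField.

Section LocalUnits.
Variable K : fieldType.
Implicit Types (p : place K) (x y : K).

Definition is_unit p x := (x != 0) && (ord p x == 0).

Lemma unit_small p x : is_unit p x -> small p 0 x.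
Proof. by case/andP => x0 /eqP px; rewrite /small px lexx orbT. Qed.

Lemma unitNsmall p x : small p 0 x -> is_unit p x = ~~ small p 1 x.
Proof.
move=> hx; rewrite /is_unit; have [x0|x0] := eqVneq x 0; first by rewrite x0 small0.
by move: hx; rewrite !smallE //=; lia.
Qed.

Lemma unit_mul p x y : is_unit p x -> is_unit p y -> is_unit p (x * y).
Proof.
by move=> /andP[x0 /eqP px] /andP[y0 /eqP py]; rewrite /is_unit mulf_neq0 // ordM // px py.
Qed.

Lemma unit_exp p x n : is_unit p x -> is_unit p (x ^+ n).
Proof.
by case/andP => x0 /eqP px; rewrite /is_unit expf_neq0 // ordX // px mul0rn.
Qed.

Lemma unit_inv p x : is_unit p x -> is_unit p x^-1.
Proof. by case/andP => x0 /eqP px; rewrite /is_unit invr_eq0 x0 ordV // px. Qed.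

Lemma unit_congr p x y : is_unit p x -> small p 1 (x - y) -> is_unit p y.
Proof.
move=> ux h; have -> : y = x + - (x - y) by rewrite opprB subrKC.
case/andP: ux => x0 /eqP px; have [|e1 e2] := @ord_small_add _ p x (- (x - y)) x0.
  by rewrite px; apply: smallN.
by rewrite /is_unit e1 e2 px.
Qed.

End LocalUnits.

Section LocalSquares.
Variables (F : finFieldType) (K : fieldType) (kap : {rmorphism F -> K}).
Hypotheses (ffK : ffield kap) (odd_char : (2%:R : F) != 0).
Implicit Types (p : place K) (x y u : K).

Lemma two_neq0 : (2%:R : K) != 0.
Proof. by rewrite -(rmorph_nat kap) fmorph_eq0. Qed.

Lemma unit2 p : is_unit p 2%:R.
Proof. by rewrite /is_unit two_neq0 -(rmorph_nat kap) ord_kap. Qed.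

Lemma odd_card : odd #|F|.
Proof.
apply: contraT; rewrite -dvdn2 => h.
have /(Cauchy (isT : prime 2))[x _ ox] : (2 %| #|[set: F]%G|)%N by rewrite cardsT.
have x2 : (x *+ 2)%R = 0 by rewrite -[LHS]/(x ^+ 2)%g -ox expg_order.
have x0 : x != 0 by apply: contra_eq_neq ox => ->; rewrite -[0]/(1%g) order1.
by move: x2; rewrite -mulr_natr => /eqP; rewrite mulf_eq0 (negbTE x0) (negbTE odd_char).
Qed.

Lemma odd_residue_card p : odd (#|F| ^ degp kap p).
Proof. by rewrite oddX odd_card orbT. Qed.

(** Multiplication by a unit [a] permutes the units of the residue field and so fixes their product,
    whence a^(N-1) = 1. A field with N - 1 such roots of unity contains a primitive one, and [g]
    lifts it. *)
Lemma ex_primitive_root p : let N := (#|F| ^ degp kap p)%N in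
  exists2 g, is_unit p g & (forall i j, small p 1 (g ^+ i - g ^+ j) = (i == j %[mod N.-1])%N) /\
    forall x, is_unit p x -> exists i, small p 1 (x - g ^+ i).
Proof.
move=> N; have [u [h1 h2 h3]] := degpP ffK p.
pose T := 'cV[F]_(degp kap p); pose r : T -> K := lincomb kap u.
have cT : #|T| = N by exact: card_cV.
pose e (c : T) : residue p := res p (r c).
have ei : injective e by move=> c c' /eqP; rewrite res_eq // => /h2.
have es a : exists c, a = e c.
  have [x hx ->] := res_surj a; have [c hc] := h3 x hx.
  by exists c; apply/eqP; rewrite res_eq.
have [c0 e0] := es 0; have cN c : (e c != 0) = (c != c0).
  by rewrite e0 (inj_eq ei).
have N1 : (0 < N.-1)%N.
  rewrite -ltnS prednK; last by rewrite expn_gt0 ltnW // finNzRing_gt1.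
  by rewrite -[1%N](expn0 #|F|) ltn_exp2l ?finNzRing_gt1 // degp_gt0.
have unity (a : residue p) : a != 0 -> a ^+ N.-1 = 1.
  move=> a0; have [h hh] := choice (fun c => es (a * e c)).
  have hi : injective h.
    by move=> c c' ehc; apply/ei/(mulfI a0); rewrite !hh ehc.
  have P0 : \prod_(c | c != c0) e c != 0.
    by apply/prodf_neq0 => c; rewrite cN.
  have E : \prod_(c | c != c0) e c = \prod_(c | c != c0) (a * e c).
    rewrite (reindex_inj hi); apply: eq_big => [c|c _]; last by rewrite hh.
    by rewrite -!cN -hh mulf_eq0 (negbTE a0).
  apply: (mulIf P0); rewrite mul1r [in RHS]E.
  rewrite big_split /= prodr_const; congr (_ ^+ _ * _).
  by rewrite -cT -(cardC1 c0); apply: eq_card => c; rewrite !inE.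
pose rs := [seq e c | c <- enum (predC1 c0)].
have [|||z zrs prz] := hasP (@has_prim_root (residue p) N.-1 rs N1 _ _ _).
- by apply/allP => a /mapP[c]; rewrite mem_enum inE -cN => hc ->; apply/unity_rootP/unity.
- by rewrite map_inj_uniq // enum_uniq.
- by rewrite size_map -cardE -cT cardC1.
have [g hg eg] := res_surj z.
have gz i : res p (g ^+ i) = z ^+ i.
  elim: i => [|i IH]; first by rewrite !expr0 res1.
  by rewrite !exprS resM // ?IH ?eg //; have := smallX i hg; rewrite mul0rn.
have gs i : small p 0 (g ^+ i) by have := smallX i hg; rewrite mul0rn.
exists g.
  rewrite unitNsmall // -res_eq0 // -eg; apply/negP => /eqP z0.
  by have := prim_expr_order prz; rewrite z0 expr0n gtn_eqF // => /eqP; rewrite eq_sym oner_eq0.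
split=> [i j|x ux]; first by rewrite -res_eq // !gz (eq_prim_root_expr prz).
have sx := unit_small ux.
have /unity/(prim_rootP prz)[i hi] : res p x != 0 by rewrite res_eq0 // -unitNsmall.
by exists i; rewrite -res_eq // hi gz.
Qed.

Lemma is_square_atP p u : is_square_at p u <->
  exists s, cauchy_seq p s /\ null_seq p (fun n => s n ^+ 2 - u).
Proof.
have key (s : cauchy_ring p) :
    (\pi_(completion p) s) ^+ 2 = to_completion p u <-> null_seq p (fun n => val s n ^+ 2 - u).
  rewrite -[X in X = _](rmorphXn \pi_{ideal_quot (@null K p)}); split.
    by move=> /eqP; rewrite -Quotient.idealrBE inE => /asboolP.
  move=> h; have : s ^+ 2 - (exist (fun w => w \in @cauchy K p) _ (cst_cauchy p u) : cauchy_ring p) \in @null K p.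
    by rewrite inE; apply/asboolP.
  by rewrite Quotient.idealrBE => /eqP.
split.
  move=> [y hy]; exists (val (generic_quotient.repr y)); split; first by have /asboolP := valP (generic_quotient.repr y).
  by apply/key; rewrite reprK.
move=> [s [cs ns]]; have cs' : s \in @cauchy K p by apply/asboolP.
by exists (\pi_(completion p) (exist _ s cs')); apply/key.
Qed.

(** Newton's iteration: the new error [f y ^+ 2 - u] is the square of [(y ^+ 2 - u) / (2 y)], and 2
    y is a unit in odd characteristic. *)
Lemma is_square_at_unit p u : is_unit p u ->
  is_square_at p u <-> exists y, small p 1 (u - y ^+ 2).
Proof.
move=> uu; split.
  move=> /is_square_atP[s [_ /(_ 1)[n hn]]]; exists (s n).
  by rewrite -opprB; apply/smallN/hn.
move=> [y0 hy0]; apply/is_square_atP.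
pose f y := y - (y ^+ 2 - u) / (2%:R * y).
pose s n := iter n f y0.
have step n y : is_unit p y -> small p n.+1%:Z (y ^+ 2 - u) ->
    [/\ is_unit p (f y), small p n.+1%:Z (f y - y) & small p n.+2%:Z (f y ^+ 2 - u)].
  move=> uy hy; have u2y : is_unit p (2%:R * y) by apply: unit_mul; rewrite ?unit2.
  have yn0 : y != 0 by case/andP: uy.
  have hd : small p n.+1%:Z ((y ^+ 2 - u) / (2%:R * y)).
    by rewrite mulrC; apply: smallMl => //; apply/unit_small/unit_inv.
  have e : f y - y = - ((y ^+ 2 - u) / (2%:R * y)) by rewrite /f; ring.
  split.
  - apply: unit_congr uy _; rewrite -opprB e opprK; apply: smallW hd; lia.
  - by rewrite e; apply: smallN.
  - have -> : f y ^+ 2 - u = ((y ^+ 2 - u) / (2%:R * y)) ^+ 2.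
      by rewrite /f; field; rewrite yn0 two_neq0.
    by apply: smallW (smallX 2 hd); lia.
have uy0 : is_unit p y0.
  have : is_unit p (y0 ^+ 2) by apply: unit_congr uu hy0.
  by rewrite /is_unit expf_eq0 /=; case: eqVneq => //= y00; rewrite ordX // mulrn_eq0.
have inv n : is_unit p (s n) /\ small p n.+1%:Z (s n ^+ 2 - u).
  elim: n => [|n [IH1 IH2]]; first by split=> //; rewrite -opprB; apply: smallN.
  by have [a _ b] := step n _ IH1 IH2.
have cs n k : small p n.+1%:Z (s (n + k)%N - s n).
  elim: k => [|k IH]; first by rewrite addn0 subrr small0.
  rewrite -[s (n + k.+1)%N](subrK (s (n + k)%N)) -addrA; apply: smallD => //.
  have [a b] := inv (n + k)%N; have [_ c _] := step _ _ a b.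
  by rewrite addnS; apply: smallW c; lia.
exists s; split=> N.
  exists `|N|%N => m n hm hn.
  rewrite (_ : s m - s n = (s m - s `|N|%N) - (s n - s `|N|%N)); last by ring.
  by apply: smallB; [rewrite -(subnKC hm)|rewrite -(subnKC hn)]; apply: smallW (cs _ _); lia.
by exists `|N|%N => n hn; have [_] := inv n; apply: smallW; lia.
Qed.

Definition nonsquare_at p x : bool := ~~ `[< is_square_at p x >].

(** The parity of the exponent is well defined because the residue field has an even number of
    units. *)
Lemma nonsquare_at_power p g i x : is_unit p g ->
  (forall i j, small p 1 (g ^+ i - g ^+ j) = (i == j %[mod (#|F| ^ degp kap p).-1])%N) ->
  (forall x, is_unit p x -> exists i, small p 1 (x - g ^+ i)) ->
  is_unit p x -> small p 1 (x - g ^+ i) -> nonsquare_at p x = odd i.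
Proof.
move=> ug hg gen ux hx; rewrite -[odd i]negbK; congr (~~ _); apply/asboolP/idP.
  move/(is_square_at_unit ux) => [y hy].
  have uy : is_unit p y.
    have : is_unit p (y ^+ 2) by apply: unit_congr ux hy.
    by rewrite /is_unit expf_eq0 /=; case: eqVneq => //= y00; rewrite ordX // mulrn_eq0.
  have [j hj] := gen y uy.
  have : small p 1 (g ^+ i - g ^+ (j * 2)).
    rewrite exprM (_ : _ - _ = - (x - g ^+ i) + (x - y ^+ 2) + (y - g ^+ j) * (y + g ^+ j)); last by ring.
    apply: smallD; first by apply: smallD => //; apply: smallN.
    rewrite mulrC; apply: smallMl => //; apply: smallD; first exact: unit_small.
    by apply/unit_small/unit_exp.
  rewrite hg => /eqP /(congr1 odd).
  have oM : ~~ odd (#|F| ^ degp kap p).-1.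
    by have := odd_residue_card p; case: (_ ^ _)%N => // n /=.
  have om k n : ~~ odd n -> odd (k %% n) = odd k.
    by move=> /negbTE on; rewrite [in RHS](divn_eq k n) oddD oddM on andbF.
  by rewrite !om // oddM andbF => ->.
move=> ei; apply/(is_square_at_unit ux); exists (g ^+ i./2).
by rewrite -exprM muln2 halfK (negbTE ei) subn0.
Qed.

Lemma nonsquare_atM p x y : is_unit p x -> is_unit p y ->
  nonsquare_at p (x * y) = nonsquare_at p x (+) nonsquare_at p y.
Proof.
move=> ux uy; have [g ug [hg gen]] := ex_primitive_root p.
have [i hi] := gen x ux; have [j hj] := gen y uy.
rewrite (nonsquare_at_power ug hg gen ux hi) (nonsquare_at_power ug hg gen uy hj) -oddD.
apply: (nonsquare_at_power ug hg gen (unit_mul ux uy)).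
rewrite exprD (_ : _ - _ = (x - g ^+ i) * y + g ^+ i * (y - g ^+ j)); last by ring.
apply: smallD; first by rewrite mulrC; apply: smallMl => //; exact: unit_small.
by apply: smallMl => //; apply/unit_small/unit_exp.
Qed.

Lemma nonsquare_atMsq p x m : m != 0 -> nonsquare_at p (x * m ^+ 2) = nonsquare_at p x.
Proof. by move=> m0; rewrite /nonsquare_at (asbool_equiv_eq (is_square_atM2 p x m0)). Qed.

End LocalSquares.

(** * Parities of permutations and Zolotarev's lemma *)

Section PermutationParity.
Implicit Types (T : finType).

Definition fperm T (f : T -> T) : {perm T} :=
  if pselect (injective f) is left h then perm h else 1%g.

Lemma fpermE T (f : T -> T) : injective f -> fperm f =1 f.
Proof. by move=> fi x; rewrite /fperm; case: pselect => // h; rewrite permE. Qed.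

Definition fodd T (f : T -> T) : bool := odd_perm (fperm f).

Lemma fodd_comp T (f g : T -> T) : injective f -> injective g ->
  fodd (f \o g) = fodd f (+) fodd g.
Proof.
move=> fi gi; rewrite addbC -odd_permM; congr odd_perm; apply/permP => x.
by rewrite permM !fpermE //; apply: inj_comp.
Qed.

Lemma fodd_ext T (f g : T -> T) : f =1 g -> fodd f = fodd g.
Proof. by move=> /funext ->. Qed.

Lemma fodd_id T (f : T -> T) : (forall x, f x = x) -> fodd f = false.
Proof.
move=> h; rewrite /fodd (_ : fperm f = 1%g) ?odd_perm1 //.
by apply/permP => x; rewrite fpermE ?perm1 // => a b; rewrite !h.
Qed.

Lemma fodd_iter T (f : T -> T) n : injective f -> fodd (iter n f) = odd n && fodd f.
Proof.
move=> fi; elim: n => [|n IH]; first exact: fodd_id.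
rewrite (_ : fodd (iter n.+1 f) = fodd (f \o iter n f)) // fodd_comp //; last first.
  by elim: n {IH} => [|n IHn] x y //= /fi/IHn.
by rewrite IH /=; case: (odd n); case: (fodd f).
Qed.

Lemma card_porbit_eq T (s : {perm T}) x m : (0 < m)%N -> iter m s x = x ->
  (forall i, (0 < i < m)%N -> iter i s x != x) -> #|porbit s x| = m.
Proof.
move=> m0 im hm; have n0 : (0 < #|porbit s x|)%N by rewrite lt0n card_porbit_neq0.
have [lt|gt|//] := ltngtP #|porbit s x| m.
  by have := hm #|porbit s x|; rewrite n0 lt iter_porbit eqxx => /(_ isT).
have := uniq_traject_porbit s x => /(uniqP x)/(_ 0%N m); rewrite !inE size_traject.
by move=> /(_ n0 gt); rewrite !nth_traject // im => /(_ erefl) e; rewrite -e in m0.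
Qed.

(** The sign is the parity of [#|T|] minus the number of orbits: fixed points cancel, and each of
    the [k] remaining orbits contributes m - 1. *)
Lemma odd_perm_of_orbits T (s : {perm T}) m :
  (forall x, s x != x -> #|porbit s x| = m) ->
  exists k, #|[set x | s x != x]| = (m * k)%N /\ odd_perm s = odd (m * k) (+) odd k.
Proof.
move=> hm; pose P1 := [set C in porbits s | #|C| == 1%N]; pose P2 := [set C in porbits s | #|C| != 1%N].
have sumT : #|T| = (\sum_(C in porbits s) #|C|)%N.
  rewrite -sum1_card (partition_big (porbit s) (mem (porbits s))) /=; last first.
    by move=> x _; apply: imset_f.
  apply: eq_bigr => C /imsetP[y _ ->]; rewrite sum1dep_card; apply: eq_card => x.
  by rewrite inE eq_porbit_mem.
have porbit1 x : (#|porbit s x| == 1%N) = (s x == x).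
  apply/idP/eqP => [/cards1P[y e]|sx].
    by have := mem_porbit s 1 x; have := porbit_id s x; rewrite e !inE expg1 => /eqP -> /eqP.
  by apply/eqP; apply: card_porbit_eq => // -[|i].
have P1E : #|P1| = #|[set x | s x == x]|.
  rewrite -(card_imset _ (@set1_inj T)); apply: eq_card => C; rewrite !inE.
  apply/andP/imsetP => [[/imsetP[x _ ->]]|[x]].
    rewrite porbit1 => sx; exists x; rewrite ?inE //; move: sx; rewrite -porbit1 => /cards1P[y e].
    by have := porbit_id s x; rewrite e inE => /eqP ->.
  rewrite inE => sx ->; rewrite cards1; split=> //.
  move: (sx); rewrite -porbit1 => /cards1P[y e]; have := porbit_id s x.
  by rewrite e inE => /eqP ->; rewrite -e; apply: imset_f.
have cP : #|porbits s| = (#|P1| + #|P2|)%N.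
  rewrite -(cardsID [set C : {set T} | #|C| == 1%N] (porbits s)); congr (_ + _)%N; apply: eq_card => C.
    by rewrite !inE.
  by rewrite !inE andbC.
have cT : #|T| = (#|P1| + m * #|P2|)%N.
  rewrite sumT (bigID (fun C : {set T} => #|C| == 1%N)) /=; congr (_ + _)%N.
    rewrite -sum1dep_card big_mkcond [RHS]big_mkcond /=.
    by apply: eq_bigr => C _; case: andP => // -[_ /eqP].
  rewrite mulnC -sum_nat_const; apply: eq_big => [C|C]; first by rewrite !inE.
  by case/andP=> /imsetP[x _ ->]; rewrite porbit1 => /hm.
exists #|P2|; split.
  have := cardsC [set x | s x == x]; rewrite cT P1E => /addnI <-.
  by apply: eq_card => x; rewrite !inE.
by rewrite /odd_perm cT cP !oddD; case: (odd _); case: (odd (m * _)); case: (odd _).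
Qed.

(* It is enough to look at transpositions, which generate.                    *)
Lemma fodd_lift T T' (Phi : {perm T} -> T' -> T') (r : nat) :
  (forall g, injective (Phi g)) -> (forall g h, Phi (g * h)%g =1 Phi h \o Phi g) ->
  (forall v, Phi 1%g v = v) ->
  (forall x y, x != y -> #|[set v | Phi (tperm x y) v != v]| = (r * 2)%N) -> odd r ->
  forall g, fodd (Phi g) = odd_perm g.
Proof.
move=> inj hM h1 hr or g; have [ts -> dts] := prod_tpermP g.
elim: ts dts => [|[x y] ts IH] /=.
  by move=> _; rewrite big_nil odd_perm1; apply: fodd_id.
move=> /andP[dxy dts]; rewrite big_cons odd_permM odd_tperm /= -(IH dts).
rewrite (fodd_ext (hM _ _)) fodd_comp // addbC; congr (_ (+) _).
rewrite /dpair /= in dxy; rewrite dxy.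
have inv v : Phi (tperm x y) (Phi (tperm x y) v) = v.
  by have := hM (tperm x y) (tperm x y) v; rewrite /= tperm2 h1.
have [v|k [ck ok]] := @odd_perm_of_orbits _ (fperm (Phi (tperm x y))) 2.
  rewrite fpermE // => nv; apply: card_porbit_eq => //=; first by rewrite !fpermE.
  by move=> [|[|i]] //= _; rewrite fpermE.
rewrite /fodd ok oddM /=; suff -> : k = r by [].
have : (2 * k = r * 2)%N.
  rewrite -ck -(hr x y dxy); apply: eq_card => v; rewrite !inE fpermE //.
by lia.
Qed.

End PermutationParity.

(** * The sign of an invertible matrix as a permutation of vectors *)

Section MatrixParity.
Variable F : finFieldType.
Hypothesis odd_char : (2%:R : F) != 0.

Definition mxodd n (A : 'M[F]_n) : bool := fodd (fun v : 'cV[F]_n => A *m v).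

Lemma mulmx_inj n (A : 'M[F]_n) : A \in unitmx -> injective (fun v : 'cV[F]_n => A *m v).
Proof. by move=> uA v w; apply: (can_inj (mulKmx uA)). Qed.

Lemma mxoddM n (A B : 'M[F]_n) : A \in unitmx -> B \in unitmx ->
  mxodd (A *m B) = mxodd A (+) mxodd B.
Proof.
move=> uA uB; rewrite -fodd_comp; try exact: mulmx_inj.
by apply: fodd_ext => v; rewrite /= mulmxA.
Qed.

(** The sign of multiplication by [a] on [F], that is, the quadratic character in additive
    notation. *)
Definition scodd (a : F) : bool := mxodd (a%:M : 'M_1).

Lemma scalar_unitmx n (a : F) : a != 0 -> (a%:M : 'M_n) \in unitmx.
Proof. by move=> a0; rewrite unitmxE det_scalar unitrX // unitfE. Qed.

Lemma scoddM a b : a != 0 -> b != 0 -> scodd (a * b) = scodd a (+) scodd b.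
Proof.
by move=> a0 b0; rewrite /scodd -mxoddM ?scalar_unitmx // -scalar_mxM.
Qed.

Lemma scodd1 : scodd 1 = false.
Proof. by apply: fodd_id => v; rewrite mul1mx. Qed.

Lemma card_natr0 : (#|F|%:R : F) = 0.
Proof.
have h : ((1%R : F) ^+ #|[set: F]%G|)%g = 1%g by apply: expg_cardG; rewrite inE.
by move: h; rewrite cardsT FinRing.zmodXgE.
Qed.

(** As (1 + N)^k = 1 + k N, the power with exponent q = [#|F|] is the identity. Since q is odd, the
    permutation is even; and the determinant d satisfies d = d^q = 1. *)
Lemma transvection_parity n (N : 'M[F]_n) : N *m N = 0 ->
  [/\ 1%:M + N \in unitmx, \det (1%:M + N) = 1 & mxodd (1%:M + N) = false].
Proof.
move=> NN; pose A := 1%:M + N.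
have AN k : A *m (1%:M + k%:R *: N) = 1%:M + k.+1%:R *: N.
  rewrite mulmxDl mul1mx mulmxDr mulmx1 -scalemxAr NN scaler0 addr0.
  by rewrite -addrA -natr1 scalerDl scale1r.
have it k (v : 'cV_n) : iter k (fun v => A *m v) v = (1%:M + k%:R *: N) *m v.
  elim: k => [|k IH]; first by rewrite scale0r addr0 mul1mx.
  by rewrite iterS IH mulmxA AN.
have itd k : \det (1%:M + k%:R *: N) = \det A ^+ k.
  elim: k => [|k IH]; first by rewrite scale0r addr0 det1.
  by rewrite exprS -IH -det_mulmx AN.
have dA : \det A = 1 by rewrite -[LHS]expf_card -itd card_natr0 scale0r addr0 det1.
have uA : A \in unitmx by rewrite unitmxE dA unitr1.
split=> //; have := fodd_iter #|F| (mulmx_inj uA).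
rewrite odd_card //= => e; rewrite /mxodd -/A -[LHS]e.
by apply: fodd_id => v; rewrite it card_natr0 scale0r addr0 mul1mx.
Qed.

(** Each diagonal block acts on one component only, so a transposition of that component becomes a
    product of [r] transpositions, where [r] is the number of values of the other component, an odd
    power of an odd cardinality or 1, hence odd in all cases. *)
Lemma block_parity n (a : 'M[F]_1) (D : 'M[F]_n) : a \in unitmx -> D \in unitmx ->
  mxodd (block_mx a 0 0 D) = mxodd a (+) mxodd D.
Proof.
move=> ua uD.
have ub : (block_mx a 0 0 1%:M : 'M[F]_(1 + n)) \in unitmx.
  by rewrite unitmxE det_lblock det1 mulr1 -unitmxE.
have ub' : (block_mx 1%:M 0 0 D : 'M[F]_(1 + n)) \in unitmx.
  by rewrite unitmxE det_lblock det1 mul1r -unitmxE.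
have -> : block_mx a 0 0 D = block_mx a 0 0 1%:M *m block_mx 1%:M 0 0 D.
  by rewrite mulmx_block !mulmx0 !mul0mx !addr0 !add0r mulmx1 mul1mx.
rewrite mxoddM //; congr (_ (+) _).
- pose Phi (g : {perm 'cV[F]_1}) (v : 'cV[F]_(1 + n)) := col_mx (g (usubmx v)) (dsubmx v).
  have -> : mxodd (block_mx a 0 0 (1%:M : 'M_n)) = fodd (Phi (fperm (fun v : 'cV_1 => a *m v))).
    rewrite /mxodd; apply: fodd_ext => v; rewrite /Phi fpermE; last exact: mulmx_inj.
    by rewrite -{1}[v]vsubmxK mul_block_col !mul0mx addr0 add0r mul1mx.
  apply: (@fodd_lift _ _ Phi (#|F| ^ n)).
  + by move=> g v w /eq_col_mx[/perm_inj e1 e2]; rewrite -[v]vsubmxK e1 e2 vsubmxK.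
  + by move=> g h v; rewrite /Phi /= col_mxKu col_mxKd permM.
  + by move=> v; rewrite /Phi perm1 vsubmxK.
  + move=> x y xy; pose h (c : bool * 'cV[F]_n) := col_mx (if c.1 then x else y) c.2.
    have hi : injective h.
      move=> [b v] [b' v'] /eq_col_mx[/= e ->]; congr pair.
      by move: e xy; case: b; case: b' => // ->; rewrite eqxx.
    rewrite mulnC -card_bool -card_cV -card_prod -(card_codom hi); apply: eq_card => v.
    rewrite inE /Phi; apply/idP/codomP => [|[[b w] ->]].
      rewrite -{3}[v]vsubmxK => nv.
      have : tperm x y (usubmx v) != usubmx v by apply: contra_neq nv => ->.
      case: tpermP => [e _|e _|]; last by rewrite eqxx.
        by exists (true, dsubmx v); rewrite /h /= -e vsubmxK.
      by exists (false, dsubmx v); rewrite /h /= -e vsubmxK.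
    rewrite /h col_mxKu col_mxKd /=; apply: contra_neq xy => /eq_col_mx[+ _].
    by case: b; rewrite ?tpermL ?tpermR.
  + by rewrite oddX odd_card // orbT.
- pose Phi (g : {perm 'cV[F]_n}) (v : 'cV[F]_(1 + n)) := col_mx (usubmx v) (g (dsubmx v)).
  have -> : mxodd (block_mx (1%:M : 'M_1) 0 0 D) = fodd (Phi (fperm (fun v : 'cV_n => D *m v))).
    rewrite /mxodd; apply: fodd_ext => v; rewrite /Phi fpermE; last exact: mulmx_inj.
    by rewrite -{1}[v]vsubmxK mul_block_col !mul0mx addr0 add0r mul1mx.
  apply: (@fodd_lift _ _ Phi #|F|).
  + by move=> g v w /eq_col_mx[e1 /perm_inj e2]; rewrite -[v]vsubmxK e1 e2 vsubmxK.
  + by move=> g h v; rewrite /Phi /= col_mxKu col_mxKd permM.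
  + by move=> v; rewrite /Phi perm1 vsubmxK.
  + move=> x y xy; pose h (c : bool * 'cV[F]_1) := col_mx c.2 (if c.1 then x else y).
    have hi : injective h.
      move=> [b v] [b' v'] /eq_col_mx[/= -> e]; congr pair.
      by move: e xy; case: b; case: b' => // ->; rewrite eqxx.
    rewrite mulnC -card_bool -[#|F|]expn1 -card_cV -card_prod -(card_codom hi); apply: eq_card => v.
    rewrite inE /Phi; apply/idP/codomP => [|[[b w] ->]].
      rewrite -{3}[v]vsubmxK => nv.
      have : tperm x y (dsubmx v) != dsubmx v by apply: contra_neq nv => ->.
      case: tpermP => [e _|e _|]; last by rewrite eqxx.
        by exists (true, usubmx v); rewrite /h /= -e vsubmxK.
      by exists (false, usubmx v); rewrite /h /= -e vsubmxK.
    rewrite /h col_mxKu col_mxKd /=; apply: contra_neq xy => /eq_col_mx[_].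
    by case: b; rewrite ?tpermL ?tpermR.
  + by rewrite odd_card.
Qed.

(** Gaussian elimination: a matrix with nonzero corner is a block diagonal matrix between two
    factors of the form 1 + N with N^2 = 0; a zero corner is first made nonzero by adding another
    row, which is multiplication by such a factor. *)
Theorem mxodd_det n (A : 'M[F]_n) : A \in unitmx -> mxodd A = scodd (\det A).
Proof.
elim: n A => [|n IH] A uA.
  by rewrite det_mx00 scodd1; apply: fodd_id => v; apply/matrixP => -[].
have nz0 (B : 'M[F]_(1 + n)) : B \in unitmx -> B 0 0 != 0 -> mxodd B = scodd (\det B).
  move=> uB B00; pose a := ulsubmx B.
  have ea : a = (B 0 0)%:M.
    apply/matrixP => i j; rewrite !zmodp.ord1 !mxE eqxx mulr1n.
    by congr (B _ _); apply: val_inj.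
  have ua : a \in unitmx by rewrite ea scalar_unitmx.
  pose L := block_mx (1%:M : 'M_1) 0 (dlsubmx B *m invmx a) (1%:M : 'M_n).
  pose U := block_mx (1%:M : 'M_1) (invmx a *m ursubmx B) 0 (1%:M : 'M_n).
  pose D := drsubmx B - dlsubmx B *m invmx a *m ursubmx B.
  have eB : B = L *m block_mx a 0 0 D *m U.
    rewrite !mulmx_block !mulmx0 !mul0mx !addr0 !add0r !mulmx1 !mul1mx mulmxKV //.
    by rewrite mulKVmx // mulmxA /D subrKC /a addr0 submxK.
  have LE : L = 1%:M + block_mx 0 0 (dlsubmx B *m invmx a) 0.
    by rewrite scalar_mx_block add_block_mx !addr0 add0r.
  have UE : U = 1%:M + block_mx 0 (invmx a *m ursubmx B) 0 0.
    by rewrite scalar_mx_block add_block_mx !addr0 add0r.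
  have [uL dL sL] := @transvection_parity _ (block_mx 0 0 (dlsubmx B *m invmx a) 0)
    (ltac:(by rewrite mulmx_block !mulmx0 !mul0mx !addr0 block_mx0)).
  have [uU dU sU] := @transvection_parity _ (block_mx 0 (invmx a *m ursubmx B) 0 0)
    (ltac:(by rewrite mulmx_block !mulmx0 !mul0mx !addr0 block_mx0)).
  rewrite -LE in uL dL sL; rewrite -UE in uU dU sU.
  have dB : \det B = B 0 0 * \det D.
    by rewrite {1}eB !det_mulmx dL dU mul1r mulr1 det_ublock ea det_scalar1.
  have uD : D \in unitmx.
    by move: uB; rewrite !unitmxE dB unitrM => /andP[].
  have uM : block_mx a 0 0 D \in unitmx.
    by rewrite unitmxE det_ublock unitrM -!unitmxE ua uD.
  rewrite {1}eB !mxoddM ?unitmx_mul ?uL ?uM // sL sU addbF block_parity // IH // ea.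
  rewrite dB scoddM //.
  by move: uD; rewrite unitmxE unitfE.
have [A00|A00] := eqVneq (A 0 0) 0; last exact: nz0.
have [i Ai] : exists i, A i 0 != 0.
  apply: contrapT => /forallNP h.
  have : A *m delta_mx 0 0 = 0 :> 'cV_n.+1.
    apply/matrixP => i j; rewrite !mxE (bigD1 0) //= mxE !eqxx zmodp.ord1 mulr1.
    rewrite big1 ?addr0; first by apply/eqP; apply: contrapT => /negP; exact: h.
    by move=> k k0; rewrite !mxE (negbTE k0) mulr0.
  move/(congr1 (mulmx (invmx A))); rewrite mulKmx // mulmx0 => /matrixP/(_ 0 0).
  by rewrite !mxE eqxx => /eqP; rewrite oner_eq0.
have i0 : i != 0 by apply: contra_neq Ai => ->.
have NN : delta_mx 0 i *m delta_mx 0 i = 0 :> 'M[F]_n.+1.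
  by rewrite mul_delta_mx_0.
have [uE dE sE] := transvection_parity NN.
have := nz0 ((1%:M + delta_mx 0 i) *m A); rewrite unitmx_mul uE uA mxoddM // sE det_mulmx dE mul1r.
apply=> //; rewrite mulmxDl mul1mx mxE A00 add0r mxE (bigD1 i) //= mxE !eqxx mul1r.
rewrite big1 ?addr0 // => k ki.
by rewrite mxE (negbTE ki) andbF mul0r.
Qed.

End MatrixParity.

(** * Zolotarev's lemma on a semilocal ring modulo t *)

Section SemilocalAction.
Variables (F : finFieldType) (K : fieldType) (kap : {rmorphism F -> K}).
Hypotheses (ffK : ffield kap) (odd_char : (2%:R : F) != 0).
Implicit Types (p q : place K).
Variables (Z : seq (place K)) (t : K) (d : nat) (u : 'I_d -> K).
Local Notation V := (semilocal Z (fun p => - ord p t)).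
Local Notation O := (semilocal Z (fun=> 0)).
Local Notation r := (lincomb kap u).
Hypotheses (uZ : uniq Z) (t0 : t != 0) (tpos : forall p, p \in Z -> 0 < ord p t).
Hypothesis tu : transversal_of O V r.
Implicit Types (y z : K) (c : 'cV[F]_d).

Let VF : Fsub kap V. Proof. exact: semilocal_Fsub. Qed.
Let Vg : subgrp V. Proof. by case: VF. Qed.

Definition semilocal_unit y := forall p, p \in Z -> is_unit p y.

Lemma semilocal_unitO y : semilocal_unit y -> O y.
Proof. by move=> hy p pZ; rewrite oppr0; apply/unit_small/hy. Qed.

Let VM y z : O y -> V z -> V (y * z).
Proof.
by move=> hy hz p pZ; apply: smallMl; [have := hy p pZ; rewrite oppr0|exact: hz].
Qed.

Let OM y z : O y -> O z -> O (y * z).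
Proof.
move=> hy hz p pZ; rewrite oppr0; apply: smallMl.
  by have := hy p pZ; rewrite oppr0.
by have := hz p pZ; rewrite oppr0.
Qed.

(** Multiplication by [y] on the semilocal ring modulo [t], transported to coordinate vectors by the
    representatives [r c]. *)
Definition semilocal_act y c : 'cV[F]_d :=
  classical_sets.xget 0 (fun c' => V (y * r c - r c')).

Lemma semilocal_actP y c : O y -> V (y * r c - r (semilocal_act y c)).
Proof.
move=> hy; apply: (@classical_sets.xgetPex _ 0 (fun c' => V (y * r c - r c'))).
by case: tu => h1 _ h3; apply: h3; apply: OM.
Qed.

Lemma semilocal_act_uniq y c c' : O y -> V (y * r c - r c') -> semilocal_act y c = c'.
Proof.
move=> hy h; case: tu => _ h2 _; apply: h2.
by apply: (subgrp_trans Vg _ h); apply: (subgrp_swap Vg); apply: semilocal_actP.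
Qed.

Lemma semilocal_actM y z c : O y -> O z ->
  semilocal_act (y * z) c = semilocal_act y (semilocal_act z c).
Proof.
move=> hy hz; apply: semilocal_act_uniq; first exact: OM.
rewrite -mulrA; apply: (subgrp_trans Vg (y := y * r (semilocal_act z c))).
  by rewrite -mulrBr; apply: VM => //; apply: semilocal_actP.
exact: semilocal_actP.
Qed.

Lemma semilocal_act_congr y z c : O y -> O z -> V (y - z) ->
  semilocal_act y c = semilocal_act z c.
Proof.
move=> hy hz h; apply: semilocal_act_uniq => //.
apply: (subgrp_trans Vg (y := z * r c)); last exact: semilocal_actP.
by rewrite -mulrBl mulrC; apply: VM => //; case: tu.
Qed.

Lemma semilocal_act1 c : semilocal_act 1 c = c.
Proof.
apply: semilocal_act_uniq; first by move=> p _; rewrite oppr0; exact: small1.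
by rewrite mul1r subrr; case: Vg.
Qed.

Lemma semilocal_act_inj y : semilocal_unit y -> injective (semilocal_act y).
Proof.
move=> hy; apply: (can_inj (g := semilocal_act y^-1)) => c.
have hy' : semilocal_unit y^-1 by move=> p pZ; apply/unit_inv/hy.
rewrite -semilocal_actM; try exact: semilocal_unitO.
rewrite (@semilocal_act_congr _ 1) ?semilocal_act1 //.
- by apply: OM; apply: semilocal_unitO.
- by move=> p _; rewrite oppr0; exact: small1.
- move=> p pZ; have /andP[y0 _] := hy p pZ.
  by rewrite mulVf // subrr small0.
Qed.

Lemma semilocal_actX y n c : O y -> iter n (semilocal_act y) c = semilocal_act (y ^+ n) c.
Proof.
move=> hy; elim: n => [|n IH]; first by rewrite expr0 semilocal_act1.
rewrite iterS IH exprS semilocal_actM // => p pZ.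
by rewrite oppr0; have := hy p pZ; rewrite oppr0 => /(smallX n); rewrite mul0rn.
Qed.

Lemma semilocal_act_mx y : O y -> exists M : 'M[F]_d, forall c, semilocal_act y c = M *m c.
Proof.
move=> hy; exists (\matrix_(i, j) semilocal_act y (delta_mx j 0) i 0) => c.
have rZ a c1 : r (a *: c1) = kap a * r c1.
  by rewrite /lincomb mulr_sumr; apply: eq_bigr => i _; rewrite mxE rmorphM mulrA.
have rS (f : 'I_d -> 'cV[F]_d) : r (\sum_j f j) = \sum_j r (f j).
  rewrite /lincomb exchange_big /=; apply: eq_bigr => i _.
  by rewrite summxE rmorph_sum mulr_suml.
apply: semilocal_act_uniq => //.
have {1}-> : c = \sum_j c j 0 *: delta_mx j 0.
  by rewrite [LHS]matrix_sum_delta; apply: eq_bigr => j _; rewrite big_ord1.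
have -> : (\matrix_(i, j) semilocal_act y (delta_mx j 0) i 0) *m c =
          \sum_j c j 0 *: semilocal_act y (delta_mx j 0).
  apply/matrixP => i k; rewrite (zmodp.ord1 k) mxE summxE; apply: eq_bigr => j _.
  by rewrite !mxE mulrC.
rewrite !rS mulr_sumr -sumrB; apply: subgrp_sum => // j _.
rewrite !rZ mulrCA -mulrBr; apply: (proj2 VF); exact: semilocal_actP.
Qed.

Lemma semilocal_act_det y (M : 'M[F]_d) : semilocal_unit y ->
  (forall c, semilocal_act y c = M *m c) ->
  M \in unitmx /\ fodd (semilocal_act y) = scodd (\det M).
Proof.
move=> hy hM; have hy' : semilocal_unit y^-1 by move=> p pZ; apply/unit_inv/hy.
have [M' hM'] := semilocal_act_mx (semilocal_unitO hy').
have MM : M *m M' = 1%:M.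
  apply/matrixP => i j.
  have e c : M *m (M' *m c) = c.
    rewrite -hM' -hM -semilocal_actM; try exact: semilocal_unitO.
    rewrite (@semilocal_act_congr _ 1) ?semilocal_act1 //.
    + by apply: OM; apply: semilocal_unitO.
    + by move=> p _; rewrite oppr0; exact: small1.
    + move=> p pZ; have /andP[y0 _] := hy p pZ.
      by rewrite mulfV // subrr small0.
  have := e (delta_mx j 0); rewrite mulmxA; set X := M *m M'.
  by rewrite -colE => /matrixP/(_ i 0); rewrite !mxE eqxx andbT.
have [uM _] := mulmx1_unit MM; split=> //.
rewrite -mxodd_det //; exact: fodd_ext.
Qed.

(** Each q-th power, q = [#|F|], gains one order: in x^q - 1 = (x - 1)(1 + x + ... + x^(q-1)) the
    second factor is congruent to q = 0. *)
Lemma unit_near1_exp p (n k : nat) y : small p 1 (y - 1) -> (k < n)%N ->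
  small p k.+1%:Z (y ^+ (#|F| ^ n) - 1).
Proof.
have qs x (N : nat) : (0 < N)%N -> small p N%:Z (x - 1) -> small p N.+1%:Z (x ^+ #|F| - 1).
  move=> N0 hx; rewrite subrX1 -addn1 PoszD; apply: smallM => //.
  have x1 : small p 1 (x - 1) by apply: smallW hx; lia.
  rewrite (_ : \sum_(i < #|F|) x ^+ i = \sum_(i < #|F|) (x ^+ i - 1)).
    have s0 : small p 0 x.
      by rewrite -[x](subrK 1); apply: smallD; [exact: smallW x1|exact: small1].
    apply: small_sum => i _; rewrite subrX1 mulrC; apply: smallMl => //.
    by apply: small_sum => j _; have := smallX j s0; rewrite mul0rn.
  rewrite big_split /= sumr_const card_ord mulNrn -(rmorph_nat kap) card_natr0 //.
  by rewrite rmorph0 oppr0 addr0.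
move=> hy; elim: n k => [//|n IH] k kn; rewrite expnSr exprM.
case: k kn => [_|k kn].
  by case: n IH => [_|n IH]; [rewrite expr1; apply: smallW (qs y 1%N _ hy)|apply: smallW (qs _ _ _ (IH 0%N _))].
by apply: qs => //; apply: IH.
Qed.

(** These classes form the kernel of the reduction to the local component at [p], which has q^(e f)
    elements for e = [ord p t] and f the degree of [p]. They will be the fixed points of a generator
    at [p]. *)
Lemma card_fixed_layer p : p \in Z ->
  (#|[set c | `[< small p (ord p t) (r c) >]]| * #|F| ^ (`|ord p t| * degp kap p))%N = #|{: 'cV[F]_d}|.
Proof.
move=> pZ; pose E q := (if q == p then `|ord p t|%N else 0%N).
have pt := tpos pZ.
have [T [s [cT hT]]] := semilocal_index ffK (fun q => - (E q)%:Z) E uZ.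
have eE : (\sum_(q <- Z) E q * degp kap q)%N = (`|ord p t| * degp kap p)%N.
  rewrite (big_rem p) //= {1}/E eqxx big_seq big1 ?addn0 // => q.
  by rewrite mem_rem_uniq // inE => /andP[/negbTE qp _]; rewrite /E qp.
pose W := semilocal Z (fun q => - (E q)%:Z).
have Wg : subgrp W by case: (semilocal_Fsub kap Z (fun q => - (E q)%:Z)).
have OW x : W x -> O x by move=> h q qZ; apply: smallW (h q qZ); rewrite opprK oppr0.
have WV x : V x -> W x.
  move=> h q qZ; apply: smallW (h q qZ); rewrite !opprK /E; case: eqVneq => [->|_].
    by rewrite gez0_abs // ltW.
  by rewrite ltW // tpos.
have WP x : O x -> W x <-> small p (ord p t) x.
  move=> hx; split=> [h|h q qZ].
    by have := h p pZ; rewrite opprK /E eqxx gez0_abs // ltW.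
  rewrite opprK /E; case: eqVneq => [->|_]; first by rewrite gez0_abs // ltW.
  by have := hx q qZ; rewrite oppr0.
have [tu1 tu2 tu3] := tu.
pose Fix := [set c | `[< small p (ord p t) (r c) >]].
have hF : transversal_of W V (fun c : {c | c \in Fix} => r (val c)).
  split.
  - by move=> [c hc] /=; apply/WP => //; move: hc; rewrite inE => /asboolP.
  - by move=> [c hc] [c' hc'] /= /tu2 e; apply: val_inj.
  - move=> x Wx; have [c hc] := tu3 x (OW _ Wx).
    have hcF : c \in Fix.
      rewrite inE; apply/asboolP/WP => //.
      rewrite -[r c]opprK -[- r c](addKr x) opprD opprK.
      by apply: (subgrpD Wg) => //; apply: (subgrpN Wg); exact: WV.
    by exists (exist _ c hcF).
have hT' : transversal_of O W s.
  have e x : O x <-> semilocal Z (fun q => - (E q)%:Z + (E q)%:Z) x.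
    by split=> h q qZ; have := h q qZ; rewrite addNr.
  have [a1 a2 a3] := hT; split=> [i|//|x hx]; first by apply/e/a1.
  by apply: a3; apply/e.
have Og : subgrp O by case: (semilocal_Fsub kap Z (fun=> 0)).
have h := transversal_comp Og Wg Vg OW WV hT' hF.
have := transversal_card Vg h tu; rewrite card_prod card_sig cT eE => <-.
by rewrite mulnC.
Qed.

(* The orbits of a generator g of the residue field at p, acting on O / V:    *)
(* every point that g moves has an orbit of length |k(p)^*|.                  *)
Lemma fodd_generator p g : p \in Z -> semilocal_unit g ->
  (forall i j, small p 1 (g ^+ i - g ^+ j) = (i == j %[mod (#|F| ^ degp kap p).-1])%N) ->
  (forall q, q \in Z -> q != p -> small q (ord q t) (g - 1)) ->
  small p (ord p t) (g ^+ (#|F| ^ degp kap p).-1 - 1) ->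
  fodd (semilocal_act g) = odd `|ord p t|.
Proof.
move=> pZ ug hg gq gN; set N := (#|F| ^ degp kap p)%N in hg gN.
have N1 : (1 < N)%N by rewrite -[1%N](expn0 #|F|) ltn_exp2l ?finNzRing_gt1 // degp_gt0.
have oN : odd N := odd_residue_card kap odd_char p.
have Og := semilocal_unitO ug; have [tu1 tu2 tu3] := tu.
have OgX i : O (g ^+ i) by apply: semilocal_unitO => q qZ; apply/unit_exp/ug.
have gi i : O (g ^+ i - 1).
  move=> q qZ; rewrite oppr0; apply: smallB; last exact: small1.
  by have := OgX i q qZ; rewrite oppr0.
have giq i q : q \in Z -> q != p -> small q (ord q t) (g ^+ i - 1).
  move=> qZ qp; rewrite subrX1 mulrC; apply: smallMl; last exact: gq.
  by apply: small_sum => j _; have := OgX j q qZ; rewrite oppr0.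
have fixP i c : semilocal_act (g ^+ i) c = c <-> small p (ord p t) ((g ^+ i - 1) * r c).
  split=> [e|h].
    have := @semilocal_actP (g ^+ i) c (OgX i) p pZ.
    by rewrite e opprK mulrBl mul1r.
  apply: semilocal_act_uniq => // q qZ; rewrite opprK.
  rewrite (_ : _ - _ = (g ^+ i - 1) * r c); last by ring.
  have [->//|qp] := eqVneq q p.
  rewrite mulrC; apply: smallMl; last exact: giq.
  by have := tu1 c q qZ; rewrite oppr0.
have unitP i c : ~~ (N.-1 %| i)%N -> small p (ord p t) ((g ^+ i - 1) * r c) -> small p (ord p t) (r c).
  move=> ni h; have ui : is_unit p (g ^+ i - 1).
    rewrite unitNsmall; last by have := gi i p pZ; rewrite oppr0.
    by rewrite -[1 in X in small _ _ X](expr0 g) hg mod0n.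
  have /andP[i0 _] := ui; rewrite -[r c](mulKf i0); apply: smallMl => //.
  exact/unit_small/unit_inv.
have dvdP i c : (N.-1 %| i)%N -> semilocal_act (g ^+ i) c = c.
  move=> /dvdnP[k ei]; apply/fixP; rewrite ei mulnC exprM.
  rewrite mulrC; apply: smallMl; first by have := tu1 c p pZ; rewrite oppr0.
  rewrite subrX1 mulrC; apply: smallMl => //; apply: small_sum => j _.
  by rewrite -exprM; have := OgX (N.-1 * j)%N p pZ; rewrite oppr0.
have gsi : injective (semilocal_act g) by apply: semilocal_act_inj.
have nfix c : semilocal_act g c = c <-> small p (ord p t) (r c).
  rewrite -{1}[g]expr1 fixP; split=> h; last first.
    by apply: smallMl => //; have := gi 1%N p pZ; rewrite oppr0.
  have [N2|N2] := boolP (N.-1 %| 1)%N; last exact: unitP N2 h.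
  by exfalso; move: N2; rewrite dvdn1; lia.
have [c|k [ck ok]] := @odd_perm_of_orbits _ (fperm (semilocal_act g)) N.-1.
  rewrite fpermE // => nc; have ei i : iter i (fperm (semilocal_act g)) c = semilocal_act (g ^+ i) c.
    by rewrite -semilocal_actX //; apply: eq_iter => v; rewrite fpermE.
  apply: card_porbit_eq; first by lia.
    by rewrite ei dvdP.
  move=> i /andP[i0 iN]; rewrite ei; apply: contra_neq nc => /fixP/unitP h.
  by apply/nfix/h; rewrite gtnNdvd.
rewrite /fodd ok; pose Fix := [set c | `[< small p (ord p t) (r c) >]].
pose e := `|ord p t|%N; pose S := (\sum_(i < e) N ^ i)%N.
have cF : (#|Fix| * N ^ e)%N = (#|F| ^ d)%N.
  by rewrite -card_cV -(card_fixed_layer pZ) /N -expnM mulnC [(e * _)%N]mulnC mulnC.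
have cC : (#|Fix| + N.-1 * k)%N = (#|F| ^ d)%N.
  rewrite -card_cV -(cardsC Fix) -ck; congr (_ + _)%N; apply: eq_card => c.
  rewrite !inE fpermE //; apply/negb_inj; rewrite !negbK.
  by apply/eqP/asboolP => /nfix.
have oFix : odd #|Fix|.
  have : odd (#|Fix| * N ^ e) by rewrite cF oddX odd_card // orbT.
  by rewrite oddM => /andP[].
(* Counting all points gives #Fix * N^e = #Fix + (N - 1) k. The geometric sum [S] has e terms, all
   odd, hence the parity of e. *)
have kE : k = (#|Fix| * S)%N.
  have N1' : (0 < N.-1)%N by clear -N1; lia.
  apply/eqP; rewrite -(eqn_pmul2l N1') mulnCA /S -predn_exp -(eqn_add2l #|Fix|) cC -cF.
  by rewrite -{2}[#|Fix|]muln1 -mulnDr add1n prednK // expn_gt0 ltnW.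
have oS : odd S = odd e.
  rewrite /S; elim: (e) => [|n IH]; first by rewrite big_ord0.
  by rewrite big_ord_recr /= oddD IH oddX oN orbT addbT.
rewrite oddM kE oddM oFix oS /=.
by have -> : odd N.-1 = false by case: (N) oN => // n /= /negbTE.
Qed.

(** A primitive root at [p] is glued with 1 at the other places and raised to the power N^M. This
    makes g^(N-1) trivial modulo the power of [p] in [t], and keeps the residue since N^M is 1
    modulo N - 1. *)
Lemma ex_generator p : p \in Z -> exists g, [/\ semilocal_unit g,
  forall i j, small p 1 (g ^+ i - g ^+ j) = (i == j %[mod (#|F| ^ degp kap p).-1])%N,
  forall x, is_unit p x -> exists i, small p 1 (x - g ^+ i),
  forall q, q \in Z -> q != p -> small q (ord q t) (g - 1) &
  small p (ord p t) (g ^+ (#|F| ^ degp kap p).-1 - 1)].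
Proof.
move=> pZ; have [g0 ug0 [hg0 gen]] := ex_primitive_root ffK p.
pose M := (\sum_(q <- Z) `|ord q t|).+1.
have qM q : q \in Z -> ord q t <= M%:Z.
  by move=> qZ; rewrite /M (big_rem q) //=; lia.
have [g1 hg1] := weak_approximation (fun q => if q == p then g0 else 1) M%:Z uZ.
have g1p : small p 1 (g1 - g0).
  by have := hg1 p pZ; rewrite eqxx; apply: smallW; lia.
have g1q q : q \in Z -> q != p -> small q M%:Z (g1 - 1).
  by move=> qZ qp; have := hg1 q qZ; rewrite (negbTE qp).
have ug1p : is_unit p g1 by apply: unit_congr ug0 _; rewrite -opprB; apply: smallN.
have ug1 : semilocal_unit g1.
  move=> q qZ; have [->//|qp] := eqVneq q p.
  apply: (@unit_congr _ _ 1); first by rewrite /is_unit oner_neq0 ord1.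
  by rewrite -opprB; apply/smallN/smallW/g1q => //; lia.
set N := (#|F| ^ degp kap p)%N in hg0 *.
pose g := g1 ^+ (N ^ M).
have congX x y n : small p 0 x -> small p 0 y -> small p 1 (x - y) -> small p 1 (x ^+ n - y ^+ n).
  move=> hx hy h; rewrite subrXX mulrC; apply: smallMl => //.
  apply: small_sum => i _; apply: smallMl.
    by have := smallX (n.-1 - i) hx; rewrite mul0rn.
  by have := smallX i hy; rewrite mul0rn.
have NM : (N ^ M = 1 %[mod N.-1])%N.
  have N0 : (0 < N)%N by rewrite expn_gt0 ltnW // finNzRing_gt1.
  by rewrite -{1}(prednK N0) -modnXm -addn1 modnDl modnXm exp1n.
have gg0 : small p 1 (g - g0).
  have h1 : small p 1 (g - g0 ^+ (N ^ M)) by apply: congX => //; apply: unit_small.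
  rewrite -[g](subrK (g0 ^+ (N ^ M))) -addrA; apply: smallD => //.
  by rewrite -{2}[g0]expr1 hg0; apply/eqP.
have ug : semilocal_unit g by move=> q qZ; apply/unit_exp/ug1.
have cX i : small p 1 (g ^+ i - g0 ^+ i).
  by apply: congX => //; apply: unit_small => //; apply: ug.
exists g; split=> //.
- move=> i j; rewrite -hg0; apply/idP/idP => h.
    rewrite (_ : _ - _ = - (g ^+ i - g0 ^+ i) + (g ^+ i - g ^+ j) + (g ^+ j - g0 ^+ j)); last by ring.
    by apply: smallD => //; apply: smallD => //; apply: smallN.
  rewrite (_ : _ - _ = (g ^+ i - g0 ^+ i) + (g0 ^+ i - g0 ^+ j) - (g ^+ j - g0 ^+ j)); last by ring.
  by apply: smallB => //; apply: smallD.
- move=> x /gen[i hi]; exists i.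
  rewrite (_ : _ - _ = (x - g0 ^+ i) - (g ^+ i - g0 ^+ i)); last by ring.
  exact: smallB.
- move=> q qZ qp; rewrite /g subrX1 mulrC; apply: smallMl.
    apply: small_sum => i _; apply/unit_small/unit_exp; exact: ug1.
  by apply: smallW (g1q q qZ qp); apply: qM.
- rewrite /g -exprM mulnC exprM -expnM.
  have h0 : small p 1 (g1 ^+ N.-1 - 1).
    rewrite -(subrK (g0 ^+ N.-1) (g1 ^+ N.-1)) -addrA.
    apply: smallD; first by apply: congX => //; apply: unit_small.
    by have := hg0 N.-1 0%N; rewrite expr0 modnn mod0n.
  have d0 := degp_gt0 ffK p.
  apply: smallW (@unit_near1_exp p (degp kap p * M) M.-1 _ h0 _).
    by rewrite /= ; exact: qM.
  exact: (leq_pmull M d0).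
Qed.

Lemma semilocal_unitM y z : semilocal_unit y -> semilocal_unit z -> semilocal_unit (y * z).
Proof. by move=> hy hz p pZ; apply: unit_mul; [apply: hy|apply: hz]. Qed.

Lemma fodd_actM y z : semilocal_unit y -> semilocal_unit z ->
  fodd (semilocal_act (y * z)) = fodd (semilocal_act y) (+) fodd (semilocal_act z).
Proof.
move=> hy hz; rewrite -fodd_comp; try exact: semilocal_act_inj.
by apply: fodd_ext => c; apply: semilocal_actM; apply: semilocal_unitO.
Qed.

(** Up to a factor congruent to 1 at all places of [Z], [y] is the product of the [g p ^+ e p]; the
    signs of these are known, and the parity of [e p] is the symbol of [y] at [p]. A factor
    congruent to 1 is an even permutation because some odd power of it acts trivially. *)
Theorem Zolotarev_semilocal y : semilocal_unit y ->
  fodd (semilocal_act y) = \big[addb/false]_(p <- Z) (odd `|ord p t| && nonsquare_at p y).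
Proof.
move=> uy; have /choice[g hg] p : exists g, p \in Z -> [/\ semilocal_unit g,
  forall i j, small p 1 (g ^+ i - g ^+ j) = (i == j %[mod (#|F| ^ degp kap p).-1])%N,
  forall x, is_unit p x -> exists i, small p 1 (x - g ^+ i),
  forall q, q \in Z -> q != p -> small q (ord q t) (g - 1) &
  small p (ord p t) (g ^+ (#|F| ^ degp kap p).-1 - 1)].
  have [pZ|pZ] := boolP (p \in Z); last by exists 0.
  by have [g hg] := ex_generator pZ; exists g.
have /choice[e he] p : exists e, p \in Z -> small p 1 (y - g p ^+ e).
  have [pZ|pZ] := boolP (p \in Z); last by exists 0%N.
  by have [_ _ gen _ _] := hg p pZ; have [i hi] := gen y (uy p pZ); exists i.
have actX z n : semilocal_unit z -> fodd (semilocal_act (z ^+ n)) = odd n && fodd (semilocal_act z).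
  move=> uz; rewrite -fodd_iter; last exact: semilocal_act_inj.
  by apply: fodd_ext => c; rewrite semilocal_actX //; apply: semilocal_unitO.
have near1 w : semilocal_unit w -> (forall p, p \in Z -> small p 1 (w - 1)) ->
    fodd (semilocal_act w) = false.
  move=> uw hw; pose M := (\sum_(q <- Z) `|ord q t|).+1.
  have -> : fodd (semilocal_act w) = fodd (semilocal_act (w ^+ (#|F| ^ M))).
    by rewrite actX // oddX odd_card // orbT.
  apply: fodd_id => c; rewrite (@semilocal_act_congr _ 1) ?semilocal_act1 //.
  - by apply: semilocal_unitO => p pZ; apply/unit_exp/uw.
  - by move=> p _; rewrite oppr0; exact: small1.
  - move=> p pZ; rewrite opprK; apply: smallW (@unit_near1_exp p M M.-1 w (hw p pZ) _) => //.
    by rewrite /M /= (big_rem p) //=; lia.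
pose P (s : seq (place K)) := \prod_(p <- s) g p ^+ e p.
have PP s : uniq s -> {subset s <= Z} -> semilocal_unit (P s) /\
    (forall p, p \in Z -> small p 1 (P s - (if p \in s then g p ^+ e p else 1))) /\
    fodd (semilocal_act (P s)) = \big[addb/false]_(p <- s) (odd `|ord p t| && nonsquare_at p y).
  elim: s => [|q s IH] /=.
    move=> _ _; rewrite /P !big_nil; split; first by move=> p _; rewrite /is_unit oner_neq0 ord1.
    split=> [p _|]; first by rewrite subrr small0.
    by apply: fodd_id => c; rewrite semilocal_act1.
  move=> /andP[qs us] sZ; have qZ : q \in Z by apply: sZ; rewrite mem_head.
  have [|u1 [h1 o1]] := IH us; first by move=> p ps; apply: sZ; rewrite inE ps orbT.
  have [ug gmod gen gq gN] := hg q qZ.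
  have ugX : semilocal_unit (g q ^+ e q) by move=> p pZ; apply/unit_exp/ug.
  rewrite /P !big_cons -/(P s); split; first exact: semilocal_unitM.
  split=> [p pZ|].
    have s0 : small p 0 (P s) by apply/unit_small/u1.
    rewrite inE; have [->|pq] := eqVneq p q.
      rewrite orTb (_ : _ - _ = g q ^+ e q * (P s - 1)); last by ring.
      apply: smallMl; first exact/unit_small/ugX.
      by have := h1 q qZ; rewrite (negbTE qs).
    have := h1 p pZ; rewrite /=; set b := (if _ then _ else _) => hb.
    rewrite (_ : _ - _ = P s * (g q ^+ e q - 1) + (P s - b)); last by rewrite /P; ring.
    apply: smallD => //.
    apply: smallMl => //; rewrite subrX1 mulrC; apply: smallMl.
      apply: small_sum => i _; apply/unit_small/unit_exp; exact: ug.
    by apply: smallW (gq p pZ pq); rewrite -gtz0_ge1 tpos.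
  rewrite fodd_actM // o1; congr (_ (+) _); rewrite actX //.
  rewrite (fodd_generator qZ ug gmod gq gN) andbC; congr (_ && _).
  by rewrite (nonsquare_at_power odd_char (ug q qZ) gmod gen (uy q qZ) (he q qZ)).
have [uP [hP <-]] := PP Z uZ (fun p pZ => pZ).
have uPi : semilocal_unit (P Z)^-1 by move=> p pZ; apply/unit_inv/uP.
have uw : semilocal_unit (y * (P Z)^-1) by apply: semilocal_unitM.
have fw : fodd (semilocal_act (y * (P Z)^-1)) = false.
  apply: near1 => // p pZ.
  have /andP[P0 _] := uP p pZ.
  rewrite (_ : _ - _ = (P Z)^-1 * (y - P Z)); last by field.
  apply: smallMl; first exact/unit_small/uPi.
  rewrite (_ : _ - _ = (y - g p ^+ e p) - (P Z - g p ^+ e p)); last by ring.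
  by apply: smallB; [exact: he|have := hP p pZ; rewrite pZ].
have -> : fodd (semilocal_act y) = fodd (semilocal_act (y * (P Z)^-1 * P Z)).
  apply: fodd_ext => c; apply: semilocal_act_congr; try exact: semilocal_unitO.
    by apply/semilocal_unitO/semilocal_unitM.
  move=> p pZ; have /andP[P0 _] := uP p pZ.
  by rewrite divfK // subrr small0.
by rewrite fodd_actM // fw.
Qed.

End SemilocalAction.

(** * Norms to rational subfields *)

Section SubfieldNorm.
Variables (K : fieldType) (k : K -> Prop) (n : nat).
Hypotheses (k1 : k 1) (kB : forall x y, k x -> k y -> k (x - y))
  (kM : forall x y, k x -> k y -> k (x * y)).
Implicit Types (x y z : K) (u w : 'I_n -> K).

Definition kindep u := forall c : 'I_n -> K,
  (forall i, k (c i)) -> \sum_i c i * u i = 0 -> forall i, c i = 0.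

Definition kspan u := forall z, exists2 c : 'I_n -> K,
  forall i, k (c i) & z = \sum_i c i * u i.

Definition kbasis u := kindep u /\ kspan u.

Let kg : subgrp k.
Proof. by split=> //; rewrite -(subrr 1); apply: kB. Qed.

(** [M] is the matrix of multiplication by [x] in the family [u], with entries in the subfield [k].
    When [u] is a basis, its determinant is the norm of [x] to [k], seen in [K]. *)
Definition represents u x (M : 'M[K]_n) :=
  (forall i j, k (M i j)) /\ forall j, x * u j = \sum_i M i j * u i.

Lemma ex_represents u x : kspan u -> exists M, represents u x M.
Proof.
move=> su; have /choice[c hc] j : exists c : 'I_n -> K, (forall i, k (c i)) /\ x * u j = \sum_i c i * u i.
  by have [c] := su (x * u j); exists c.
exists (\matrix_(i, j) c j i); split=> [i j|j]; first by rewrite mxE; case: (hc j).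
by have [_ ->] := hc j; apply: eq_bigr => i _; rewrite mxE.
Qed.

Lemma represents_uniq u x M N : kindep u -> represents u x M -> represents u x N -> M = N.
Proof.
move=> iu [kM' eM] [kN eN]; apply/matrixP => i j; apply/eqP; rewrite -subr_eq0; apply/eqP.
apply: (iu (fun i => M i j - N i j)) => [l|]; first exact: kB.
by under eq_bigr do rewrite mulrBl; rewrite sumrB -eM -eN subrr.
Qed.

Lemma representsM u x y M N : represents u x M -> represents u y N ->
  represents u (x * y) (M *m N).
Proof.
move=> [kM' eM] [kN eN]; split=> [i j|j].
  by rewrite mxE; apply: subgrp_sum => // l _; apply: kM.
rewrite -mulrA eN mulr_sumr; under eq_bigr do rewrite mulrCA eM mulr_sumr.
rewrite exchange_big /=; apply: eq_bigr => i _; rewrite mxE mulr_suml.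
by apply: eq_bigr => l _; rewrite mulrA [M i l * _]mulrC.
Qed.

Lemma represents1 u : represents u 1 1%:M.
Proof.
split=> [i j|j]; first by rewrite mxE; case: eqP => _; [exact: k1|case: kg].
rewrite mul1r (bigD1 j) //= mxE eqxx mul1r big1 ?addr0 // => i ij.
by rewrite mxE (negbTE ij) mul0r.
Qed.

Lemma represents_sum u (I : Type) (r : seq I) (c x : I -> K) (M : I -> 'M[K]_n) :
  (forall i, k (c i)) -> (forall i, represents u (x i) (M i)) ->
  represents u (\sum_(i <- r) c i * x i) (\sum_(i <- r) c i *: M i).
Proof.
move=> kc hM; split=> [i j|j].
  by rewrite summxE; apply: subgrp_sum => // l _; rewrite mxE; apply: kM => //; case: (hM l).
rewrite mulr_suml; under [RHS]eq_bigr do rewrite summxE mulr_suml.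
rewrite exchange_big /=; apply: eq_bigr => l _; have [_ e] := hM l.
by rewrite -mulrA e mulr_sumr; apply: eq_bigr => i _; rewrite mxE mulrA.
Qed.

Lemma kdet (M : 'M[K]_n) : (forall i j, k (M i j)) -> k (\det M).
Proof.
move=> hM; apply: subgrp_sum => // s _; apply: kM; last first.
  by apply: (big_ind k) => // *; exact: kM.
have kN1 : k (-1) by apply: subgrpN.
by elim: (nat_of_bool _) => [|i IH]; rewrite ?expr0 // exprS; apply: kM.
Qed.

Lemma det_represents_neq0 u x M : kbasis u -> x != 0 -> represents u x M -> \det M != 0.
Proof.
move=> [iu su] x0 hM; have [N hN] := ex_represents x^-1 su.
have e : M *m N = 1%:M.
  apply: (represents_uniq iu (x := 1)); last exact: represents1.
  by rewrite -(mulfV x0); apply: representsM.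
by apply: contra_eq_neq (congr1 determinant e) => d0; rewrite det_mulmx d0 mul0r det1 eq_sym oner_neq0.
Qed.

(** Both bases have length [n], so the change of basis is a square invertible matrix [C] with M C =
    C N. *)
Lemma det_represents_basis u w x M N : kbasis u -> kbasis w ->
  represents u x M -> represents w x N -> \det M = \det N.
Proof.
move=> [iu su] [iw sw] [kM' eM] [kN eN].
have coord v v' : kspan v -> exists2 C : 'M[K]_n, forall i j, k (C i j) & forall j, v' j = \sum_i C i j * v i.
  move=> sv; have /choice[c hc] j : exists c : 'I_n -> K, (forall i, k (c i)) /\ v' j = \sum_i c i * v i.
    by have [c] := sv (v' j); exists c.
  exists (\matrix_(i, j) c j i) => [i j|j]; first by rewrite mxE; case: (hc j).
  by have [_ ->] := hc j; apply: eq_bigr => i _; rewrite mxE.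
have mulC (v v' v'' : 'I_n -> K) (C D : 'M[K]_n) : (forall j, v' j = \sum_i C i j * v i) ->
    (forall j, v'' j = \sum_i D i j * v' i) -> forall j, v'' j = \sum_i (C *m D) i j * v i.
  move=> hC hD j; rewrite hD; under eq_bigr do rewrite hC mulr_sumr.
  rewrite exchange_big /=; apply: eq_bigr => i _; rewrite mxE mulr_suml.
  by apply: eq_bigr => l _; rewrite mulrA [C i l * _]mulrC.
have kmul (C D : 'M[K]_n) : (forall i j, k (C i j)) -> (forall i j, k (D i j)) -> forall i j, k ((C *m D) i j).
  by move=> hC hD i j; rewrite mxE; apply: subgrp_sum => // l _; apply: kM.
have inju (C D : 'M[K]_n) : (forall i j, k (C i j)) -> (forall i j, k (D i j)) ->
    (forall j, \sum_i C i j * u i = \sum_i D i j * u i) -> C = D.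
  move=> hC hD h; apply/matrixP => i j; apply/eqP; rewrite -subr_eq0; apply/eqP.
  apply: (iu (fun i => C i j - D i j)) => [l|]; first exact: kB.
  by under eq_bigr do rewrite mulrBl; rewrite sumrB h subrr.
have [C kC eC] := coord u w su; have [D kD eD] := coord w u sw.
have CD : C *m D = 1%:M.
  apply: inju => [|i j|j]; first exact: kmul.
    by case: (represents1 u) => h _; exact: h.
  rewrite -(mulC u w u C D eC eD); have [_ h] := represents1 u.
  by rewrite -h mul1r.
have e : M *m C = C *m N.
  apply: inju => [||j]; try exact: kmul.
  rewrite -(mulC u _ (fun j => x * w j) M C eM); last first.
    by move=> l; rewrite eC mulr_sumr; apply: eq_bigr => i _; rewrite mulrCA.
  by rewrite -(mulC u w (fun j => x * w j) C N eC).
have dC : \det C != 0.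
  by apply: contra_eq_neq (congr1 determinant CD) => d0; rewrite det_mulmx d0 mul0r det1 eq_sym oner_neq0.
apply: (mulIf dC); rewrite -det_mulmx e det_mulmx; exact: mulrC.
Qed.

End SubfieldNorm.

Section RationalSubfield.
Variables (F : finFieldType) (K : fieldType) (kap : {rmorphism F -> K}).
Implicit Types (p q : place K) (t x y z : K).
Local Notation ev := (pev kap).

Definition ratf t z := exists a b : {poly F}, ev t b != 0 /\ z = ev t a / ev t b.

Lemma ratf_pev t a : ratf t (ev t a).
Proof. by exists a, 1; rewrite rmorph1 oner_neq0 divr1. Qed.

Lemma ratf1 t : ratf t 1.
Proof. by rewrite -(rmorph1 (ev t)); exact: ratf_pev. Qed.

Lemma ratfB t x y : ratf t x -> ratf t y -> ratf t (x - y).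
Proof.
move=> [a [b [b0 ->]]] [c [d [d0 ->]]]; exists (a * d - c * b), (b * d).
rewrite rmorphB !rmorphM /= mulf_neq0 //; split=> //.
by field; rewrite b0 d0.
Qed.

Lemma ratfM t x y : ratf t x -> ratf t y -> ratf t (x * y).
Proof.
move=> [a [b [b0 ->]]] [c [d [d0 ->]]]; exists (a * c), (b * d).
rewrite !rmorphM /= mulf_neq0 //; split=> //.
by field; rewrite b0 d0.
Qed.

Lemma ratfV t x : ratf t x -> ratf t x^-1.
Proof.
move=> [a [b [b0 ->]]]; have [a0|a0] := eqVneq (ev t a) 0.
  by rewrite a0 mul0r invr0 -(rmorph0 (ev t)); exact: ratf_pev.
by exists b, a; rewrite invf_div.
Qed.

Lemma ratf_inv t z : t != 0 -> ratf t^-1 z -> ratf t z.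
Proof.
move=> t0; have rt : ratf t t by rewrite -{2}(pevX kap t); exact: ratf_pev.
have rp a : ratf t (ev t^-1 a).
  rewrite pevE; apply: subgrp_sum => [|i _].
    by split=> [|x y]; [rewrite -(rmorph0 (ev t)); exact: ratf_pev|exact: ratfB].
  apply: ratfM; first by rewrite -(pevC kap t); exact: ratf_pev.
  elim: (nat_of_ord i) => [|j IH]; first by rewrite expr0; exact: ratf1.
  by rewrite exprS; apply: ratfM => //; apply: ratfV.
by move=> [a [b [_ ->]]]; apply: ratfM => //; apply: ratfV.
Qed.

Lemma common_denominator t n (c : 'I_n -> K) : (forall i, ratf t (c i)) ->
  exists b (a : 'I_n -> {poly F}), ev t b != 0 /\ forall i, ev t b * c i = ev t (a i).
Proof.
move=> hc.
have /choice[f hf] i : exists ab : {poly F} * {poly F}, ev t ab.2 != 0 /\ c i = ev t ab.1 / ev t ab.2.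
  by have [a [b h]] := hc i; exists (a, b).
exists (\prod_i (f i).2), (fun i => (\prod_(j | j != i) (f j).2) * (f i).1); split.
  by rewrite rmorph_prod; apply/prodf_neq0 => i _; case: (hf i).
move=> i; have [b0 ->] := hf i; rewrite (bigD1 i) //= !rmorphM /=.
by field.
Qed.

Lemma tindep_kindep t n (u : 'I_n -> K) : transc kap t -> tindep kap t u <-> kindep (ratf t) u.
Proof.
move=> trt; split=> [iu c hc e i|iu a e i].
  have [b [a [b0 ha]]] := common_denominator hc.
  have /iu/(_ i) : tcomb kap t u a = 0.
    rewrite -[RHS](mulr0 (ev t b)) -e mulr_sumr; apply: eq_bigr => j _.
    by rewrite mulrA ha.
  by move/(congr1 (ev t)); rewrite -ha rmorph0 => /eqP; rewrite mulf_eq0 (negbTE b0) => /eqP.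
by apply: trt; apply: (iu (fun i => ev t (a i))) => // j; exact: ratf_pev.
Qed.

Lemma tbasis_kbasis t n (u : 'I_n -> K) : transc kap t -> tbasis kap t u -> kbasis (ratf t) u.
Proof.
move=> trt [iu su]; split; first by apply/tindep_kindep.
move=> z; have [b [a [b0 e]]] := su z; exists (fun i => ev t (a i) / ev t b).
  by move=> i; exists (a i), b.
rewrite -[z](mulKf b0) e mulr_sumr; apply: eq_bigr => i _.
by rewrite mulrA [_^-1 * _]mulrC.
Qed.

Lemma kbasis_inv t n (u : 'I_n -> K) : t != 0 -> kbasis (ratf t^-1) u -> kbasis (ratf t) u.
Proof.
move=> t0 [iu su]; split=> [c hc|z].
  by apply: iu => i; rewrite -[t]invrK in hc; apply: ratf_inv; rewrite ?invr_eq0.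
by have [c hc e] := su z; exists c => // i; apply: ratf_inv.
Qed.

Lemma pev_pole_order p t a : ord p t < 0 -> a != 0 ->
  ev t a != 0 /\ ord p (ev t a) = ord p t *+ (size a).-1.
Proof.
move=> pt; have t0 : t != 0 by apply: contraTneq pt => ->; rewrite ord_zero.
have [s hs] : exists s, (size a <= s)%N by exists (size a).
elim: s a hs => [|s IH] a hs a0; first by move: hs; rewrite leqn0 size_poly_eq0 (negbTE a0).
have [d0|d0] := eqVneq (drop_poly 1 a) 0.
  have a00 : a`_0 != 0.
    apply: contra_neq a0 => a00; apply/polyP => -[|i]; rewrite coef0 //.
    by have /polyP/(_ i) := d0; rewrite coef_drop_poly addn1 coef0.
  rewrite pev_const_term d0 rmorph0 mul0r addr0 fmorph_eq0 ord_kap // a00; split=> //.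
  have := size_drop_poly 1 a; rewrite d0 size_poly0 => /esym/eqP; rewrite subn_eq0.
  by case: (size a) => [|[|m]] //= _; rewrite mulr0n.
have sd := size_drop_poly 1 a.
have [e0 eo] : ev t (drop_poly 1 a) != 0 /\ ord p (ev t (drop_poly 1 a)) = ord p t *+ (size (drop_poly 1 a)).-1.
  by apply: IH => //; rewrite sd; lia.
have et0 : ev t (drop_poly 1 a) * t != 0 by rewrite mulf_neq0.
have eto : ord p (ev t (drop_poly 1 a) * t) = ord p t *+ (size a).-1.
  rewrite ordM // eo -mulrSr; congr (_ *+ _); rewrite sd.
  by move: d0; rewrite -size_poly_eq0 sd; lia.
have lt0 : ord p (ev t (drop_poly 1 a) * t) < 0.
  by rewrite ordM // eo addrC ltr_wnDr // mulrn_wle0 // ltW.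
rewrite pev_const_term addrC -eto; apply: ordD_lt => //.
have [->|a00] := eqVneq a`_0 0; first by rewrite rmorph0 eqxx.
by rewrite ord_kap // lt0 orbT.
Qed.

(** Numerator and denominator are powers of [t] times polynomials with nonzero constant term; order
    0 forces equal powers, and the residue is the quotient of the constant terms. *)
Lemma ratf_residue p t z : 0 < ord p t -> ratf t z -> z != 0 -> ord p z = 0 ->
  exists2 e, e != 0 & small p 1 (z - kap e).
Proof.
move=> pt [a [b [b0 ->]]]; have t0 : t != 0 by apply: contraTneq pt => ->; rewrite ord_zero.
have trt : transc kap t by apply: (transc_ord (p := p)); rewrite gt_eqF.
have decomp (g : {poly F}) : ev t g != 0 -> exists i h, g = h * 'X^i /\ h`_0 != 0.
  move=> g0; have gn0 : g != 0 by apply: contra_neq g0 => ->; rewrite rmorph0.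
  have [s hs] : exists s, (size g <= s)%N by exists (size g).
  elim: s g hs gn0 {g0} => [|s IH] g hs g0; first by move: hs; rewrite leqn0 size_poly_eq0 (negbTE g0).
  have [g00|] := eqVneq g`_0 0; last by exists 0%N, g; rewrite expr0 mulr1.
  have ge : g = drop_poly 1 g * 'X.
    by apply/polyP => -[|j]; rewrite coefMX /= ?coef_drop_poly ?addn1.
  have [||i [h [e h0]]] := IH (drop_poly 1 g); first by rewrite size_drop_poly; lia.
    by apply: contra_neq g0 => e; rewrite ge e mul0r.
  by exists i.+1, h; rewrite ge e exprSr mulrA.
have [j [b' [eb b'0]]] := decomp b b0.
move=> z0; have a0 : ev t a != 0 by apply: contra_neq z0 => ->; rewrite mul0r.
have [i [a' [ea a'0]]] := decomp a a0.
have st : small p 1 t by rewrite smallE //; lia.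
have [ua oa] := pev_unit kap st a'0; have [ub ob] := pev_unit kap st b'0.
have tX m : t ^+ m != 0 by rewrite expf_neq0.
rewrite ea eb !rmorphM !rmorphXn /= pevX ord_div ?mulf_neq0 // !ordM // oa ob !ordX //.
rewrite !add0r -(mulr_natr _ i) -(mulr_natr _ j) !natz -mulrBr => /eqP; rewrite mulf_eq0 gt_eqF //= => /eqP ij.
have -> : i = j by move: ij; clear; lia.
exists (a'`_0 / b'`_0); first by rewrite mulf_neq0 ?invr_eq0.
have kb : kap b'`_0 != 0 by rewrite fmorph_eq0.
rewrite fmorph_div (_ : _ - _ = ((ev t a' - kap a'`_0) * kap b'`_0 -
   (ev t b' - kap b'`_0) * kap a'`_0) * (ev t b' * kap b'`_0)^-1); last first.
  by field; rewrite ub kb tX.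
have sm (g : {poly F}) : small p 1 (ev t g - kap g`_0).
  rewrite pev_const_term addrC addKr; apply: smallMl => //; apply: small_pev.
  exact: smallW st.
rewrite mulrC; apply: smallMl.
  by rewrite smallE ?invr_eq0 ?mulf_neq0 // ordV ?mulf_neq0 // ordM // ob ord_kap.
by apply: smallB; rewrite mulrC; apply: smallMl => //; exact: small_kap.
Qed.

Lemma ord_kap_congr p c e : small p 1 (kap c - kap e) -> c = e.
Proof.
rewrite -rmorphB => h; apply/eqP; rewrite -subr_eq0; apply: contraT => n0.
by move: h; rewrite smallE ?fmorph_eq0 // ord_kap.
Qed.

Lemma small_det p n (M N : 'M[K]_n) : (forall i j, small p 0 (M i j)) ->
  (forall i j, small p 0 (N i j)) ->
  (forall i j, small p 1 (M i j - N i j)) -> small p 1 (\det M - \det N).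
Proof.
move=> hM hN h; rewrite /determinant -sumrB; apply: small_sum => s _.
rewrite -mulrBr; apply: smallMl.
  by case: (odd_perm s); rewrite ?expr0 ?expr1 ?smallN ?small1 //; apply: smallN; exact: small1.
pose R x y := [/\ small p 0 x, small p 0 y & small p 1 (x - y)].
suff [] : R (\prod_i M i (s i)) (\prod_i N i (s i)) by [].
apply: (big_ind2 R) => [|x x' y y' [a b c] [d e f]|i _].
- by split; rewrite ?small1 // subrr small0.
- split; try exact: smallMl.
  rewrite (_ : _ - _ = y * (x - x') + x' * (y - y')); last by ring.
  by apply: smallD; apply: smallMl.
- by split.
Qed.

End RationalSubfield.

(** * Reciprocity *)

Section Reciprocity.
Variables (F : finFieldType) (K : fieldType) (kap : {rmorphism F -> K}).
Hypotheses (ffK : ffield kap) (odd_char : (2%:R : F) != 0).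
Implicit Types (p q : place K) (x y z : K).
Local Notation ev := (pev kap).
Local Notation rat := (ratf kap).
Local Notation zer := (zeros ffK).

Section Zeros.
Variables (t : K) (n : nat) (w : 'I_n -> K).
Local Notation Z := (zer t).
Local Notation O := (semilocal Z (fun=> 0)).
Local Notation V := (semilocal Z (fun p => - ord p t)).
Hypotheses (trt : transc kap t) (wO : forall i, O (w i)).
Hypothesis tw : transversal_of O V (lincomb kap w).

Definition regular z := exists a b : {poly F}, b`_0 != 0 /\ z = ev t a / ev t b.

Let t0 : t != 0 := transc_neq0 trt.
Let tZ p : p \in Z -> small p 1 t.
Proof. by rewrite mem_zeros => h; rewrite smallE // -gtz0_ge1. Qed.

(** If a common denominator of the [c i] is divisible by [t], then so are all numerators, because
    [w] is independent modulo [t]; the factor [t] can be divided out until the denominator is a unit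
    at t = 0. *)
Lemma lattice_coord x (c : 'I_n -> K) : O x -> (forall i, rat t (c i)) ->
  x = \sum_i c i * w i -> forall i, regular (c i).
Proof.
move=> Ox hc ex; have [b [a [b0 hb]]] := common_denominator hc.
have ext : ev t b * x = \sum_i ev t (a i) * w i.
  by rewrite ex mulr_sumr; apply: eq_bigr => i _; rewrite mulrA hb.
have [s hs] : exists s, (size b <= s)%N by exists (size b).
elim: s b a hs b0 hb ext => [|s IH] b a hs b0 hb ext.
  by move: hs b0; rewrite leqn0 size_poly_eq0 => /eqP ->; rewrite rmorph0 eqxx.
have [b00|b00] := eqVneq b`_0 0; last first.
  by move=> i; exists (a i), b; rewrite -hb mulrC mulKf.
have evs (g : {poly F}) : g`_0 = 0 -> ev t g = ev t (drop_poly 1 g) * t.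
  by move=> g0; rewrite pev_const_term g0 rmorph0 add0r.
have a00 : \col_i (a i)`_0 = 0.
  have [_ sep _] := tw; apply: sep; rewrite lincomb0 subr0 => p pZ; rewrite opprK.
  have -> : lincomb kap w (\col_i (a i)`_0) =
      t * (ev t (drop_poly 1 b) * x - \sum_i ev t (drop_poly 1 (a i)) * w i).
    rewrite mulrBr mulrCA mulrA -evs // ext mulr_sumr -sumrB; apply: eq_bigr => i _; rewrite mxE [ev t (a i)]pev_const_term.
    by ring.
  rewrite -[ord p t]addr0; apply: smallM; first exact: small_ord.
  have st : small p 0 t by apply: smallW (tZ pZ).
  apply: smallB; first by apply: smallMl; [exact: small_pev|have := Ox p pZ; rewrite oppr0].
  by apply: small_sum => i _; apply: smallMl; [exact: small_pev|have := wO i pZ; rewrite oppr0].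
have ai0 i : (a i)`_0 = 0 by have /matrixP/(_ i 0) := a00; rewrite !mxE.
apply: (IH (drop_poly 1 b) (fun i => drop_poly 1 (a i))).
- by rewrite size_drop_poly; move: hs; clear; lia.
- by apply: contra_neq b0 => e; rewrite evs // e mul0r.
- by move=> i; apply: (mulIf t0); rewrite mulrAC -evs // hb evs.
- apply: (mulIf t0); rewrite mulr_suml mulrAC -evs // ext.
  by apply: eq_bigr => i _; rewrite evs // mulrAC.
Qed.

Lemma regular_residue z : regular z ->
  exists c, forall p, p \in Z -> small p (ord p t) (z - kap c) /\ small p 0 z.
Proof.
move=> [a [b [b0 ->]]]; exists (a`_0 / b`_0) => p pZ.
have st := tZ pZ; have [ub ob] := pev_unit kap st b0.
have kb : kap b`_0 != 0 by rewrite fmorph_eq0.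
have st0 : small p 0 t by apply: smallW st.
have s0 : small p 0 (ev t b)^-1 by rewrite smallE ?invr_eq0 // ordV // ob.
split; last by apply: smallMl => //; exact: small_pev.
rewrite fmorph_div (_ : _ - _ = (ev t b)^-1 * (((ev t a - kap a`_0) * kap b`_0 -
   (ev t b - kap b`_0) * kap a`_0) * (kap b`_0)^-1)); last by field; rewrite ub kb.
have sm (g : {poly F}) : small p (ord p t) (ev t g - kap g`_0).
  rewrite pev_const_term addrC addKr; apply: smallMl; first exact: small_pev.
  exact: small_ord.
apply: smallMl => //; rewrite mulrC -fmorphV; apply: smallMl; first exact: small_kap.
by apply: smallB; rewrite mulrC; apply: smallMl => //; exact: small_kap.
Qed.

(** The entries of [M] are regular at t = 0. Their values form [M0], which is also the matrix of
    multiplication by [x] on the semilocal ring modulo [t]. *)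
Lemma det_at_zeros x (M : 'M[K]_n) : semilocal_unit Z x -> represents (rat t) w x M ->
  exists M0 : 'M[F]_n, [/\ M0 \in unitmx,
    forall p, p \in Z -> small p 1 (\det M - kap (\det M0)) &
    fodd (semilocal_act kap Z t w x) = scodd (\det M0)].
Proof.
move=> ux [kM eM]; have Ox := semilocal_unitO ux.
have reg i j : regular (M i j).
  apply: (@lattice_coord (x * w j) (fun i => M i j)) => //.
  move=> p pZ; rewrite oppr0; apply: smallMl.
    by have := Ox p pZ; rewrite oppr0.
  by have := wO j pZ; rewrite oppr0.
have /choice[f hf] (ij : 'I_n * 'I_n) : exists c, forall p, p \in Z ->
    small p (ord p t) (M ij.1 ij.2 - kap c) /\ small p 0 (M ij.1 ij.2).
  exact: regular_residue.
pose M0 : 'M[F]_n := \matrix_(i, j) f (i, j).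
have act c : semilocal_act kap Z t w x c = M0 *m c.
  apply: (semilocal_act_uniq tw Ox) => p pZ; rewrite opprK.
  rewrite (_ : _ - _ = \sum_i \sum_j kap (c j 0) * ((M i j - kap (f (i, j))) * w i)).
    apply: small_sum => i _; apply: small_sum => j _; apply: smallMl; first exact: small_kap.
    rewrite mulrC; apply: smallMl; first by have := wO i pZ; rewrite oppr0.
    by case: (hf (i, j) p pZ).
  rewrite /lincomb mulr_sumr; under eq_bigr do rewrite mulrCA eM mulr_sumr.
  rewrite exchange_big /= -sumrB; apply: eq_bigr => i _.
  rewrite mxE rmorph_sum mulr_suml -sumrB; apply: eq_bigr => j _.
  by rewrite mxE rmorphM; ring.
have [uM0 fo] := semilocal_act_det odd_char tw ux act.
exists M0; split=> // p pZ; rewrite -det_map_mx.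
apply: small_det => i j; rewrite ?mxE; first by case: (hf (i, j) p pZ).
  exact: small_kap.
have [h _] := hf (i, j) p pZ; apply: smallW h.
by move: pZ; rewrite mem_zeros gtz0_ge1.
Qed.

End Zeros.

Definition even_divisor x := forall p, (2 %| ord p x)%Z.

Lemma ex_unit_multiple (Z : seq (place K)) x : uniq Z -> x != 0 -> even_divisor x ->
  exists2 m, m != 0 & semilocal_unit Z (x * m ^+ 2).
Proof.
move=> uZ x0 ex.
have [m m0 hm] := ex_ord_prescribed (fun p => - (ord p x %/ 2)%Z) uZ.
exists m => // p pZ; rewrite /is_unit mulf_neq0 ?expf_neq0 //= ordM ?expf_neq0 // ordX //.
rewrite hm //; have /divzK e := ex p; rewrite -{1}e; apply/eqP; ring.
Qed.

(** Replacing [u] by the basis [w] adapted to the zeros of [t], and [x] by a square multiple that is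
    a unit there, only multiplies [h] by a factor. The norm then has value c e^2 at t = 0, with e
    the residue of the new [h], and the square drops out of the sign. *)
Lemma square_class_at_zeros t n (u : 'I_n -> K) x M c h : transc kap t -> zdeg ffK t = n ->
  tbasis kap t u -> x != 0 -> even_divisor x -> represents (rat t) u x M ->
  c != 0 -> rat t h -> \det M = kap c * h ^+ 2 ->
  \big[addb/false]_(p <- zer t) (odd `|ord p t| && nonsquare_at p x) = scodd c.
Proof.
move=> trt en; subst n => bu x0 ex hM c0 rh eM; have t0 := transc_neq0 trt.
have [w [wO iw tw]] := zeros_lattice ffK t0.
have bw : tbasis kap t w := tbasis_of_tindep trt bu iw.
have Zpos p : p \in zer t -> 0 < ord p t by rewrite mem_zeros.
have uZ := zeros_uniq ffK t.
have [m m0 um] := ex_unit_multiple uZ x0 ex.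
have [kbu kbw] := (tbasis_kbasis trt bu, tbasis_kbasis trt bw).
have R1 := ratf1 kap t; have RB := @ratfB F K kap t; have RM := @ratfM F K kap t.
have [Mm hMm] := ex_represents m (proj2 kbu).
have [M' hM'] := ex_represents (x * m ^+ 2) (proj2 kbw).
have hMxm : represents (rat t) u (x * m ^+ 2) (M *m (Mm *m Mm)).
  by apply: representsM => //; rewrite expr2; apply: representsM.
pose h' := h * \det Mm.
have eM' : \det M' = kap c * h' ^+ 2.
  rewrite -(det_represents_basis R1 RB RM kbu kbw hMxm hM') !det_mulmx eM /h'; ring.
have x20 : x * m ^+ 2 != 0 by rewrite mulf_neq0 ?expf_neq0.
have h'0 : h' != 0.
  have := det_represents_neq0 R1 RB RM kbw x20 hM'; rewrite eM'.
  by apply: contra_neq => ->; rewrite expr0n mulr0.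
have [M0 [uM0 hM0 fo]] := det_at_zeros trt wO tw um hM'.
have -> : \big[addb/false]_(p <- zer t) (odd `|ord p t| && nonsquare_at p x) =
    fodd (semilocal_act kap (zer t) t w (x * m ^+ 2)).
  rewrite (Zolotarev_semilocal ffK odd_char uZ t0 Zpos tw um).
  by apply: eq_bigr => p _; rewrite nonsquare_atMsq.
have [p pt] : exists p, 0 < ord p t.
  have [p pt] := ex_pole ffK (transcV t0 trt); exists p.
  by move: pt; rewrite ordV // oppr_lt0.
have pZ : p \in zer t by rewrite mem_zeros.
have d0 : \det M0 != 0 by move: uM0; rewrite unitmxE unitfE.
have hd := hM0 p pZ; have od : ord p (\det M') = 0.
  have k0 : kap (\det M0) != 0 by rewrite fmorph_eq0.
  have [|_] := @ord_small_add _ p (kap (\det M0)) (\det M' - kap (\det M0)) k0.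
    by rewrite ord_kap // add0r.
  by rewrite subrKC ord_kap.
have oh : ord p h' = 0.
  move: od; rewrite eM' ordM ?expf_neq0 ?fmorph_eq0 // ord_kap // add0r ordX // => /eqP.
  by rewrite mulrn_eq0 => /eqP.
have rh' : rat t h' by apply: ratfM => //; apply: (kdet R1 RB RM) => i j; case: hMm.
have [e e0 he] := ratf_residue pt rh' h'0 oh.
have sh : small p 0 h' by rewrite smallE // oh.
rewrite fo (_ : \det M0 = c * (e * e)).
  by rewrite !scoddM ?mulf_neq0 // addbb addbF.
apply: (@ord_kap_congr _ _ kap p).
rewrite (_ : _ - _ = (\det M' - kap (c * (e * e))) - (\det M' - kap (\det M0))); last by ring.
apply: smallB => //; rewrite eM' !rmorphM.
rewrite (_ : _ - _ = kap c * ((h' + kap e) * (h' - kap e))); last by ring.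
apply: smallMl; first exact: small_kap.
by apply: smallMl => //; apply: smallD => //; exact: small_kap.
Qed.

Lemma size_cofactor (b P : {poly F}) s :
  (1 < size P)%N -> b != 0 -> (size (b * P)%R <= s.+1)%N -> (size b <= s)%N.
Proof.
move=> sP b0; have P0 : P != 0 by rewrite -size_poly_gt0 ltnW.
have -> : size (b * P)%R = (size b + size P).-1 := size_mul b0 P0.
lia.
Qed.

(** * Irreducible polynomials in t and the places above them *)

Section PrimeOverP.
Variables (t : K) (P : {poly F}).
Hypotheses (trt : transc kap t) (irrP : irreducible_poly P).

Let P0 : P != 0. Proof. by apply: irredp_neq0. Qed.
Let sP : (1 < size P)%N. Proof. by case: irrP. Qed.

Lemma transc_pev_irreducible : transc kap (ev t P).
Proof.
have [p pt] := ex_pole ffK trt; have [_ e] := pev_pole_order kap pt P0.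
apply: (transc_ord (p := p)); rewrite e mulrn_eq0 negb_or (lt_eqF pt) andbT.
by move: sP; case: (size P) => [|[|m]].
Qed.

Lemma place_over_irreducible : exists p, 0 < ord p (ev t P).
Proof.
have tr := transc_pev_irreducible; have e0 := transc_neq0 tr.
have [p pt] := ex_pole ffK (transcV e0 tr); exists p.
by move: pt; rewrite ordV // oppr_lt0.
Qed.

Variable p : place K.
Hypothesis pP : 0 < ord p (ev t P).

Lemma small_over_irreducible : small p 0 t.
Proof.
rewrite smallE ?(transc_neq0 trt) // leNgt; apply/negP => pt.
have [_ e] := pev_pole_order kap pt P0.
by move: pP; rewrite e ltNge mulrn_wle0 // ltW.
Qed.

Lemma pev_unit_over a : ~~ (P %| a) -> is_unit p (ev t a).
Proof.
move=> na; have st := small_over_irreducible.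
have /Bezout_eq1_coprimepP[[u v] /= e] : coprimep P a by rewrite irreducible_poly_coprime.
rewrite unitNsmall; last exact: small_pev.
apply/negP => sa; have : small p 1 (ev t (u * P + v * a)).
  rewrite rmorphD !rmorphM /=; apply: smallD; apply: smallMl => //; try exact: small_pev.
  by rewrite smallE -?gtz0_ge1 //; exact: transc_neq0 transc_pev_irreducible.
by rewrite e rmorph1 smallE ?oner_neq0 // ord1.
Qed.

Lemma pev_order_over a : a != 0 -> exists j : nat, ord p (ev t a) = ord p (ev t P) *+ j.
Proof.
have [s hs] : exists s, (size a <= s)%N by exists (size a).
elim: s a hs => [|s IH] a hs a0; first by move: hs; rewrite leqn0 size_poly_eq0 (negbTE a0).
have [/dvdpP[b eb]|na] := boolP (P %| a); last first.
  by exists 0%N; case/andP: (pev_unit_over na) => _ /eqP.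
have b0 : b != 0 by apply: contra_neq a0 => b0; rewrite eb b0 mul0r.
have [||j hj] := IH b => //.
  by apply: size_cofactor sP _ _; rewrite -?eb.
exists j.+1; rewrite eb rmorphM /= ordM ?hj ?mulrSr //.
  by apply: contra_neq b0 => /trt.
exact: transc_neq0 transc_pev_irreducible.
Qed.

Lemma ratf_order_over z : rat t z -> z != 0 -> exists j : int, ord p z = ord p (ev t P) * j.
Proof.
move=> [a [b [b0 ->]]] z0.
have a0 : ev t a != 0 by apply: contra_neq z0 => ->; rewrite mul0r.
have [|i hi] := @pev_order_over a; first by apply: contra_neq a0 => ->; rewrite rmorph0.
have [|j hj] := @pev_order_over b; first by apply: contra_neq b0 => ->; rewrite rmorph0.
exists (i%:Z - j%:Z); rewrite ord_div // hi hj mulrBr.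
by rewrite -(mulr_natr _ i) -(mulr_natr _ j) !natz.
Qed.

End PrimeOverP.

(* The only places of K that are nonnegative on this localization of F[t] are *)
(* those over P.                                                              *)
Definition localized t (P : {poly F}) z :=
  exists a b : {poly F}, ~~ (P %| b) /\ z = ev t a / ev t b.

Lemma localized_subring t P : transc kap t -> irreducible_poly P ->
  subring_pred (localized t P).
Proof.
move=> trt irrP; have nz b : ~~ (P %| b) -> ev t b != 0.
  by move=> nb; apply: contraNneq nb => /trt ->; rewrite dvdp0.
have n1 : ~~ (P %| 1) by rewrite dvdp1; have [h _] := irrP; rewrite gtn_eqF.
have nM b d : ~~ (P %| b) -> ~~ (P %| d) -> ~~ (P %| b * d).
  move=> nb nd; rewrite Gauss_dvdpr //; by rewrite irreducible_poly_coprime.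
split; first by exists 1, 1; rewrite rmorph1 divr1.
    move=> _ _ [a [b [nb ->]]] [c [d [nd ->]]]; exists (a * d - c * b), (b * d).
    split; first exact: nM.
    by rewrite rmorphB !rmorphM /=; field; rewrite !nz.
  move=> _ _ [a [b [nb ->]]] [c [d [nd ->]]]; exists (a * c), (b * d).
split; first exact: nM.
  by rewrite !rmorphM /=; field; rewrite !nz.
Qed.

(** Otherwise some place [p] is nonnegative on the localization and negative at [x]. It does not lie
    over [P], so all nonzero polynomials in [t] have order 0 at [p]. The powers of a uniformizer are
    then independent over F[t], against the bounded rank. *)
Lemma integral_over_localized t P x : transc kap t -> irreducible_poly P ->
  (forall p, p \in zer (ev t P) -> small p 0 x) -> integral_over (localized t P) x.
Proof.
move=> trt irrP hx; apply: contrapT => nint.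
have hA := localized_subring trt irrP.
have nz b : ~~ (P %| b) -> ev t b != 0.
  by move=> nb; apply: contraNneq nb => /trt ->; rewrite dvdp0.
have n1 : ~~ (P %| 1) by rewrite dvdp1; have [h _] := irrP; rewrite gtn_eqF.
have Apev a : localized t P (ev t a) by exists a, 1; rewrite rmorph1 divr1.
have [|p [pA x0 px]] := @ex_place_not_integral F K kap ffK _ x hA _ nint.
  by move=> c; rewrite -(pevC kap t); apply: Apev.
have trP := transc_pev_irreducible trt irrP; have eP0 := transc_neq0 trP.
have [pP|pP] := ltP 0 (ord p (ev t P)).
  by have := hx p; rewrite mem_zeros pP smallE // leNgt px => /(_ isT).
have oP : ord p (ev t P) = 0.
  by apply/le_anti; rewrite pP /= -smallE //; apply: pA.
have oall a : a != 0 -> ord p (ev t a) = 0.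
  have [s hs] : exists s, (size a <= s)%N by exists (size a).
  elim: s a hs => [|s IH] a hs a0; first by move: hs; rewrite leqn0 size_poly_eq0 (negbTE a0).
  have [/dvdpP[b eb]|na] := boolP (P %| a); last first.
    have ea0 := nz a na; apply/le_anti/andP; split; last by rewrite -smallE //; apply: pA.
    rewrite -oppr_ge0 -ordV // -smallE ?invr_eq0 //; apply: pA.
    by exists 1, a; rewrite rmorph1 div1r.
  have b0 : b != 0 by apply: contra_neq a0 => b0; rewrite eb b0 mul0r.
  rewrite eb rmorphM /= ordM // ?oP ?addr0; last by apply: contra_neq b0 => /trt.
  apply: IH => //; have [h _] := irrP.
  by apply: size_cofactor h _ _; rewrite -?eb.
have [y y0 py] := ord_uniformizer p; have [r hr] := ffield_rank_bounded t ffK.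
have := hr r.+1 (fun i => y ^+ i); rewrite ltnn => h.
suff /h : tindep kap t (fun i : 'I_r.+1 => y ^+ i) by [].
move=> a ea i; apply/eqP; apply: contraT => ai.
have [j aj jmin] := @arg_minnP _ i (fun k => a k != 0) (@nat_of_ord _) ai.
have eaj : ev t (a j) != 0 by apply: contra_neq aj => /trt.
have oj : ord p (ev t (a j) * y ^+ j) = j%:Z.
  by rewrite ordM ?expf_neq0 // oall // ordX // py add0r natz.
move: ea; rewrite /tcomb (bigD1 j) //= => ea.
have [||ne _] := @ord_small_add _ p (ev t (a j) * y ^+ j) (\sum_(k < r.+1 | k != j) ev t (a k) * y ^+ k).
- by rewrite mulf_neq0 ?expf_neq0.
- rewrite oj; apply: small_sum => k kj.
  have [->|ak] := eqVneq (a k) 0; first by rewrite rmorph0 mul0r small0.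
  have jk : (j <= k)%N := jmin k ak.
  have eak : ev t (a k) != 0 by apply: contra_neq ak => /trt.
  rewrite smallE ?mulf_neq0 ?expf_neq0 // ordM ?expf_neq0 // oall // ordX // py add0r natz.
  by move: kj jk; rewrite -val_eqE /=; clear; lia.
by rewrite ea eqxx in ne.
Qed.

(** The number [d], the degree of an integral equation, is the same for all [j]. *)
Lemma integral_powers (A : K -> Prop) x : subring_pred A -> integral_over A x ->
  exists d, forall j, exists2 c : 'I_d -> K, forall i, A (c i) & x ^+ j = \sum_i c i * x ^+ i.
Proof.
move=> hA [g [mg Ag gx]]; have [A1 AB AM] := hA; have hA' := subring_subgrp hA.
have s0 : (0 < size g)%N by rewrite size_poly_gt0 monic_neq0.
exists (size g).-1.
have top : x ^+ (size g).-1 = \sum_(i < (size g).-1) - g`_i * x ^+ i.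
  have := gx; rewrite (horner_coef_wide x (leqSpred (size g))) big_ord_recr /=.
  have -> : g`_(size g).-1 = 1 by move: mg; rewrite monicE => /eqP.
  rewrite mul1r addrC => /eqP; rewrite addr_eq0 => /eqP ->.
  by rewrite -sumrN; apply: eq_bigr => i _; rewrite mulNr.
elim=> [|j [c Ac e]].
  have [z0|z0] := posnP (size g).-1.
    exists (fun=> 0); first by move=> _; case: hA'.
    by move: top; rewrite z0 !big_ord0 expr0.
  exists (fun i => (nat_of_ord i == 0%N)%:R).
    by move=> i; case: eqP => _; [|case: hA'].
  rewrite (bigD1 (Ordinal z0)) //= mul1r big1 ?addr0 // => i.
  by rewrite -val_eqE /= => /negbTE ->; rewrite mul0r.
case: ((size g).-1) c Ac e top => [|n] c Ac e top.
  exists c => //; rewrite exprS e !big_ord0; exact: mulr0.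
exists (fun i : 'I_n.+1 => (if (i : nat) is k.+1 then c (inord k) else 0) + c ord_max * - g`_i).
  move=> i; apply: (subgrpD hA'); last by apply: AM => //; exact: (subgrpN hA').
  by case: (nat_of_ord i) => [|k] //; case: hA'.
rewrite exprS e mulr_sumr big_ord_recr /=.
rewrite [x * (c ord_max * _)]mulrCA -exprS top mulr_sumr.
under [RHS]eq_bigr do rewrite mulrDl.
rewrite big_split /= [X in _ = X + _]big_ord_recl /= mul0r add0r; congr (_ + _); last first.
  by apply: eq_bigr => i _; rewrite mulrA.
apply: eq_bigr => i _; rewrite mulrCA -exprS /=; congr (c _ * _).
by apply: val_inj; rewrite /= inordK // ltnS (ltnW (ltn_ord i)).
Qed.

(** All powers of [x] are integral combinations of finitely many of them, so the matrices [R j] have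
    uniformly bounded denominators at [p]. Since the determinant of [R j] is the [j]-th power of
    that of [M], the latter cannot have negative order. *)
Lemma norm_integral t P n (u : 'I_n -> K) x M p : transc kap t -> irreducible_poly P ->
  tbasis kap t u -> x != 0 -> (forall q, q \in zer (ev t P) -> small q 0 x) ->
  represents (rat t) u x M -> 0 < ord p (ev t P) -> 0 <= ord p (\det M).
Proof.
move=> trt irrP bu x0 hx hM pP; have ku := tbasis_kbasis trt bu.
have R1 := ratf1 kap t; have RB := @ratfB F K kap t; have RM := @ratfM F K kap t.
have A0 z : localized t P z -> rat t z /\ small p 0 z.
  move=> [a [b [nb ->]]]; have ub := pev_unit_over trt irrP pP nb; have /andP[eb0 _] := ub.
  split; first by exists a, b.
  apply: smallMl; last exact/unit_small/unit_inv.
  by apply: small_pev; apply: small_over_irreducible pP.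
have [d hpow] := integral_powers (localized_subring trt irrP) (integral_over_localized trt irrP hx).
have /choice[R hR] j := ex_represents (x ^+ j) (proj2 ku).
pose B := (\sum_(i < d) \sum_a \sum_b `|ord p (R i a b)|)%N.
have sB (i : 'I_d) a b : small p (- B%:Z) (R i a b).
  have h : (`|ord p (R i a b)| <= B)%N.
    by rewrite /B (bigD1 i) //= (bigD1 a) //= (bigD1 b) //= -!addnA leq_addr.
  by apply: smallW (small_ord p (R i a b)); move: h; clear; lia.
have sR j a b : small p (- B%:Z) (R j a b).
  have [c Ac e] := hpow j.
  have -> : R j = \sum_i c i *: R i.
    apply: (represents_uniq RB (proj1 ku) (hR j)); rewrite e.
    by apply: (represents_sum R1 RB RM) => // i; case: (A0 _ (Ac i)).
  rewrite summxE; apply: small_sum => i _; rewrite mxE; apply: smallMl => //.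
  by case: (A0 _ (Ac i)).
have dR j : \det (R j) = \det M ^+ j.
  elim: j => [|j IH].
    rewrite expr0 -(det1 K n); congr (\det _).
    by apply: (represents_uniq RB (proj1 ku) (hR 0%N)); rewrite expr0; apply: represents1.
  rewrite exprS -IH -det_mulmx; congr (\det _).
  by apply: (represents_uniq RB (proj1 ku) (hR j.+1)); rewrite exprS; apply: representsM.
have d0 := det_represents_neq0 R1 RB RM ku x0 hM.
have sdet j : small p (- (B * n)%N%:Z) (\det (R j)).
  apply: small_sum => s _; rewrite mulr_sign.
  suff h : small p (- (B * n)%N%:Z) (\prod_i (R j) i (s i)) by case: (odd_perm s) => //; exact: smallN.
  have : small p (- B%:Z *+ n) (\prod_i (R j) i (s i)).
    by rewrite -[n in _ *+ n]card_ord; apply: small_prodn => i.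
  by rewrite mulNrn -mulr_natr natz PoszM.
rewrite leNgt; apply/negP => neg.
(* A negative order of [\det M] would give its power at most the order -(B n + 1), beyond the bound
   -B n. *)
have := sdet (B * n).+1; rewrite dR smallE ?expf_neq0 // ordX // -mulr_natr natz.
move: neg; clear; nia.
Qed.

Lemma norm_unit t P n (u : 'I_n -> K) x M p : transc kap t -> irreducible_poly P ->
  tbasis kap t u -> semilocal_unit (zer (ev t P)) x ->
  represents (rat t) u x M -> 0 < ord p (ev t P) -> ord p (\det M) = 0.
Proof.
move=> trt irrP bu ux hM pP; have ku := tbasis_kbasis trt bu.
have R1 := ratf1 kap t; have RB := @ratfB F K kap t; have RM := @ratfM F K kap t.
have pZ : p \in zer (ev t P) by rewrite mem_zeros.
have /andP[x0 _] := ux p pZ.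
have [N hN] := ex_represents x^-1 (proj2 ku).
have MN : \det M * \det N = 1.
  rewrite -det_mulmx -(det1 K n); congr (\det _).
  apply: (represents_uniq RB (proj1 ku) (x := 1)); last exact: represents1.
  by rewrite -(mulfV x0); apply: representsM.
have M0 := det_represents_neq0 R1 RB RM ku x0 hM.
have N0 : \det N != 0 by apply: contra_eq_neq MN => ->; rewrite mulr0 eq_sym oner_neq0.
have h1 := norm_integral trt irrP bu x0 (fun q qZ => unit_small (ux q qZ)) hM pP.
have h2 : 0 <= ord p (\det N).
  apply: (norm_integral trt irrP bu _ _ hN pP); first by rewrite invr_eq0.
  by move=> q qZ; apply/unit_small/unit_inv/ux.
have := ordM p M0 N0; rewrite MN ord1; move: h1 h2; clear; lia.
Qed.

Lemma ex_irreducible_factor (s : {poly F}) : (1 < size s)%N ->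
  exists2 P, irreducible_poly P & P %| s.
Proof.
move=> ss; have s0 : s != 0 by rewrite -size_poly_gt0 ltnW.
have ex : exists n, `[< exists P, [/\ P %| s, size P = n & (1 < n)%N] >].
  by exists (size s); apply/asboolP; exists s.
case: (ex_minnP ex) => n /asboolP[P [Ps sP n1]] nmin.
exists P => //; split; first by rewrite sP.
move=> q sq qP; have P0 : P != 0 by rewrite -size_poly_gt0 sP ltnW.
have q0 : q != 0 by apply: contraTneq qP => ->; rewrite dvd0p.
have q1 : (1 < size q)%N by rewrite ltn_neqAle eq_sym sq size_poly_gt0.
rewrite -(dvdp_size_eqp qP) eqn_leq dvdp_leq // sP; apply: nmin; apply/asboolP.
by exists q; split=> //; apply: dvdp_trans qP Ps.
Qed.

Lemma squarefree_decomposition (g : {poly F}) : g != 0 ->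
  exists h s : {poly F}, g = s * (h * h) /\ forall P : {poly F}, (1 < size P)%N -> ~~ (P * P %| s).
Proof.
move=> g0; pose Q n := exists h : {poly F}, [/\ h * h %| g, h != 0 & size h = n].
have [||n [h [hg h0 sh]] nmax] := @ex_max_nat Q (size g).
- by exists 1%N, 1; rewrite mulr1 dvd1p oner_neq0 size_poly1.
- move=> n [h [hg h0 <-]]; apply: dvdp_leq => //; apply: dvdp_trans hg; exact: dvdp_mulr.
have /dvdpP[s eg] := hg; exists h, s; split=> // P sP; apply/negP => /dvdpP[s' es].
have P0 : P != 0 by rewrite -size_poly_gt0 ltnW.
have : Q (size (h * P)%R).
  exists (h * P); rewrite mulf_neq0 //; split=> //.
  by rewrite eg es; apply/dvdpP; exists s'; ring.
move/nmax; have -> : size (h * P)%R = (size h + size P).-1 := size_mul h0 P0.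
have : (0 < n)%N by rewrite -sh size_poly_gt0.
by rewrite sh; move: sP; clear; lia.
Qed.

(** Let [s] be the squarefree part of the norm. If an irreducible [P] divides [s], choose [m] with
    [x * m ^+ 2] a unit above [P]. Its norm has order 0 at a place [p] over [P], but it is [s] times
    a square, whose order is an odd multiple of the order of P(t). *)
Lemma norm_square_class t n (u : 'I_n -> K) x M : transc kap t -> tbasis kap t u ->
  x != 0 -> even_divisor x -> represents (rat t) u x M ->
  exists c h, [/\ c != 0, rat t h & \det M = kap c * h ^+ 2].
Proof.
move=> trt bu x0 ex hM; have ku := tbasis_kbasis trt bu.
have R1 := ratf1 kap t; have RB := @ratfB F K kap t; have RM := @ratfM F K kap t.
have d0 := det_represents_neq0 R1 RB RM ku x0 hM.
have [a [b [b0 eM]]] : rat t (\det M) by apply: (kdet R1 RB RM) => i j; case: hM.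
have ea0 : ev t a != 0 by apply: contra_neq d0 => e; rewrite eM e mul0r.
have ab0 : a * b != 0.
  by apply: contra_neq (mulf_neq0 ea0 b0) => e; rewrite -rmorphM /= e rmorph0.
have [h [s [eg sqf]]] := squarefree_decomposition ab0.
have dM : \det M = ev t s * (ev t h / ev t b) ^+ 2.
  rewrite eM expr_div_n expr2 -rmorphM /= mulrA -rmorphM /= -eg rmorphM /=.
  by field.
have s0 : s != 0 by apply: contra_neq ab0 => e; rewrite eg e mul0r.
have h0 : h != 0 by apply: contra_neq ab0 => e; rewrite eg e !mul0r mulr0.
have evn0 (c : {poly F}) : c != 0 -> ev t c != 0 by apply: contra_neq => /trt.
have [s1|s1] := leqP (size s) 1.
  have es := size1_polyC s1; exists s`_0, (ev t h / ev t b); split.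
  - by apply: contra_neq s0 => e; rewrite es e.
  - by exists h, b.
  - by rewrite dM {1}es pevC.
exfalso; have [P irrP Ps] := ex_irreducible_factor s1.
have [sP _] := irrP; have [p pP] := place_over_irreducible trt irrP.
have eP0 := transc_neq0 (transc_pev_irreducible trt irrP).
have uZ := zeros_uniq ffK (ev t P).
have [m m0 um] := ex_unit_multiple uZ x0 ex.
have [Mm hMm] := ex_represents m (proj2 ku).
have hMxm : represents (rat t) u (x * m ^+ 2) (M *m (Mm *m Mm)).
  by apply: representsM => //; rewrite expr2; apply: representsM.
have := norm_unit trt irrP bu um hMxm pP.
have dm0 := det_represents_neq0 R1 RB RM ku m0 hMm.
have /dvdpP[s' es] := Ps.
have nPs' : ~~ (P %| s').
  by apply: contra (sqf P sP) => /dvdpP[s'' e]; rewrite es e -mulrA dvdp_mull.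
have /andP[es'0 /eqP os'] := pev_unit_over trt irrP pP nPs'.
pose y := ev t h / ev t b * \det Mm.
have y0 : y != 0.
  apply: mulf_neq0 dm0; apply: mulf_neq0; first exact: evn0.
  by rewrite invr_eq0.
have ry : rat t y.
  by apply: ratfM; [exists h, b|apply: (kdet R1 RB RM) => i j; case: hMm].
have [j ej] := ratf_order_over trt irrP pP ry y0.
rewrite !det_mulmx dM.
rewrite (_ : _ * _ * (_ * _) = ev t s' * ev t P * y ^+ 2); last first.
  rewrite es rmorphM /= /y.
  by move: (ev t s') (ev t P) (ev t h / ev t b) (\det Mm) => a1 a2 a3 a4; ring.
have es'P := mulf_neq0 es'0 eP0; have y20 : y ^+ 2 != 0 by rewrite expf_neq0.
rewrite (ordM p es'P y20) (ordM p es'0 eP0) os' add0r (ordX p _ y0) ej.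
move: pP; set d := ord p _ => dpos e.
have /eqP : d * (1 + 2%:R * j) = 0 by rewrite -e; ring.
by rewrite mulf_eq0 (gt_eqF dpos) /=; clear; lia.
Qed.

(** F(y) and F(y^-1) are the same subfield and one matrix represents [x] over both, so the zeros and
    the poles of [y] contribute the same [scodd c]. *)
Theorem reciprocity x y : x != 0 -> even_divisor x ->
  \big[addb/false]_(p <- zer y ++ zer y^-1) (odd `|ord p y| && nonsquare_at p x) = false.
Proof.
move=> x0 ex; rewrite big_cat /=.
have [[p py]|none] := pselect (exists p, ord p y != 0); last first.
  by rewrite !big1_seq // => p _; have [->//|h] := eqVneq (ord p y) 0; case: none; exists p.
have trt := transc_ord (kap := kap) py; have y0 := transc_neq0 trt.
have [n [u bu]] := ex_tbasis ffK trt; have [e1 e2] := tbasis_zdeg ffK trt bu.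
have [M hM] := ex_represents x (proj2 (tbasis_kbasis trt bu)).
have [c [h [c0 rh eM]]] := norm_square_class trt bu x0 ex hM.
have := square_class_at_zeros trt e1 bu x0 ex hM c0 rh eM; rewrite /= => ->.
have trt' := transcV y0 trt.
have bu' : tbasis kap y^-1 u.
  have ku : kbasis (rat y^-1) u.
    apply: kbasis_inv; rewrite ?invr_eq0 // invrK; exact: tbasis_kbasis.
  have [n' [u' bu']] := ex_tbasis ffK trt'.
  have [e3 _] := tbasis_zdeg ffK trt' bu'; rewrite e2 in e3; subst n'.
  by apply: tbasis_of_tindep bu' _ => //; apply/tindep_kindep; case: ku.
have ratI z : rat y z -> rat y^-1 z by move=> hz; apply: ratf_inv; rewrite ?invr_eq0 // invrK.
have hM' : represents (rat y^-1) u x M by case: hM => a b; split=> // i j; apply: ratI.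
have := square_class_at_zeros trt' e2 bu' x0 ex hM' c0 (ratI _ rh) eM.
rewrite (eq_bigr (fun p => odd `|ord p y| && nonsquare_at p x)) => [->|q _]; first by rewrite addbb.
by rewrite ordV // abszN.
Qed.

End Reciprocity.

(** * Local squares are squares *)

Section SplitPlaces.
Variables (K L : fieldType) (iota : {rmorphism K -> L}) (x : K) (zeta : L).
Hypotheses (nsq : forall y, y ^+ 2 != x) (zeta2 : zeta ^+ 2 = iota x).
Hypothesis coord : forall y : L, exists a b, y = iota a + iota b * zeta.

Lemma coord_uniq a b c d : iota a + iota b * zeta = iota c + iota d * zeta -> a = c /\ b = d.
Proof.
move=> e; have e' : iota (b - d) * zeta = iota (c - a).
  rewrite !rmorphB /= (_ : _ * _ = (iota a + iota b * zeta) - iota a - iota d * zeta); last by ring.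
  by rewrite e; ring.
have [bd|bd] := eqVneq (b - d) 0.
  move: e'; rewrite bd rmorph0 mul0r => /esym/eqP; rewrite fmorph_eq0 subr_eq0 => /eqP ->.
  by split=> //; apply/eqP; rewrite -subr_eq0 bd.
have ibd : iota (b - d) != 0 by rewrite fmorph_eq0.
have := nsq ((c - a) / (b - d)); rewrite -(inj_eq (fmorph_inj iota)) -zeta2.
by rewrite rmorphXn fmorph_div /= -e' [iota _ * _]mulrC mulfK // eqxx.
Qed.

Section Place.
Variables (p : place K) (s : nat -> K).
Hypotheses (cs : cauchy_seq p s) (ns : null_seq p (fun n => s n ^+ 2 - x)).

Lemma null_seqD u w : null_seq p u -> null_seq p w -> null_seq p (fun n => u n + w n).
Proof.
move=> hu hw N; have [a ha] := hu N; have [b hb] := hw N; exists (maxn a b) => n.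
by rewrite geq_max => /andP[an bn]; apply: smallD; [exact: ha|exact: hb].
Qed.

Lemma null_seqM u w : null_seq p u -> cauchy_seq p w -> null_seq p (fun n => u n * w n).
Proof.
move=> hu hw N; have [A hA] := cauchy_bounded hw; have [a ha] := hu (N - A).
by exists a => n an; rewrite -[N](subrK A); apply: smallM; [exact: ha|exact: hA].
Qed.

Lemma null_seq_ext u w : u =1 w -> null_seq p u -> null_seq p w.
Proof. by move=> uw hu N; have [a ha] := hu N; exists a => n /ha; rewrite uw. Qed.

Lemma null_seqN u : null_seq p u -> null_seq p (fun n => - u n).
Proof. by move=> hu N; have [a ha] := hu N; exists a => n /ha /smallN. Qed.

Lemma cauchy_seq_ext u w : u =1 w -> cauchy_seq p u -> cauchy_seq p w.
Proof. by move=> uw hu N; have [a ha] := hu N; exists a => m n /ha h /h; rewrite !uw. Qed.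

Lemma cauchy_seqD u w : cauchy_seq p u -> cauchy_seq p w -> cauchy_seq p (fun n => u n + w n).
Proof.
move=> hu hw N; have [a ha] := hu N; have [b hb] := hw N; exists (maxn a b) => m n.
rewrite !geq_max => /andP[am bm] /andP[an bn]; rewrite opprD addrACA.
by apply: smallD; [exact: ha|exact: hb].
Qed.

Lemma cauchy_seqM u w : cauchy_seq p u -> cauchy_seq p w -> cauchy_seq p (fun n => u n * w n).
Proof.
move=> hu hw; have [_ _ hM] := cauchy_subring p; apply/asboolP.
by have := hM u w; apply; apply/asboolP.
Qed.

Lemma null_cauchy u : null_seq p u -> cauchy_seq p u.
Proof.
by move=> hu N; have [a ha] := hu N; exists a => m n /ha hm /ha hn; apply: smallB.
Qed.

(** [u] converges in K_p to the image of [y] under the embedding of [L] that sends [zeta] to the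
    limit of [s]. *)
Definition approx y u := exists a b, y = iota a + iota b * zeta /\
  null_seq p (fun n => u n - (a + b * s n)).

Lemma ex_approx y : exists u, approx y u.
Proof.
have [a [b e]] := coord y; exists (fun n => a + b * s n), a, b; split=> // N.
by exists 0%N => n _; rewrite subrr small0.
Qed.

Lemma approx_iota a : approx (iota a) (fun=> a).
Proof.
exists a, 0; rewrite rmorph0 mul0r addr0; split=> // N; exists 0%N => n _.
by rewrite mul0r addr0 subrr small0.
Qed.

Lemma approx_zeta : approx zeta s.
Proof.
exists 0, 1; rewrite rmorph0 rmorph1 mul1r add0r; split=> // N; exists 0%N => n _.
by rewrite mul1r add0r subrr small0.
Qed.

Lemma cauchy_coord a b : cauchy_seq p (fun n => a + b * s n).
Proof. by apply: cauchy_seqD; [|apply: cauchy_seqM => //]; apply: cauchy_cst. Qed.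

Lemma approx_cauchy y u : approx y u -> cauchy_seq p u.
Proof.
move=> [a [b [_ h]]].
apply: (cauchy_seq_ext (u := fun n => (u n - (a + b * s n)) + (a + b * s n))).
  by move=> n; rewrite subrK.
by apply: cauchy_seqD (null_cauchy h) (cauchy_coord a b).
Qed.

Lemma approx_diff y u w : approx y u -> approx y w -> null_seq p (fun n => u n - w n).
Proof.
move=> [a [b [-> h]]] [c [d [/coord_uniq[ea eb] h']]]; subst c d.
by apply: null_seq_ext (null_seqD h (null_seqN h')) => n /=; ring.
Qed.

Lemma approxD y z u w : approx y u -> approx z w -> approx (y + z) (fun n => u n + w n).
Proof.
move=> [a [b [-> h]]] [c [d [-> h']]]; exists (a + c), (b + d); split.
  by rewrite !rmorphD /=; ring.
by apply: null_seq_ext (null_seqD h h') => n /=; ring.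
Qed.

Lemma approxM y z u w : approx y u -> approx z w -> approx (y * z) (fun n => u n * w n).
Proof.
move=> ay az; have [[a [b [ey h]]] [c [d [ez h']]]] := (ay, az).
exists (a * c + b * d * x), (a * d + b * c); split.
  by rewrite ey ez !rmorphD !rmorphM /= -zeta2; ring.
have h1 := null_seqM h (approx_cauchy az).
have h2 := null_seqM h' (cauchy_coord a b).
have h3 := null_seqM ns (@cauchy_cst _ p (b * d)).
by apply: null_seq_ext (null_seqD (null_seqD h1 h2) h3) => n /=; ring.
Qed.

(** Multiplied by an approximation of [y^-1], the terms of [u] tend to 1, which bounds their orders
    from above. A Cauchy sequence with this property has eventually constant order; this constant is
    the value of [y] at the split place. *)
Lemma approx_ord y : y != 0 -> exists v, forall u, approx y u ->
  exists n0, forall n, (n0 <= n)%N -> u n != 0 /\ ord p (u n) = v.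
Proof.
move=> y0; have [w aw] := ex_approx y^-1.
have [A hA] := cauchy_bounded (approx_cauchy aw).
have low u : approx y u -> exists n0, forall n, (n0 <= n)%N -> u n != 0 /\ ord p (u n) <= - A.
  move=> au; have := approxM au aw; rewrite mulfV // => a1.
  have := approx_iota 1; rewrite rmorph1 => /(approx_diff a1)/(_ 1)[n0 hn0].
  exists n0 => n /hn0 h; have := @ord_small_add _ p 1 _ (oner_neq0 K); rewrite ord1 add0r.
  move=> /(_ _ h); rewrite subrKC => -[uw0 ouw].
  move: uw0; rewrite mulf_eq0 negb_or => /andP[u0 w0]; split=> //.
  by have := hA n; rewrite smallE //; move: ouw; rewrite ordM //; clear; lia.
have [u0 au0] := ex_approx y; have [n1 hn1] := low _ au0.
have [n2 hn2] := approx_cauchy au0 (- A + 1).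
pose m := maxn n1 n2; have [um0 om] := hn1 m (leq_maxl _ _).
exists (ord p (u0 m)) => u au; have [n3 hn3] := approx_diff au au0 (- A + 1).
exists (maxn m n3) => n; rewrite geq_max => /andP[mn n3n].
rewrite (_ : u n = u0 m + ((u n - u0 n) + (u0 n - u0 m))); last by ring.
have n2m : (n2 <= m)%N := leq_maxr _ _.
apply: ord_small_add => //; apply: (@smallW _ _ _ (- A + 1)); first by rewrite lerD2r.
by apply: smallD; [exact: hn3|apply: hn2 => //; exact: leq_trans n2m mn].
Qed.

Lemma ex_split_place : exists P : place L, (forall a, ord P (iota a) = ord p a) /\
  forall N, exists n0, forall n, (n0 <= n)%N -> small P N (zeta - iota (s n)).
Proof.
have /choice[f hf] y : exists v, (y = 0 -> v = 0) /\ (y != 0 -> forall u, approx y u ->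
    exists n0, forall n, (n0 <= n)%N -> u n != 0 /\ ord p (u n) = v).
  have [->|y0] := eqVneq y 0; first by exists 0.
  by have [v hv] := approx_ord y0; exists v; split=> // e; rewrite e eqxx in y0.
have fE y u v : y != 0 -> approx y u ->
    (exists n0, forall n, (n0 <= n)%N -> ord p (u n) = v) -> f y = v.
  move=> y0 /((hf y).2 y0)[n0 h0] [n1 h1].
  by have [_ <-] := h0 _ (leq_maxl n0 n1); rewrite h1 // leq_maxr.
have fi a : f (iota a) = ord p a.
  have [->|a0] := eqVneq a 0; first by rewrite rmorph0 ord_zero; apply: (hf 0).1.
  apply: (fE _ (fun=> a)); [by rewrite fmorph_eq0|exact: approx_iota|by exists 0%N].
have f0 : f 0 = 0 by apply: (hf 0).1.
have fM y z : y != 0 -> z != 0 -> f (y * z) = f y + f z.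
  move=> y0 z0; have [u au] := ex_approx y; have [w aw] := ex_approx z.
  apply: (fE _ _ _ _ (approxM au aw)); first exact: mulf_neq0.
  have [n0 h0] := (hf y).2 y0 u au; have [n1 h1] := (hf z).2 z0 w aw.
  exists (maxn n0 n1) => n; rewrite geq_max => /andP[/h0[u0 <-] /h1[w0 <-]].
  exact: ordM.
have fD y z : y != 0 -> z != 0 -> y + z != 0 -> Num.min (f y) (f z) <= f (y + z).
  move=> y0 z0 yz0; have [u au] := ex_approx y; have [w aw] := ex_approx z.
  have [n0 h0] := (hf y).2 y0 u au; have [n1 h1] := (hf z).2 z0 w aw.
  have [n2 h2] := (hf (y + z)).2 yz0 _ (approxD au aw).
  have [u0 <-] := h0 (maxn n0 (maxn n1 n2)) (leq_maxl _ _).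
  have [w0 <-] : w (maxn n0 (maxn n1 n2)) != 0 /\ ord p (w (maxn n0 (maxn n1 n2))) = f z.
    by apply: h1; rewrite leq_max leq_maxl orbT.
  have [uw0 <-] := h2 (maxn n0 (maxn n1 n2)) ltac:(by rewrite !leq_max leqnn !orbT).
  exact: ordD.
have [pi pi0 opi] := ord_uniformizer p.
have fu : exists2 y, y != 0 & f y = 1 by exists (iota pi); rewrite ?fmorph_eq0 ?fi.
exists (Place f0 fM fD fu); split=> //= N.
have [n0 h0] := cs N; exists n0 => n nn; rewrite /small.
have [//|e0 /=] := eqVneq; have [u au] := ex_approx (zeta - iota (s n)).
have [n1 h1] := (hf _).2 e0 u au.
have := approxD approx_zeta (approx_iota (- s n)); rewrite rmorphN => az.
have [n2 h2] := approx_diff au az N; pose m := maxn (maxn n0 n1) n2.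
have [um0 <-] : u m != 0 /\ ord p (u m) = f (zeta - iota (s n)).
  by apply: h1; rewrite /m !leq_max leqnn !orbT.
rewrite -smallE // (_ : u m = (u m - (s m + - s n)) + (s m - s n)); last by ring.
by apply: smallD; [apply: h2|apply: h0 => //]; rewrite /m !leq_max leqnn ?orbT.
Qed.

End Place.

(** The sequences [s] and [- s] give the two places; were they equal, [zeta *+ 2] would be
    arbitrarily small. The density of [K] for both places is what preserves residue degrees. *)
Lemma ex_split_places p : (2%:R : K) != 0 -> is_square_at p x -> exists P1 P2 : place L,
  [/\ P1 != P2, forall a, ord P1 (iota a) = ord p a, forall a, ord P2 (iota a) = ord p a,
      forall y N, exists a, small P1 N (y - iota a) &
      forall y N, exists a, small P2 N (y - iota a)].
Proof.
move=> two0 /is_square_atP[s [cs ns]].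
have [P1 [r1 h1]] := ex_split_place cs ns.
have cs' : cauchy_seq p (fun n => - s n).
  by move=> N; have [a ha] := cs N; exists a => m n am an; rewrite -opprD; apply/smallN/ha.
have ns' : null_seq p (fun n => (- s n) ^+ 2 - x) by apply: null_seq_ext ns => n; rewrite sqrrN.
have [P2 [r2 h2]] := ex_split_place cs' ns'.
have dense (P : place L) (u : nat -> K) : (forall a, ord P (iota a) = ord p a) ->
    (forall N, exists n0, forall n, (n0 <= n)%N -> small P N (zeta - iota (u n))) ->
    forall y N, exists a, small P N (y - iota a).
  move=> r h y N; have [a [b ->]] := coord y.
  have [n0 h0] := h (N - ord p b); exists (a + b * u n0).
  rewrite rmorphD rmorphM /= (_ : _ - _ = iota b * (zeta - iota (u n0))); last by ring.
  by rewrite -[N](subrKC (ord p b)); apply: smallM; [rewrite -r small_ord|exact: h0].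
exists P1, P2; split=> //; [|exact: dense r1 h1|exact: dense r2 h2].
apply/eqP => e; subst P2.
have z0 : zeta != 0.
  apply: contra_neq (nsq 0) => z0; rewrite expr0n /=.
  by apply/eqP; rewrite -(inj_eq (fmorph_inj iota)) -zeta2 z0 expr0n rmorph0.
have tz0 : zeta *+ 2 != 0 by rewrite -mulr_natl mulf_neq0 // -(rmorph_nat iota) fmorph_eq0.
have [n1 hn1] := h1 (ord P1 (zeta *+ 2) + 1); have [n2 hn2] := h2 (ord P1 (zeta *+ 2) + 1).
have := smallD (hn1 _ (leq_maxl n1 n2)) (hn2 _ (leq_maxr n1 n2)).
rewrite rmorphN opprK (_ : _ + _ = zeta *+ 2); last by ring.
by rewrite smallE // gerDl.
Qed.

End SplitPlaces.

Lemma ex_quadratic_extension (K : fieldType) (x : K) : (forall y, y ^+ 2 != x) ->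
  exists (L : fieldType) (iota : {rmorphism K -> L}) (zeta : L),
    zeta ^+ 2 = iota x /\ forall y : L, exists a b, y = iota a + iota b * zeta.
Proof.
move=> nsq; pose P : {poly K} := 'X^2 - x%:P.
have sP : size P = 3%N by rewrite size_XnsubC.
have irrP : irreducible_poly P.
  apply: cubic_irreducible; first by rewrite sP.
  by move=> y; rewrite /root !hornerE subr_eq0; apply: nsq.
have [L dL [z rz gz]] := irredp_FAdjoin irrP.
exists L, (in_alg L), z; split.
  move: rz; rewrite /root rmorphB /= map_polyXn map_polyC !hornerE subr_eq0 => /eqP.
  by [].
move=> y; have yz : y \in <<1; z>>%VS by rewrite gz memvf.
have /polyOver1P[g eg] : Fadjoin_poly 1 z y \is a polyOver 1%VS by apply: Fadjoin_polyOver.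
have := Fadjoin_poly_eq yz; rewrite eg => <-.
have sg : (size g <= 2)%N.
  rewrite -(size_map_poly (in_alg L)) -eg.
  apply: leq_trans (size_Fadjoin_poly _ _ _) _.
  by rewrite adjoin_degreeE gz dimv1 divn1 dL sP.
exists g`_0, g`_1; rewrite (horner_coef_wide (n := 2)) ?size_map_poly //.
by rewrite 2!big_ord_recl big_ord0 !coef_map /= expr0 expr1 mulr1 addr0.
Qed.

Lemma ffield_extension (F : finFieldType) (K L : fieldType) (kap : {rmorphism F -> K})
    (iota : {rmorphism K -> L}) (zeta : L) :
  (forall y : L, exists a b, y = iota a + iota b * zeta) ->
  ffield kap -> ffield (iota \o kap).
Proof.
move=> coord [t [n [w [trt tw]]]].
have pevi a : pev (iota \o kap) (iota t) a = iota (pev kap t a).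
  by rewrite !pevE rmorph_sum /=; apply: eq_bigr => i _; rewrite rmorphM rmorphXn.
exists (iota t), (n + n)%N,
  (fun i => match fintype.split i with inl j => iota (w j) | inr j => iota (w j) * zeta end).
split; first by move=> a; rewrite pevi => /eqP; rewrite fmorph_eq0 => /eqP/trt.
move=> y; have [a [b ->]] := coord y.
have [d [f [d0 hf]]] := tw a; have [e [g [e0 hg]]] := tw b.
exists (d * e), (fun i => match fintype.split i with inl j => f j * e | inr j => g j * d end).
rewrite rmorphM /= !pevi; split; first by rewrite mulf_neq0 ?fmorph_eq0.
rewrite /tcomb big_split_ord /=.
rewrite (_ : _ * _ = iota (pev kap t e) * iota (pev kap t d * a) +
  iota (pev kap t d) * iota (pev kap t e * b) * zeta); last by rewrite !rmorphM; ring.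
rewrite hf hg /tcomb !rmorph_sum mulr_sumr; congr (_ + _).
  apply: eq_bigr => i _; case: split_ordP => j => [/lshift_inj <-|/eqP]; last by rewrite eq_lrshift.
  by rewrite pevi !rmorphM /=; ring.
rewrite mulr_sumr mulr_suml.
apply: eq_bigr => i _; case: split_ordP => j => [/eqP|/rshift_inj <-]; first by rewrite eq_rlshift.
by rewrite pevi !rmorphM /=; ring.
Qed.

(** * Counting divisors in a completely split quadratic extension *)

Lemma atleast_injection (A : zmodType) (U : A -> Prop) B : atleast U B.+1 ->
  exists f : 'I_B -> A, injective f /\ forall i, U (f i) /\ f i != 0.
Proof.
move=> [T [r [ir Ur]]].
pose S := [set t | r t != 0] => cT.
have cS : (B <= #|S|)%N.
  have : (#|~: S| <= 1)%N.
    apply/card_le1_eqP => u v; rewrite !inE !negbK => /eqP eu /eqP ev.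
    by apply: ir; rewrite eu ev.
  by have := cardsC S; move: cT; rewrite -cardsT; clear; lia.
have nS : (0 < B)%N -> exists t0, t0 \in S.
  by move=> B0; apply/card_gt0P; apply: leq_trans cS.
case: B cT cS nS => [|B] cT cS nS.
  by exists (fun=> 0); split=> [[]|[]].
exists (fun i => r (enum_val (widen_ord cS i))); split.
  by move=> i j /ir /enum_val_inj e; apply: val_inj; have /(congr1 val) := e.
by move=> i; split=> //; have := enum_valP (widen_ord cS i); rewrite inE.
Qed.

Section ResidueDegree.
Variables (F : finFieldType) (K L : fieldType) (kap : {rmorphism F -> K}).
Variable (iota : {rmorphism K -> L}).
Hypotheses (ffK : ffield kap) (ffL : ffield (iota \o kap)).

Lemma degp_dense (p : place K) (P : place L) : (forall a, ord P (iota a) = ord p a) ->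
  (forall y N, exists a, small P N (y - iota a)) -> degp (iota \o kap) P = degp kap p.
Proof.
move=> rP dP; have [u tu] := degpP ffK p; have [u' tu'] := degpP ffL P.
have li c : lincomb (iota \o kap) (fun i => iota (u i)) c = iota (lincomb kap u c).
  by rewrite rmorph_sum; apply: eq_bigr => i _; rewrite rmorphM.
have smi N a : small P N (iota a) = small p N a by rewrite /small fmorph_eq0 rP.
have [subg _] := small_Fsub (iota \o kap) P 1.
suff tu2 : transversal_of (small P 0) (small P 1) (lincomb (iota \o kap) (fun i => iota (u i))).
  have := transversal_card subg tu' tu2; rewrite !card_cV.
  by move=> /eqP; rewrite eqn_exp2l ?finRing_gt1 // => /eqP.
have [mu su cu] := tu; split=> [c|c d|y y0].
- by rewrite li smi.
- by rewrite !li -rmorphB smi => /su.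
- have [a ha] := dP y 1; have sa : small p 0 a.
    rewrite -smi -[iota a](subKr y); apply: smallB => //; exact: smallW ha.
  have [c hc] := cu a sa; exists c; rewrite li.
  by rewrite -[y](subrK (iota a)) -addrA -rmorphB; apply: smallD; rewrite ?smi.
Qed.

End ResidueDegree.

Lemma card_le_image (T : finType) (A : zmodType) (U : A -> Prop) (S : {set T}) (z : T -> A) B C :
  (forall i, i \in S -> U (z i)) -> atmost U B ->
  (forall v, (#|[set i in S | z i == v]| <= C)%N) -> (#|S| <= B * C)%N.
Proof.
move=> Uz hB hC; pose s := undup [seq z i | i <- enum S].
have zs (u : {i | i \in S}) : z (val u) \in s.
  by rewrite mem_undup map_f // mem_enum (valP u).
have card_s : (#|{: seq_sub s}| <= B)%N.
  apply: (hB _ (@ssval _ s)); first exact: val_inj.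
  move=> [v /=]; rewrite mem_undup => /mapP[i]; rewrite mem_enum => iS ->; exact: Uz.
rewrite -card_sig; apply: leq_trans (leq_mul card_s (leqnn C)).
apply: (@card_le_fibers _ _ (fun u => SeqSub (zs u))) => v.
apply: leq_trans (hC (ssval v)); rewrite -(card_imset _ val_inj).
apply/subset_leq_card/subsetP => i /imsetP[u]; rewrite [u \in _]inE => /eqP e ->.
by rewrite inE (valP u) -e eqxx.
Qed.

Section LiftDivisor.
Variables (F : finFieldType) (K L : fieldType) (kK : {rmorphism F -> K}) (kL : {rmorphism F -> L}).
Variables (ffK : ffield kK) (ffL : ffield kL) (P : place K -> place L).
Hypothesis injP : injective P.
Implicit Types (D : divisor K) (p : place K).

(** Only the chosen place [P p] above each [p] is used, unlike in the conorm; the two choices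
    together turn pairs of divisors of [K] into divisors of [L]. *)
Definition lift_div D : divisor L := \sum_(p <- dom D) << coeff p D *g P p >>.

Lemma coeff_lift_out D Q : (forall p, P p != Q) -> coeff Q (lift_div D) = 0.
Proof.
move=> hQ; rewrite /lift_div raddf_sum big1 // => p _ /=.
by rewrite coeffU (negbTE (hQ p)) mulr0.
Qed.

Lemma coeff_lift D p : coeff (P p) (lift_div D) = coeff p D.
Proof.
rewrite -[in RHS](freeg_sumE D) /lift_div !raddf_sum; apply: eq_bigr => q _ /=.
by rewrite !coeffU (inj_eq injP).
Qed.

Lemma effective_lift D : effective D -> effective (lift_div D).
Proof.
move=> hD; apply: effective_sum => p _ Q; rewrite coeffU mulr_ge0 //; exact: hD.
Qed.

Lemma ddeg_lift D : (forall p, degp kL (P p) = degp kK p) -> ddeg kL (lift_div D) = ddeg kK D.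
Proof.
move=> hdeg; rewrite [RHS]ddegE /lift_div raddf_sum; apply: eq_bigr => p _ /=.
by rewrite ddegU hdeg.
Qed.

End LiftDivisor.

Section LocalGlobal.
Variables (F : finFieldType) (K : fieldType) (kap : {rmorphism F -> K}).
Hypotheses (ffK : ffield kap) (odd_char : (2%:R : F) != 0).
Hypothesis full_const : forall z, ~ transc kap z -> exists c, z = kap c.
Implicit Types (p : place K) (x y z : K).

Lemma ord0_const z : (forall p, ord p z = 0) -> exists c, z = kap c.
Proof.
move=> h; apply: full_const => /(ex_pole ffK)[p]; by rewrite h ltxx.
Qed.

Lemma effective_bound_seq (L : fieldType) (Es : seq (divisor L)) :
  exists2 N, effective N & forall E, E \in Es -> effective (N - E).
Proof.
elim: Es => [|E Es [N hN hE]]; first by exists 0 => //; apply: effective0.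
have [M hM hEM] := effective_bound E; exists (N + M); first exact: effectiveD.
move=> E'; rewrite inE => /orP[/eqP->|/hE h].
  by rewrite -addrA; apply: effectiveD.
by rewrite addrAC; apply: effectiveD.
Qed.

(** One unit of the exponent is spent on discarding the zero function. *)
Lemma nonzero_functions (g : nat) p r a :
  (forall D (m : nat), m%:Z + g%:Z <= ddeg kap D -> atleast (LL D) (#|F| ^ m)) ->
  (a.+1 + g <= r * degp kap p)%N ->
  exists f : 'I_(#|F| ^ a) -> K, injective f /\ forall i, LL (<< p >> *+ r) (f i) /\ f i != 0.
Proof.
move=> hg har; apply: atleast_injection.
apply: (@atleastW _ (LL (<< p >> *+ r)) _ (#|F| ^ a.+1)) => //.
  by rewrite ltn_exp2l // finNzRing_gt1.
apply: hg; rewrite raddfMn /= ddegU mul1r -mulr_natr natz mulrC.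
by move: har; clear; lia.
Qed.

Lemma LL_effective D z : z != 0 -> LL D z -> effective (divx ffK z + D).
Proof.
by move=> z0 h p; have := h p; rewrite smallE // coeffD coeff_divx; lia.
Qed.

Section Counting.
Variables (L : fieldType) (kL : {rmorphism F -> L}) (ffL : ffield kL).
Variables (P1 P2 : place K -> place L).
Hypotheses (inj1 : injective P1) (inj2 : injective P2) (disj : forall p q, P1 p != P2 q).
Hypotheses (deg1 : forall p, degp kL (P1 p) = degp kap p) (deg2 : forall p, degp kL (P2 p) = degp kap p).

Lemma lift2_inj A B A' B' : lift_div P1 A + lift_div P2 B = lift_div P1 A' + lift_div P2 B' ->
  A = A' /\ B = B'.
Proof.
move=> e; split; apply: divisorP => p.
  have := congr1 (coeff (P1 p)) e; rewrite !coeffD !coeff_lift //.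
  by rewrite !(coeff_lift_out _ (P := P2)) ?addr0 // => q; rewrite eq_sym.
have := congr1 (coeff (P2 p)) e; rewrite !coeffD !(coeff_lift inj2).
by rewrite !(coeff_lift_out _ (P := P1)) ?add0r.
Qed.

(** For each of [N] ways to share the total degree [M * d], there are [Q] pairs of functions, whose
    divisors on [L] are represented by [size Es] classes. For one class they correspond to functions
    in a space of at most [B] elements, and one such function comes from at most q^2 pairs. [Q] and
    [B] differ from q^(M d) by factors independent of [N], so a large [N] is impossible. *)
Lemma no_complete_splitting : False.
Proof.
have [g hg] := Riemann_inequality ffK; have [p0] := ex_place ffK.
have [Es hEs] := finite_class_number ffL; have [c hc] := LL_bounded ffL.
have [N0 eN0 hN0] := effective_bound_seq Es.
have d0 := degp_gt0 ffK p0; pose d := degp kap p0; pose r := g.+1.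
have q1 : (1 < #|F|)%N by rewrite finNzRing_gt1.
(* The part 2 g + 4 of the exponent is the loss g + 1 for each of the two functions, plus 2 for
   their constant factors; the rest comes from the bound on the functions of one class. *)
pose C := (size Es * #|F| ^ (`|ddeg kL N0| + c + 2 * g + 4))%N; pose N := C.+1.
pose a (i : nat) := ((r + i) * d - g.+1)%N.
have har i : (g.+1 <= (r + i) * d)%N by rewrite -[g.+1]muln1 leq_mul // leq_addr.
pose M := (r + r + N)%N; pose Q := (#|F| ^ (M * d - 2 * g.+1))%N.
have /choice[phi hphi] (i : 'I_N) : exists phi : 'I_Q -> K * K, injective phi /\ forall k,
    [/\ (phi k).1 != 0, (phi k).2 != 0, LL (<< p0 >> *+ (r + i)) (phi k).1 &
        LL (<< p0 >> *+ (r + (N - i))) (phi k).2].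
  have [|f [jf hf]] := @nonzero_functions g p0 (r + i) (a i) hg.
    by have := har i; rewrite /a -/d; clear; lia.
  have [|h [jh hh]] := @nonzero_functions g p0 (r + (N - i)) (a (N - i)%N) hg.
    by have := har (N - i)%N; rewrite /a -/d; clear; lia.
  have eQ : Q = #|{: 'I_(#|F| ^ a i) * 'I_(#|F| ^ a (N - i)%N)}|.
    rewrite card_prod !card_ord /Q -expnD; congr (_ ^ _)%N.
    have iN : (i < N)%N := ltn_ord i.
    have e : (M * d = (r + i) * d + (r + (N - i)) * d)%N.
      by rewrite -mulnDl /M; congr (_ * _)%N; move: iN; clear; lia.
    rewrite e /a; have := har i; have := har (N - i)%N; clear.
    by move: ((r + i) * d)%N ((r + (N - i)) * d)%N => u v; lia.
  pose k2 (k : 'I_Q) := enum_val (cast_ord eQ k).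
  exists (fun k => (f (k2 k).1, h (k2 k).2)); split.
    move=> k l [/jf e1 /jh e2]; apply: (cast_ord_inj (eq_n := eQ)); apply: enum_val_inj.
    by rewrite [enum_val _]surjective_pairing [RHS]surjective_pairing; congr pair.
  by move=> k /=; have [] := hf (k2 k).1; have [] := hh (k2 k).2.
pose AA (s : 'I_N * 'I_Q) := divx ffK (phi s.1 s.2).1 + << p0 >> *+ (r + s.1).
pose BB (s : 'I_N * 'I_Q) := divx ffK (phi s.1 s.2).2 + << p0 >> *+ (r + (N - s.1)).
pose DD s := lift_div P1 (AA s) + lift_div P2 (BB s).
have effD s : effective (DD s).
  have [_ /(_ s.2)[n1 n2 l1 l2]] := hphi s.1.
  by apply: effectiveD; apply: effective_lift; apply: LL_effective.
have degn (k : nat) : ddeg kap (<< p0 >> *+ k) = (k * d)%N%:Z.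
  by rewrite raddfMn /= ddegU mul1r -mulr_natr natz mulrC PoszM.
have degA s : ddeg kap (AA s) = ((r + s.1) * d)%N%:Z.
  by rewrite /AA raddfD /= (ddeg_divx ffK) add0r degn.
have degB s : ddeg kap (BB s) = ((r + (N - s.1)) * d)%N%:Z.
  by rewrite /BB raddfD /= (ddeg_divx ffK) add0r degn.
have degD s : ddeg kL (DD s) = (M * d)%N%:Z.
  rewrite /DD raddfD /= !(ddeg_lift (kK := kap)) // degA degB.
  rewrite -PoszD -mulnDl /M; congr (_ * _)%N%:Z.
  by have : (s.1 < N)%N := ltn_ord s.1; clear; lia.
have degM : ddeg kL (<< P1 p0 >> *+ M) = (M * d)%N%:Z.
  by rewrite raddfMn /= ddegU deg1 mul1r -mulr_natr natz mulrC PoszM.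
have /choice[Ez hEz] s : exists Ez : divisor L * L, [/\ Ez.1 \in Es, Ez.2 != 0 &
    DD s - << P1 p0 >> *+ M = Ez.1 + divx ffL Ez.2].
  have [|E [z [h1 h2 h3]]] := hEs (DD s - << P1 p0 >> *+ M); last by exists (E, z).
  by rewrite raddfB /= degD degM subrr.
have sEs : (0 < size Es)%N.
  by have [|E [z [h _ _]]] := hEs 0; [rewrite raddf0|move: h; case: (Es)].
have ltE s : (index (Ez s).1 Es < size Es)%N by rewrite index_mem; case: (hEz s).
have [|e he] := @pigeonhole_fiber _ _ (fun s => Ordinal (ltE s)); first by rewrite card_ord.
pose B := (#|F| ^ (`|ddeg kL (<< P1 p0 >> *+ M + N0)%R| + c))%N.
have : (#|[set s | Ordinal (ltE s) == e]| <= B * #|F| ^ 2)%N.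
  apply: (@card_le_image _ _ (LL (<< P1 p0 >> *+ M + N0)) _ (fun s => (Ez s).2)).
  - move=> s _ R; have [hE z0 eD] := hEz s.
    rewrite smallE // -(coeff_divx ffL).
    have h0 : coeff R (DD s) - coeff R (<< P1 p0 >> *+ M) =
      coeff R (Ez s).1 + coeff R (divx ffL (Ez s).2) by rewrite -coeffB eD coeffD.
    have h1 : 0 <= coeff R N0 - coeff R (Ez s).1 by rewrite -coeffB; apply: hN0.
    have h2 := effD s R; rewrite coeffD; move: h0 h1 h2; clear.
    move: (coeff R (DD s)) (coeff R (Ez s).1) (coeff R (divx ffL _)) (coeff R N0).
    by move: (coeff R _) => e1 e2 e3 e4 e5; lia.
  - apply: hc; apply: effectiveD => // R; rewrite coeffMn mulrn_wge0 //; exact: effective_place.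
  move=> v; have [->|[s0]] := set_0Vmem [set s in [set s | Ordinal (ltE s) == e] | (Ez s).2 == v].
    by rewrite cards0.
  rewrite !inE => /andP[/eqP e0 /eqP v0]; set S := [set s in _ | _].
  have /choice[h hh] s : exists h : F * F, s \in S -> [/\ s.1 = s0.1,
      (phi s.1 s.2).1 = kap h.1 * (phi s0.1 s0.2).1 & (phi s.1 s.2).2 = kap h.2 * (phi s0.1 s0.2).2].
    have [sS|] := boolP (s \in S); last by exists (0, 0).
    move: sS; rewrite !inE => /andP[/eqP es /eqP vs].
    have eD : DD s = DD s0.
      have [h1 _ eDs] := hEz s; have [h2 _ eDs0] := hEz s0.
      apply: (addIr (- (<< P1 p0 >> *+ M))); rewrite eDs eDs0 vs v0; congr (_ + _).
      rewrite -(nth_index 0 h1) -(nth_index 0 h2); congr nth.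
      by have /(congr1 val) := etrans es (esym e0).
    have [eA eB] := lift2_inj eD.
    have e1 : s.1 = s0.1.
      apply: val_inj => /=; have := congr1 (ddeg kap) eA; rewrite !degA => -[] /eqP.
      by rewrite eqn_pmul2r // eqn_add2l => /eqP.
    have [_ /(_ s.2)[n1 n2 _ _]] := hphi s.1; have [_ /(_ s0.2)[n3 n4 _ _]] := hphi s0.1.
    have [c1 hc1] : exists c1, (phi s.1 s.2).1 / (phi s0.1 s0.2).1 = kap c1.
      apply: ord0_const => p; rewrite ord_div // -!(coeff_divx ffK).
      by have := congr1 (coeff p) eA; rewrite !coeffD e1 => /addIr ->; rewrite subrr.
    have [c2 hc2] : exists c2, (phi s.1 s.2).2 / (phi s0.1 s0.2).2 = kap c2.
      apply: ord0_const => p; rewrite ord_div // -!(coeff_divx ffK).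
      by have := congr1 (coeff p) eB; rewrite !coeffD e1 => /addIr ->; rewrite subrr.
    by exists (c1, c2) => _; rewrite /= -hc1 -hc2 !divfK.
  have -> : (#|F| ^ 2 = #|{: F * F}|)%N by rewrite card_prod.
  rewrite -[X in (_ <= X)%N]cardsT -(card_in_imset (f := h)).
    by apply: subset_leq_card; apply: subsetT.
  move=> s t /hh[s1 s2 s3] /hh[t1 t2 t3] est.
  have e1 : s.1 = t.1 by rewrite s1 t1.
  rewrite [s]surjective_pairing [t]surjective_pairing -e1; congr pair.
  have [jp _] := hphi s.1; apply: jp.
  rewrite [LHS]surjective_pairing [RHS]surjective_pairing; congr pair.
    by rewrite s2 [in RHS]e1 t2 est.
  by rewrite s3 [in RHS]e1 t3 est.
move=> hS; have := leq_trans he (leq_mul (leqnn _) hS).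
rewrite card_prod !card_ord /B raddfD /= degM.
have eN := ddeg_effective kL eN0.
have -> : (`|((M * d)%N%:Z + ddeg kL N0)%R| = M * d + `|ddeg kL N0|)%N by move: eN; clear; lia.
rewrite -expnD.
have -> : (M * d + `|ddeg kL N0| + c + 2 = (`|ddeg kL N0| + c + 2 * g + 4) + (M * d - 2 * g.+1))%N.
  have : (2 * g.+1 <= M * d)%N.
    by rewrite -[(2 * _)%N]muln1 leq_mul // /M /r; clear; lia.
  clear; lia.
rewrite expnD mulnA -/C -/Q leq_pmul2r; last by rewrite /Q expn_gt0 (ltnW q1).
by rewrite ltnn.
Qed.

End Counting.

Theorem square_of_local_squares x : (forall p, is_square_at p x) -> exists y, x = y ^+ 2.
Proof.
move=> hx; apply: contrapT => nsq.
have nsq' y : y ^+ 2 != x by apply/eqP => e; apply: nsq; exists y.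
have [L [iota [zeta [z2 coord]]]] := ex_quadratic_extension nsq'.
have ffL := ffield_extension coord ffK; have two0 := two_neq0 kap odd_char.
have /choice[P hP] p : exists P : place L * place L,
  [/\ P.1 != P.2, forall a, ord P.1 (iota a) = ord p a, forall a, ord P.2 (iota a) = ord p a,
      forall (y : L) N, exists a, small P.1 N (y - iota a) &
      forall (y : L) N, exists a, small P.2 N (y - iota a)].
  by have [P1 [P2 h]] := ex_split_places nsq' z2 coord two0 (hx p); exists (P1, P2).
have restr (p q : place K) (R : place L) : (forall a, ord R (iota a) = ord p a) ->
    (forall a, ord R (iota a) = ord q a) -> p = q.
  by move=> h1 h2; apply: placeP => a; rewrite -h1 h2.
apply: (@no_complete_splitting L _ ffL (fun p => (P p).1) (fun p => (P p).2)).
- move=> p q e; have [_ h _ _ _] := hP p; have [_ h' _ _ _] := hP q.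
  by apply: restr h _; rewrite e.
- move=> p q e; have [_ _ h _ _] := hP p; have [_ _ h' _ _] := hP q.
  by apply: restr h _; rewrite e.
- move=> p q; apply/eqP => e; have [ne h _ _ _] := hP p; have [_ _ h' _ _] := hP q.
  have epq : p = q by apply: restr h _; rewrite e.
  by subst q; rewrite e eqxx in ne.
- by move=> p; have [_ h _ h' _] := hP p; apply: degp_dense.
- by move=> p; have [_ _ h _ h'] := hP p; apply: degp_dense.
Qed.

End LocalGlobal.

(** * Symbols on the class group modulo 2 *)

Section ClassMaps.
Variable K : fieldType.

Lemma to_mod2_is_additive (V : zmodType) : {morph @to_mod2 V : x y / x - y}.
Proof. by move=> x y; rewrite -[RHS](raddfB \pi_(Quotient.quot (@twice V))). Qed.

HB.instance Definition _ (V : zmodType) :=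
  GRing.isZmodMorphism.Build V (mod2 V) (@to_mod2 V) (@to_mod2_is_additive V).

Lemma to_mod2_eq0 (V : zmodType) (x : V) : to_mod2 x = 0 <-> exists y, x = y *+ 2.
Proof.
rewrite -[0](raddf0 (@to_mod2 V)); split=> [/eqP|[y ->]].
  by rewrite -Quotient.idealrBE subr0 => /asboolP.
by apply/eqP; rewrite -Quotient.idealrBE subr0; apply/asboolP; exists y.
Qed.

Lemma to_mod2_surj (V : zmodType) (x : mod2 V) : exists y, x = to_mod2 y.
Proof. by exists (generic_quotient.repr x); rewrite /to_mod2 reprK. Qed.

Lemma scale_to_mod2 (V : zmodType) (c : 'F_2) (x : V) : c *: to_mod2 x = to_mod2 (x *+ c).
Proof. by rewrite raddfMn. Qed.

Lemma div_class_is_additive : {morph @div_class K : x y / x - y}.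
Proof. by move=> x y; rewrite -[RHS](raddfB \pi_(Quotient.quot (@principal K))). Qed.

HB.instance Definition _ :=
  GRing.isZmodMorphism.Build (divisor K) (Pic K) (@div_class K) div_class_is_additive.

Lemma div_class_surj (x : Pic K) : exists D, x = div_class D.
Proof. by exists (generic_quotient.repr x); rewrite /div_class reprK. Qed.

End ClassMaps.

Lemma bool_of_F2 (c : 'F_2) : c = (odd c)%:R.
Proof. by apply: val_inj; case: c => [[|[|m]] Hm]. Qed.

Lemma odd_absz_sum (I : Type) (r : seq I) (f : I -> int) :
  odd (absz (\sum_(i <- r) f i)) = \big[addb/false]_(i <- r) odd (absz (f i)).
Proof.
elim: r => [|i r IH]; first by rewrite !big_nil.
by rewrite !big_cons -IH; clear; move: (\sum_(j <- r) f j) (f i) => a b; lia.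
Qed.

Lemma odd_abszM (a b : int) : odd (absz (a * b)) = odd (absz a) && odd (absz b).
Proof. by rewrite abszM oddM. Qed.

Section ClassGroup.
Variables (F : finFieldType) (K : fieldType) (kap : {rmorphism F -> K}).
Hypotheses (ffK : ffield kap) (odd_char : (2%:R : F) != 0).
Hypothesis full_const : forall z, ~ transc kap z -> exists c, z = kap c.
Implicit Types (p : place K) (x y z : K) (D E : divisor K).

Lemma div_class_eq0 D : div_class D = 0 <-> exists2 y, y != 0 & D = divx ffK y.
Proof.
rewrite -[0](raddf0 (@div_class K)); split=> [/eqP|[y y0 ->]].
  rewrite -Quotient.idealrBE subr0 => /asboolP[y y0 hy]; exists y => //.
  by apply: divisorP => p; rewrite coeff_divx hy.
apply/eqP; rewrite -Quotient.idealrBE subr0; apply/asboolP; exists y => // p.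
exact: coeff_divx.
Qed.

Definition class2 D : mod2 (Pic K) := to_mod2 (div_class D).

Lemma class2_is_additive : {morph class2 : x y / x - y}.
Proof. by move=> x y; rewrite /class2 !raddfB. Qed.

HB.instance Definition _ :=
  GRing.isZmodMorphism.Build (divisor K) (mod2 (Pic K)) class2 class2_is_additive.

Lemma class2_eq0 D : class2 D = 0 <-> exists E y, y != 0 /\ D = E *+ 2 + divx ffK y.
Proof.
rewrite to_mod2_eq0; split=> [[c]|[E [y [y0 ->]]]].
  have [E ->] := div_class_surj c => /eqP; rewrite -raddfMn -subr_eq0 -raddfB => /eqP.
  by move/div_class_eq0 => [y y0 e]; exists E, y; split=> //; rewrite -e subrKC.
exists (div_class E); rewrite raddfD raddfMn /=.
by rewrite [X in _ + X](_ : _ = 0) ?addr0 //; apply/div_class_eq0; exists y.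
Qed.

Lemma class2_comb (I : finType) (b : I -> place K) (c : I -> 'F_2) :
  \sum_i c i *: place_class2 (b i) = class2 (\sum_i << (c i : nat)%:Z *g b i >>).
Proof.
rewrite raddf_sum; apply: eq_bigr => i _.
rewrite scale_to_mod2 -raddfMn; congr (to_mod2 (div_class _)).
by apply: divisorP => p; rewrite coeffMn !coeffU mul1r -[LHS]mulr_natl natz.
Qed.

(** An additive extension of the symbol to divisors, with integer values; its parity is the product
    of the symbols with multiplicity. *)
Definition symbol_sum x D : int := fglift (fun p => (nonsquare_at p x : nat)%:Z : int^o) D.

Arguments symbol_sum x D%_ring_scope.

Lemma symbol_sum_is_additive x : {morph symbol_sum x : D E / D - E}.
Proof. exact: (@lift_is_additive _ (place K) int^o). Qed.

HB.instance Definition _ x :=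
  GRing.isZmodMorphism.Build (divisor K) int (symbol_sum x) (symbol_sum_is_additive x).

Lemma symbol_sumU x k p : symbol_sum x << k *g p >> = k * (nonsquare_at p x : nat)%:Z.
Proof. by rewrite /symbol_sum liftU. Qed.

Lemma symbol_sum_principal x y : x != 0 -> even_divisor x ->
  odd (absz (symbol_sum x (divx ffK y))) = false.
Proof.
move=> x0 ex; have := reciprocity ffK odd_char y x0 ex.
have part z : odd (absz (symbol_sum x (zdiv ffK z))) =
    \big[addb/false]_(p <- zeros ffK z) (odd (absz (ord p z)) && nonsquare_at p x).
  rewrite /zdiv raddf_sum odd_absz_sum; apply: eq_bigr => p _.
  by rewrite /= symbol_sumU odd_abszM; case: (nonsquare_at p x).
rewrite big_cat /= -part.
under [X in _ (+) X]eq_bigr => p _.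
  rewrite (_ : odd (absz (ord p y)) = odd (absz (ord p y^-1))); last first.
    have [->|y0] := eqVneq y 0; first by rewrite invr0.
    by rewrite ordV // abszN.
  over.
rewrite -part /divx -lock raddfB /= => <-; clear.
by move: (symbol_sum _ _) (symbol_sum _ _) => a b; lia.
Qed.

Lemma symbol_sum_class2 x D : x != 0 -> even_divisor x -> class2 D = 0 ->
  odd (absz (symbol_sum x D)) = false.
Proof.
move=> x0 ex /class2_eq0[E [y [y0 ->]]]; have := symbol_sum_principal y x0 ex.
rewrite raddfD /= raddfMn /=; clear; rewrite mulr2n.
by move: (symbol_sum _ _) (symbol_sum _ _) => a b; lia.
Qed.

Lemma symbol_of_combination x p (I : finType) (b : I -> place K) (c : I -> 'F_2) :
  x != 0 -> even_divisor x -> place_class2 p = \sum_i c i *: place_class2 (b i) ->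
  nonsquare_at p x = \big[addb/false]_i (odd (c i) && nonsquare_at (b i) x).
Proof.
move=> x0 ex; rewrite class2_comb => /eqP; rewrite -subr_eq0.
rewrite -[place_class2 p]/(class2 << p >>) -raddfB => /eqP/(symbol_sum_class2 x0 ex).
rewrite raddfB /= raddf_sum /= symbol_sumU mul1r.
under eq_bigr do rewrite symbol_sumU.
have : odd (absz (\sum_i (c i : nat)%:Z * (nonsquare_at (b i) x : nat)%:Z)) =
    \big[addb/false]_i (odd (c i) && nonsquare_at (b i) x).
  by rewrite odd_absz_sum; apply: eq_bigr => i _; rewrite odd_abszM; case: (nonsquare_at _ x).
move=> <-; clear; move: (\sum_i _) => a; case: (nonsquare_at p x) => /=; lia.
Qed.

Lemma square_of_symbols n (b : 'I_n -> place K) x : x != 0 -> even_divisor x ->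
  (forall p, exists c : 'I_n -> 'F_2, place_class2 p = \sum_i c i *: place_class2 (b i)) ->
  (forall i, nonsquare_at (b i) x = false) -> exists y, x = y ^+ 2.
Proof.
move=> x0 ex hb hx; apply: (square_of_local_squares ffK odd_char full_const) => p.
have [c hc] := hb p; have := symbol_of_combination x0 ex hc.
rewrite big1 => [|i _]; last by rewrite hx andbF.
by move/negbFE/asboolP.
Qed.

Definition pic_deg (c : Pic K) : int := ddeg kap (generic_quotient.repr c).

Lemma pic_degE D : pic_deg (div_class D) = ddeg kap D.
Proof.
have : div_class (generic_quotient.repr (div_class D) - D) = 0.
  by rewrite raddfB /= {1}/div_class reprK subrr.
move/div_class_eq0 => [y _ e].
by rewrite /pic_deg -[X in ddeg kap X = _](subrK D) e raddfD /= (ddeg_divx ffK) add0r.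
Qed.

Lemma pic_degB a b : pic_deg (a - b) = pic_deg a - pic_deg b.
Proof.
have [D ->] := div_class_surj a; have [E ->] := div_class_surj b.
by rewrite -raddfB !pic_degE raddfB.
Qed.

(** [D1] has the least positive degree; subtracting a multiple of it brings any divisor to degree
    0. *)
Lemma ex_degree_generator : exists2 D1, 0 < ddeg kap D1 &
  forall D, exists k : int, ddeg kap D = ddeg kap D1 * k.
Proof.
have [p0] := ex_place ffK.
have ex : exists n, `[< (0 < n)%N /\ exists D, ddeg kap D = n%:Z >].
  exists (degp kap p0); apply/asboolP; split; first exact: degp_gt0.
  by exists << p0 >>; rewrite ddegU mul1r.
case: (ex_minnP ex) => n /asboolP[n0 [D1 dD1]] nmin; exists D1; rewrite dD1 //.
move=> D; exists (ddeg kap D %/ n)%Z; rewrite mulrC.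
have e := divz_eq (ddeg kap D) n; rewrite {1}e.
suff -> : (ddeg kap D %% n)%Z = 0 by rewrite addr0.
have [k hk] : exists k : nat, (ddeg kap D %% n)%Z = k%:Z.
  by exists `|(ddeg kap D %% n)%Z|%N; rewrite gez0_abs // modz_ge0 // eqz_nat -lt0n.
rewrite hk; case: k hk => // k hk; exfalso.
have : (ddeg kap D %% n)%Z < n by rewrite ltz_pmod // ltz_nat.
rewrite hk ltz_nat ltnNge => /negP; apply; apply: nmin; apply/asboolP; split=> //.
exists (D - D1 *~ (ddeg kap D %/ n)%Z).
apply/eqP; rewrite raddfB raddfMz /= dD1 mulrzz subr_eq addrC mulrC -hk.
exact/eqP.
Qed.

Lemma finite_pic0 : exists Gs : seq (Pic K), forall c, (c \in Gs) = (pic_deg c == 0).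
Proof.
have [Es hEs] := finite_class_number ffK.
exists [seq div_class E | E <- Es & ddeg kap E == 0] => c.
apply/mapP/idP => [[E]|/eqP]; first by rewrite mem_filter => /andP[/eqP dE _] ->; rewrite pic_degE dE.
have [D ->] := div_class_surj c; rewrite pic_degE => dD.
have [E [z [hE z0 eD]]] := hEs D dD; exists E.
  rewrite mem_filter hE andbT; apply/eqP.
  by move: dD; rewrite eD raddfD /= ddeg_divx addr0.
rewrite eD raddfD /= [X in _ + X](_ : _ = 0) ?addr0 //.
by apply/div_class_eq0; exists z.
Qed.

End ClassGroup.

(** * Elements with even divisor and prescribed symbols *)

Section EvenElements.
Variables (F : finFieldType) (K : fieldType) (kap : {rmorphism F -> K}).
Hypotheses (ffK : ffield kap) (odd_char : (2%:R : F) != 0).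
Hypothesis full_const : forall z, ~ transc kap z -> exists c, z = kap c.
Implicit Types (p : place K) (x y z : K) (D E : divisor K).

(** If squaring were onto it would be injective, but 1 and -1 have the same square. *)
Lemma ex_nonsquare : exists c : F, c != 0 /\ forall d, d ^+ 2 != c.
Proof.
apply: contrapT => none.
have /choice[g hg] c : exists d : F, d ^+ 2 = c.
  have [->|c0] := eqVneq c 0; first by exists 0; rewrite expr0n.
  by apply: contrapT => h; apply: none; exists c; split=> // d; apply/eqP => e; apply: h; exists d.
have ig : injective g by move=> c d e; rewrite -(hg c) e hg.
have /codomP[c1 e1] := injF_onto ig 1; have /codomP[c2 e2] := injF_onto ig (-1).
have : c1 = c2 by rewrite -(hg c1) -(hg c2) -e1 -e2 sqrrN.
move=> ec; move: odd_char; rewrite -[2%:R]/(1 + 1) {1}e1 ec -e2 addNr.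
by rewrite eqxx.
Qed.

Lemma nonsquare_atM_even p x y : x != 0 -> y != 0 -> (2 %| ord p x)%Z -> (2 %| ord p y)%Z ->
  nonsquare_at p (x * y) = nonsquare_at p x (+) nonsquare_at p y.
Proof.
have [pi pi0 opi] := ord_uniformizer p.
have norm z : z != 0 -> (2 %| ord p z)%Z -> exists m, m != 0 /\ is_unit p (z * m ^+ 2).
  move=> z0 /divzK ez; exists (pi ^ (- (ord p z %/ 2)%Z)); rewrite expfz_neq0 //; split=> //.
  rewrite /is_unit mulf_neq0 ?expf_neq0 ?expfz_neq0 //= ordM ?expf_neq0 ?expfz_neq0 //.
  by rewrite ordX ?expfz_neq0 // ordXz // opi mul1r -{1}ez; apply/eqP; ring.
move=> x0 y0 /(norm _ x0)[m [m0 um]] /(norm _ y0)[k [k0 uk]].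
rewrite -(nonsquare_atMsq p x m0) -(nonsquare_atMsq p y k0) -(nonsquare_atM ffK odd_char um uk).
rewrite -(nonsquare_atMsq p (x * y) (mulf_neq0 m0 k0)); congr nonsquare_at; ring.
Qed.

Section Independent.
Variables (n : nat) (b : 'I_n -> place K).
Hypothesis indep : lin_indep (fun i => place_class2 (b i)).
Hypothesis spanning : forall p, exists c : 'I_n -> 'F_2,
  place_class2 p = \sum_i c i *: place_class2 (b i).

Let pick (e : {ffun 'I_n -> bool}) : divisor K := \sum_i << (e i : nat)%:Z *g b i >>.

Lemma class2_pick_inj e e' : class2 (pick e - pick e') = 0 -> e = e'.
Proof.
have val_b (a : bool) : nat_of_ord (a%:R : 'F_2) = a by case: a.
have pickE a : class2 (pick a) = \sum_i (a i)%:R *: place_class2 (b i).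
  by rewrite class2_comb; congr class2; apply: eq_bigr => i _; rewrite val_b.
rewrite raddfB /= !pickE -sumrB => h.
have := indep (c := fun i => (e i)%:R - (e' i)%:R); rewrite (eq_bigr _ (fun i _ => scalerBl _ _ _)).
move=> /(_ h) ee; apply/ffunP => i; have /eqP := ee i; rewrite subr_eq0.
by move/eqP/(congr1 (@nat_of_ord _)); rewrite !val_b; case: (e i) (e' i) => [] [].
Qed.

Section Torsion.
Variable Gs : seq (Pic K).
Hypothesis hGs : forall c, (c \in Gs) = (pic_deg kap c == 0).

Definition torsion2 : {set seq_sub Gs} := [set u | ssval u *+ 2 == 0].

Lemma pic0B a c : a \in Gs -> c \in Gs -> a - c \in Gs.
Proof. by rewrite !hGs (pic_degB ffK) => /eqP -> /eqP ->; rewrite subrr. Qed.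

(** A subset [e] of the [b i] is shifted to degree 0 by [k e] times [D1]. Send [(e, u)] to the class
    [pe e] plus twice [u], together with the parity of [k e]. The image determines [e], since equal
    parities make [D1] disappear modulo 2, and then [u] up to 2-torsion. Comparing sizes, 2^n #Pic^0
    <= 2 #Pic^0 #Pic^0[2]. *)
Lemma card_torsion2 : (2 ^ n <= 2 * #|torsion2|)%N.
Proof.
have G0 : 0 \in Gs by rewrite hGs -(raddf0 (@div_class K)) (pic_degE ffK) raddf0.
have GD a c : a \in Gs -> c \in Gs -> a + c \in Gs.
  by move=> ha hc; rewrite -[c]opprK; apply: pic0B => //; rewrite -sub0r; apply: pic0B.
have [D1 d1 hD1] := ex_degree_generator ffK.
have /choice[k hk] (e : {ffun 'I_n -> bool}) : exists k, ddeg kap (pick e) = ddeg kap D1 * k.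
  exact: hD1.
pose pe e := div_class (pick e - D1 *~ k e).
have peG e : pe e \in Gs.
  by rewrite hGs (pic_degE ffK) raddfB raddfMz /= hk mulrzz subrr.
have shiftG e (u : seq_sub Gs) : pe e + ssval u *+ 2 \in Gs.
  by rewrite mulr2n; apply: (GD _ _ (peG e)); apply: GD; apply: ssvalP.
pose Phi (s : {ffun 'I_n -> bool} * seq_sub Gs) := (SeqSub (shiftG s.1 s.2), odd (absz (k s.1))).
have fib t : (#|[set s | Phi s == t]| <= #|torsion2|)%N.
  have [->|[s0]] := set_0Vmem [set s | Phi s == t]; first by rewrite cards0.
  rewrite inE => /eqP es0.
  have same s : Phi s = t -> s.1 = s0.1 /\ ssval s.2 *+ 2 = ssval s0.2 *+ 2.
    move=> es; have [e1 e2] : pe s.1 + ssval s.2 *+ 2 = pe s0.1 + ssval s0.2 *+ 2 /\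
        odd (absz (k s.1)) = odd (absz (k s0.1)).
      have e : Phi s = Phi s0 by rewrite es es0.
      by split; [exact: (congr1 (fun r : seq_sub Gs * bool => ssval r.1) e)|exact: (congr1 (fun r : seq_sub Gs * bool => r.2) e)].
    have [m hm] : exists m : int, k s.1 - k s0.1 = m * 2.
      by apply/dvdzP; move: e2; rewrite /Phi /=; clear; move: (k _) (k _) => u v; lia.
    have ee : s.1 = s0.1.
      apply: class2_pick_inj; rewrite /class2 to_mod2_eq0.
      exists (ssval s0.2 - ssval s.2 + div_class D1 *~ m).
      have -> : div_class (pick s.1 - pick s0.1) =
          pe s.1 - pe s0.1 + div_class D1 *~ (k s.1 - k s0.1).
        rewrite /pe -raddfB -raddfMz -raddfD; congr div_class.
        by rewrite mulrzBr addrAC subrKA opprB subrKA.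
      rewrite hm.
      have -> : pe s.1 = pe s0.1 + ssval s0.2 *+ 2 - ssval s.2 *+ 2 by rewrite -e1 addrK.
      rewrite mulrzA -[_ *~ 2]/(_ *+ 2) mulrnDl mulrnBl.
      by congr (_ + _); rewrite addrAC [pe s0.1 + _]addrC addrK.
    by split=> //; move: e1; rewrite ee => /addrI.
  have diffG (s : {ffun 'I_n -> bool} * seq_sub Gs) : ssval s.2 - ssval s0.2 \in Gs.
    by apply: pic0B; apply: ssvalP.
  rewrite -(card_in_imset (f := fun s => SeqSub (diffG s))); last first.
    move=> s s'; rewrite !inE => /eqP/same[e1 _] /eqP/same[e1' _] /(congr1 (@ssval _ _)) /= /addIr e2.
    rewrite [s]surjective_pairing [s']surjective_pairing e1 e1'; congr pair.
    exact: val_inj.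
  apply/subset_leq_card/subsetP => u /imsetP[s]; rewrite inE => /eqP/same[_ e] ->.
  by rewrite inE /= mulrnBl e subrr.
have := card_le_fibers fib; rewrite !card_prod card_ffun card_bool card_ord.
have T0 : (0 < #|{: seq_sub Gs}|)%N by apply/card_gt0P; exists (SeqSub G0).
by rewrite mulnC -mulnA leq_pmul2l.
Qed.

End Torsion.

(** A 2-torsion class gives [l] whose divisor is twice a divisor; with the extra factor 1 or a
    nonsquare constant, this yields at least 2^n even elements. Their vectors of symbols are
    distinct because an even element with trivial symbols is a square, so every vector occurs. *)
Theorem ex_even_element (v : {ffun 'I_n -> bool}) : exists x, [/\ x != 0, even_divisor x &
  forall i, nonsquare_at (b i) x = v i].
Proof.
have [Gs hGs] := finite_pic0 ffK; have [c [c0 hc]] := ex_nonsquare.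
have kc0 : kap c != 0 by rewrite fmorph_eq0.
pose T := {u : seq_sub Gs | u \in torsion2 Gs}.
have /choice[l hl] (u : T) : exists l, l != 0 /\
    generic_quotient.repr (ssval (val u)) *+ 2 = divx ffK l.
  have := valP u; rewrite inE => /eqP e.
  have [|y y0 ey] := (div_class_eq0 ffK (generic_quotient.repr (ssval (val u)) *+ 2)).1.
    by rewrite raddfMn /= /div_class reprK.
  by exists y.
have ol p u : ord p (l u) = coeff p (generic_quotient.repr (ssval (val u))) * 2.
  by rewrite -(coeff_divx ffK) -(proj2 (hl u)) coeffMn mulr2n; clear; lia.
pose f (s : bool * T) := (if s.1 then kap c else 1) * l s.2.
have f0 s : f s != 0 by rewrite mulf_neq0 ?(proj1 (hl _)) //; case: s.1; rewrite ?oner_neq0.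
have of_ p s : ord p (f s) = coeff p (generic_quotient.repr (ssval (val s.2))) * 2.
  rewrite /f ordM ?(proj1 (hl _)) ?ol //; last by case: s.1; rewrite ?oner_neq0.
  by case: s.1; rewrite ?ord1 ?(ord_kap kap) // add0r.
have ef s : even_divisor (f s) by move=> p; rewrite of_ dvdz_mull.
pose g s : {ffun 'I_n -> bool} := [ffun i => nonsquare_at (b i) (f s)].
suff ig : injective g.
  have : v \in codom g.
    apply: inj_card_onto => //; rewrite card_prod card_bool card_sig card_ffun card_bool card_ord.
    exact: card_torsion2.
  by case/codomP => s ->; exists (f s); split=> // i; rewrite ffunE.
move=> s s' e.
have [y ey] : exists y, f s * f s' = y ^+ 2.
  apply: (square_of_symbols ffK odd_char full_const (b := b)) => //; first exact: mulf_neq0.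
    by move=> p; rewrite ordM //; apply: rpredD; apply: ef.
  move=> i; have /ffunP/(_ i) := e; rewrite !ffunE => ei.
  by rewrite (nonsquare_atM_even (f0 s) (f0 s') (ef s _) (ef s' _)) ei addbb.
have y0 : y != 0.
  have := mulf_neq0 (f0 s) (f0 s'); rewrite ey; apply: contra_neq => ->; exact: expr0n.
have e2 : s.2 = s'.2.
  apply: val_inj; apply: val_inj => /=.
  have tor (u : T) : ssval (val u) *+ 2 = 0 by have := valP u; rewrite inE => /eqP.
  have -> : ssval (val s'.2) = - ssval (val s'.2).
    by apply/eqP; rewrite -subr_eq0 opprK -mulr2n tor.
  apply/eqP; rewrite -subr_eq0 opprK; apply/eqP.
  rewrite -[ssval (val s.2)]reprK -[ssval (val s'.2)]reprK -raddfD.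
  apply/(div_class_eq0 ffK); exists y => //; apply: divisorP => p.
  have := ordM p (f0 s) (f0 s'); rewrite ey ordX // !of_ coeffD coeff_divx; clear.
  by move: (coeff p _) (coeff p _) (ord p y) => a d z; lia.
suff e1 : s.1 = s'.1 by rewrite [s]surjective_pairing [s']surjective_pairing e1 e2.
have l0 := proj1 (hl s'.2).
(* With equal torsion parts and different constants, [c] would be the square of an element of order
   0 everywhere, which is a constant. *)
case: (boolP s.1) (boolP s'.1) => h [] h'; rewrite ?h ?h' ?(negbTE h) ?(negbTE h') //; exfalso.
- have em : kap c = (y / l s'.2) ^+ 2.
    by rewrite expr_div_n -ey /f h (negbTE h') e2 mul1r; field.
  have [d hd] : exists d, y / l s'.2 = kap d.
    apply: (ord0_const ffK full_const) => p; have := congr1 (ord p) em.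
    rewrite (ord_kap kap) // ordX ?mulf_neq0 ?invr_eq0 // => /esym/eqP.
    by rewrite mulrn_eq0 => /eqP.
  by have := hc d; rewrite -(inj_eq (fmorph_inj kap)) rmorphXn /= -hd -em eqxx.
- have em : kap c = (y / l s'.2) ^+ 2.
    by rewrite expr_div_n -ey /f (negbTE h) h' e2 mul1r; field.
  have [d hd] : exists d, y / l s'.2 = kap d.
    apply: (ord0_const ffK full_const) => p; have := congr1 (ord p) em.
    rewrite (ord_kap kap) // ordX ?mulf_neq0 ?invr_eq0 // => /esym/eqP.
    by rewrite mulrn_eq0 => /eqP.
  by have := hc d; rewrite -(inj_eq (fmorph_inj kap)) rmorphXn /= -hd -em eqxx.
Qed.

End Independent.
End EvenElements.

Lemma extend_along_injection (I : finType) (T : eqType) (R : Type) (f : I -> T) (c : I -> R) (r0 : R) :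
  injective f -> exists c' : T -> R, forall i, c' (f i) = c i.
Proof.
move=> jf; exists (fun x => if [pick i | f i == x] is Some i then c i else r0) => i.
by case: pickP => [j /eqP/jf -> //|/(_ i)]; rewrite eqxx.
Qed.

(** * Maximal independent subsets of a finite set *)

Section IndependentSubsets.
Local Open Scope fset_scope.
Variables (F : fieldType) (V : lmodType F) (I : choiceType) (v : I -> V).
Implicit Types A B S : {fset I}.

Definition fset_indep A := lin_indep (fun s : A => v (val s)).

Lemma fset_indepP A : fset_indep A <->
  forall c : I -> F, \sum_(i <- A) c i *: v i = 0 -> forall i, i \in A -> c i = 0.
Proof.
split=> [h c|h c e i].
  rewrite big_seq_fsetE /= => e i iA; exact: (h (fun s => c (val s)) e [` iA]).
have [c' hc'] := extend_along_injection c 0 (@val_inj _ _ A).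
rewrite -hc'; apply: h; last exact: valP.
by rewrite big_seq_fsetE /= -[RHS]e; apply: eq_bigr => j _; rewrite -hc'.
Qed.

Lemma span_of_dependent A p : fset_indep A -> p \notin A -> ~ fset_indep (p |` A) ->
  exists c : A -> F, v p = \sum_(s : A) c s *: v (val s).
Proof.
move=> /fset_indepP hA pA hp.
have [c [hc cp]] : exists c : I -> F, \sum_(i <- p |` A) c i *: v i = 0 /\ c p != 0.
  apply: contrapT => none; apply/hp/fset_indepP => c hc.
  have cp : c p = 0 by apply/eqP; apply: contrapT => /negP cp; apply: none; exists c.
  move: hc; rewrite big_fsetU1 //= cp scale0r add0r => /hA hc i.
  by rewrite !inE => /orP[/eqP->|/hc].
exists (fun s => - ((c p)^-1 * c (val s))).
move: hc; rewrite big_fsetU1 //= => /eqP; rewrite addr_eq0 => /eqP e.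
rewrite -[LHS](scalerK cp) e big_seq_fsetE /= scalerN scaler_sumr -sumrN.
by apply: eq_bigr => s _; rewrite scalerA scaleNr.
Qed.

(** Specializes to [max_lin_indep] of the procedure when [v] is [place_class2]. *)
Definition max_indep S A := [/\ A `<=` S, fset_indep A &
  forall B, A `<=` B -> B `<=` S -> fset_indep B -> B = A].

Lemma ex_max_indep S : exists A, max_indep S A.
Proof.
pose P n := exists A, [/\ A `<=` S, fset_indep A & #|` A| = n].
have [||n [A [AS hA nA]] nmax] := @ex_max_nat P #|` S|.
- exists 0%N, fset0; split; rewrite ?fsub0set ?cardfs0 //.
  by apply/fset_indepP => c _ i; rewrite inE.
- by move=> n [A [AS _ <-]]; apply: fsubset_leq_card.
exists A; split=> // B AB BS hB; apply/eqP; rewrite eq_sym eqEfcard AB nA /=.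
by apply: nmax; exists B.
Qed.

Lemma max_indep_span S A p : max_indep S A -> p \in S ->
  exists c : A -> F, v p = \sum_(s : A) c s *: v (val s).
Proof.
move=> [AS hA mA] pS; have [pA|pA] := boolP (p \in A).
  exists (fun s => (s == [` pA])%:R); rewrite (bigD1 [` pA]) //= eqxx scale1r big1 ?addr0 // => s.
  by move/negbTE => ->; rewrite scale0r.
apply: span_of_dependent => // hp; move/negP: pA; apply.
rewrite -(mA (p |` A)) ?fsetU11 ?fsubsetUr // fsubUset AS andbT.
by rewrite fsub1set.
Qed.

End IndependentSubsets.

(** * Generating places *)

Section GeneratingPlaces.
Variables (F : finFieldType) (K : fieldType) (kap : {rmorphism F -> K}).
Hypothesis ffK : ffield kap.
Variable S : {fset place K}.
Implicit Types (p : place K) (D E : divisor K).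

(** Weak approximation provides a function whose orders on [S] are opposite to the coefficients of
    [D]. *)
Lemma move_support D : exists D', div_class D' = div_class D /\ forall p, p \in S -> coeff p D' = 0.
Proof.
have [z z0 hz] := ex_ord_prescribed (fun p => - coeff p D) (fset_uniq S).
exists (D + divx ffK z); split.
  rewrite raddfD /= [X in _ + X](_ : _ = 0) ?addr0 //; apply/(div_class_eq0 ffK).
  by exists z.
by move=> p pS; rewrite coeffD coeff_divx hz // subrr.
Qed.

(** The class group is generated by [D1] and finitely many divisors that represent all classes of
    degree 0; moved off [S], they have their supports in [Pl]. *)
Lemma ex_finite_support : exists Pl : {fset place K}, (forall p, p \in Pl -> p \notin S) /\
  forall c : Pic K, exists D, c = div_class D /\ forall p, p \notin Pl -> coeff p D = 0.
Proof.
have [D1 d1 hD1] := ex_degree_generator ffK; have [Es hEs] := finite_class_number ffK.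
have /choice[mv hmv] := move_support.
pose Ds := [seq mv D | D <- D1 :: Es].
exists [fset p in flatten [seq dom D | D <- Ds]]%fset; split.
  move=> p; rewrite in_fset => /flattenP[s /mapP[D hD ->]]; rewrite mem_dom.
  move: hD => /mapP[D' _ ->]; apply: contraNN => pS.
  by rewrite (proj2 (hmv D')).
have out D p : D \in D1 :: Es -> p \notin [fset p in flatten [seq dom D | D <- Ds]]%fset ->
    coeff p (mv D) = 0.
  move=> hD; rewrite in_fset => hp; apply: coeff_outdom; apply: contra hp => hp.
  by apply/flattenP; exists (dom (mv D)) => //; apply/map_f/map_f.
move=> c; have [D ->] := div_class_surj c; have [k hk] := hD1 D.
have [|E [z [hE z0 eD]]] := hEs (D - D1 *~ k).
  by rewrite raddfB raddfMz /= hk mulrzz subrr.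
exists (mv E + mv D1 *~ k); split.
  rewrite raddfD raddfMz /= !(proj1 (hmv _)) -raddfMz -raddfD -[D](subrK (D1 *~ k)) eD.
  rewrite !raddfD /= [X in _ + X + _](_ : _ = 0) ?addr0 //; apply/(div_class_eq0 ffK).
  by exists z.
move=> p hp; rewrite coeffD raddfMz /= !out ?mem_head ?mul0rz ?addr0 //.
by rewrite inE hE orbT.
Qed.

(** [B] is a maximal subset of [Pl] that is independent modulo 2, and the remaining places of [Pl]
    serve as B'. Since [Pl] generates the class group, maximality makes [B] a basis modulo 2. *)
Lemma ex_generating_places : exists b : places K, generating_places S b.
Proof.
have [Pl [PlS hPl]] := ex_finite_support.
have sumPl D : (forall p, p \notin Pl -> coeff p D = 0) ->
    D = \sum_(p <- Pl) << coeff p D *g p >>.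
  move=> hD; apply: divisorP => p; rewrite coeff_sumU ?fset_uniq //.
  by case: ifPn => // /hD.
have [B mB] := ex_max_indep (@place_class2 K) Pl; have [BPl iB _] := mB.
pose tB := in_tuple (enum_fset B); pose tC := in_tuple (enum_fset (Pl `\` B)%fset).
have jB : injective (tnth tB) by apply/tuple_uniqP; apply: fset_uniq.
have jC : injective (tnth tC) by apply/tuple_uniqP; apply: fset_uniq.
have mtB i : tnth tB i \in B by apply: mem_tnth.
have mtC i : tnth tC i \in (Pl `\` B)%fset by apply: mem_tnth.
pose f (i : 'I_(size B + size (Pl `\` B)%fset)) :=
  match fintype.split i with inl j => tnth tB j | inr j => tnth tC j end.
have fl j : f (lshift _ j) = tnth tB j.
  by rewrite /f; case: split_ordP => k => [/lshift_inj ->|/eqP] //; rewrite eq_lrshift.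
have fr j : f (rshift _ j) = tnth tC j.
  by rewrite /f; case: split_ordP => k => [/eqP|/rshift_inj ->] //; rewrite eq_rlshift.
have fPl i : f i \in Pl.
  rewrite /f; case: fintype.split => j; first by apply: (fsubsetP BPl); apply: mtB.
  by have := mtC j; rewrite inE => /andP[].
have sumf (V : zmodType) (g : place K -> V) : \sum_(p <- Pl) g p = \sum_i g (f i).
  rewrite big_split_ord /=.
  under [X in _ = X + _]eq_bigr do rewrite fl; under [X in _ = _ + X]eq_bigr do rewrite fr.
  rewrite -(big_tnth _ _ (enum_fset B) xpredT g) -(big_tnth _ _ (enum_fset (Pl `\` B)%fset) xpredT g).
  rewrite (big_fsetID _ (mem B)) /=; congr (_ + _); apply: eq_fbigl => p; rewrite !inE.
    by apply/andP/idP => [[]//|pB]; split=> //; apply: (fsubsetP BPl).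
  by rewrite andbC.
exists (Places f); split.
- move=> i j; rewrite /= -(splitK i) -(splitK j).
  case: (fintype.split i) (fintype.split j) => a [] c /=; rewrite ?fl ?fr.
  + by move/jB ->.
  + by move=> e; have := mtC c; rewrite inE -e mtB.
  + by move=> e; have := mtC a; rewrite inE e mtB.
  + by move/jC ->.
- by move=> i; apply: PlS; apply: fPl.
- split=> //.
    move=> c e; have [c' hc'] := extend_along_injection c 0 jB.
    move=> i; rewrite -hc'; move/fset_indepP: iB; apply; last exact: mtB.
    rewrite (big_tnth _ _ (enum_fset B)) -[RHS]e; apply: eq_bigr => j _.
    by rewrite -/tB hc' /placeB /= fl.
  move=> x _; have [y ->] := to_mod2_surj x; have [D [-> hD]] := hPl y.
  have spanB p : p \in Pl -> exists c : 'I_(size B) -> 'F_2,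
      place_class2 p = \sum_i c i *: place_class2 (tnth tB i).
    move=> pPl; have [c ->] := max_indep_span mB pPl.
    have [c' hc'] := extend_along_injection c 0 (@val_inj _ _ B).
    exists (fun i => c' (tnth tB i)).
    rewrite -(big_tnth _ _ (enum_fset B) xpredT (fun p => c' p *: place_class2 p)).
    by rewrite big_seq_fsetE /=; apply: eq_bigr => s _; rewrite hc'.
  have /choice[c hc] i := spanB _ (fPl i).
  exists (fun j => \sum_i (coeff (f i) D)%:~R * c i j).
  rewrite {1}(sumPl D hD) sumf !raddf_sum /=.
  under [RHS]eq_bigr do rewrite scaler_suml.
  rewrite exchange_big /=; apply: eq_bigr => i _.
  under [RHS]eq_bigr do rewrite -scalerA /placeB /= fl.
  rewrite -scaler_sumr -hc scaler_int -raddfMz -raddfMz; congr (to_mod2 (div_class _)).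
  by apply: divisorP => p; rewrite raddfMz /= !coeffU mul1r -mulrzr intz mulrC.
- move=> x; have [D [-> hD]] := hPl x; exists (fun i => coeff (f i) D).
  rewrite {1}(sumPl D hD) sumf raddf_sum; apply: eq_bigr => i _ /=.
  rewrite -raddfMz; congr (div_class _).
  by apply: divisorP => p; rewrite raddfMz /= !coeffU mul1r -mulrzr intz mulrC.
Qed.

End GeneratingPlaces.

Lemma mul_denominator (R : idomainType) (r : {ratio R}) :
  FracField.mul (\pi_(FracField.type R) r) (FracField.tofrac r.2) = FracField.tofrac r.1.
Proof.
unlock FracField.tofrac; rewrite -FracField.pi_mul; apply/eqmodP; rewrite /= FracField.equivfE /FracField.mulf.
by rewrite !numden_Ratio ?mulf_neq0 ?oner_neq0 ?denom_ratioP // !mulr1 mulrC.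
Qed.

(** * The steps of the procedure *)

Section FunctionFieldOfExtension.
Variables (F : finFieldType) (K : fieldExtType {fraction {poly F}}).

Definition kconst : {rmorphism F -> K} := in_alg K \o (@FracField.tofrac {poly F} \o polyC).

Lemma kconstE c : const K c = kconst c.
Proof. by []. Qed.

Let embed (a : {poly F}) : K := in_alg K (FracField.tofrac a).

Lemma embedE a : pev kconst (embed 'X) a = embed a.
Proof.
rewrite pevE -[in RHS](coefK a) poly_def /embed !rmorph_sum.
by apply: eq_bigr => i _; rewrite -mul_polyC !rmorphM !rmorphXn.
Qed.

Lemma embed_eq0 a : (embed a == 0) = (a == 0).
Proof. by rewrite fmorph_eq0 tofrac_eq0. Qed.

Lemma embed_quotient (z : {fraction {poly F}}) : exists a b : {poly F}, b != 0 /\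
  in_alg K z = embed a / embed b.
Proof.
pose r := generic_quotient.repr z; exists r.1, r.2; have d0 := denom_ratioP r; split=> //.
rewrite /embed -fmorph_div; congr (in_alg K _); apply/eqP.
have d0' : FracField.tofrac r.2 != 0 by rewrite tofrac_eq0.
rewrite -(can2_eq (mulfK d0') (mulfVK d0')) -[z]reprK -/r; apply/eqP.
exact: mul_denominator.
Qed.

Lemma ffield_of_fieldExt : ffield kconst.
Proof.
exists (embed 'X), (\dim {:K}), (fun i => tnth (vbasis {:K}) i); split.
  by move=> a; rewrite embedE => /eqP; rewrite embed_eq0 => /eqP.
move=> z; have := coord_vbasis (memvf z).
have hc i : ratf kconst (embed 'X) (in_alg K (coord (vbasis {:K}) i z)).
  have [a [b [b0 e]]] := embed_quotient (coord (vbasis {:K}) i z).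
  by exists a, b; rewrite !embedE embed_eq0.
have [b [a [b0 ha]]] := common_denominator hc => e.
exists b, a; split=> //; rewrite {1}e mulr_sumr; apply: eq_bigr => i _.
by rewrite -ha -mulrA -mulr_algl (tnth_nth 0).
Qed.

Lemma const_of_algebraic (z : K) : full_constant_field K -> ~ transc kconst z ->
  exists c, z = kconst c.
Proof.
move=> full ntr; apply: full; apply: contrapT => nalg; apply: ntr => a ea.
apply/eqP; apply: contrapT => /negP a0; apply: nalg; exists a => //.
exact/eqP.
Qed.

Lemma odd_char_base (p : nat) : p \in [pchar K] -> odd p -> (2%:R : F) != 0.
Proof.
move=> /andP[pp /eqP pK] op; apply/eqP => e.
have : (2 %:R : K) = 0 by rewrite -(rmorph_nat kconst) e rmorph0.
move=> e2; have := pK; rewrite -[p]odd_double_half op natrD -mul2n natrM e2 mul0r addr0.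
by move/eqP; rewrite oner_eq0.
Qed.

End FunctionFieldOfExtension.

(** Used with [P] everything for the parity of an order, and with [P] the elements of even order for
    the symbol, where it is additive. *)
Lemma xor_combination (V : zmodType) (P : V -> Prop) (phi : V -> bool) : P 0 -> phi 0 = false ->
  (forall a b, P a -> P b -> P (a + b) /\ phi (a + b) = phi a (+) phi b) ->
  forall (I : finType) (l : I -> V) (c : I -> nat), (forall i, P (l i)) ->
  P (\sum_i l i *+ c i) /\ phi (\sum_i l i *+ c i) = \big[addb/false]_i (odd (c i) && phi (l i)).
Proof.
move=> P0 phi0 hP I l c hl.
have mul a k : P a -> P (a *+ k) /\ phi (a *+ k) = odd k && phi a.
  move=> Pa; elim: k => [|k [Pk ek]]; first by rewrite mulr0n.
  have [Pk' ek'] := hP _ _ Pa Pk; rewrite mulrS ek'; split=> //.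
  by rewrite ek /=; case: (phi a); case: (odd k).
apply: (big_ind2 (fun a b => P a /\ phi a = b)) => //.
  by move=> a b a' b' [Pa <-] [Pa' <-]; apply: hP.
by move=> i _; apply: mul.
Qed.

Section SquareClasses.
Variables (F : finFieldType) (K : fieldType) (kap : {rmorphism F -> K}).
Hypotheses (ffK : ffield kap) (odd_char : (2%:R : F) != 0).
Hypothesis full_const : forall z, ~ transc kap z -> exists c, z = kap c.
Implicit Types (p q : place K) (l m : mulgrp K) (D E : divisor K).

Lemma class_square l : to_mod2 l = 0 <-> exists m, val l = val m ^+ 2.
Proof.
rewrite to_mod2_eq0; split=> [[m ->]|[m e]]; exists m => //; exact: val_inj.
Qed.

Lemma ord_parity_combination p (I : finType) (l : I -> mulgrp K) (c : I -> nat) :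
  odd (absz (ord p (val (\sum_i l i *+ c i)))) =
  \big[addb/false]_i (odd (c i) && odd (absz (ord p (val (l i))))).
Proof.
pose phi (m : mulgrp K) := odd (absz (ord p (val m))).
have phi0 : phi 0 = false by rewrite /phi /= ord1.
have phiD a b' : phi (a + b') = phi a (+) phi b'.
  rewrite /phi /= ordM ?(valP a) ?(valP b') //.
  by clear; move: (ord p _) (ord p _) => u v; lia.
have h := @xor_combination _ (fun=> True) phi Logic.I phi0 (fun a b' _ _ => conj Logic.I (phiD a b')).
by have [_ e] := h I l c (fun=> Logic.I).
Qed.

Lemma symbol_combination p (I : finType) (l : I -> mulgrp K) (c : I -> nat) :
  (forall i, (2 %| ord p (val (l i)))%Z) ->
  (2 %| ord p (val (\sum_i l i *+ c i)))%Z /\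
  nonsquare_at p (val (\sum_i l i *+ c i)) =
    \big[addb/false]_i (odd (c i) && nonsquare_at p (val (l i))).
Proof.
apply: (@xor_combination _ (fun l => (2 %| ord p (val l))%Z : Prop)
  (fun l => nonsquare_at p (val l))) => [||a b ea eb].
- by rewrite /= ord1.
- have := nonsquare_atM_even ffK odd_char (oner_neq0 K) (oner_neq0 K).
  by move=> /(_ p); rewrite ord1 => /(_ isT isT); rewrite mulr1 addbb.
- split; first by rewrite /= ordM ?(valP a) ?(valP b) //; apply: rpredD.
  exact: (nonsquare_atM_even ffK odd_char (valP a) (valP b)).
Qed.

Lemma legendre_even l p : (2 %| ord p (val l))%Z ->
  legendre l p = (-1) ^+ nonsquare_at p (val l).
Proof. by move=> e; rewrite /legendre /nonsquare_at e; case: `[< _ >]. Qed.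

Lemma dvd2_odd (k : int) : (2 %| k)%Z = ~~ odd (absz k).
Proof. by rewrite dvdzE /= dvdn2. Qed.

Lemma evenB l m p : (2 %| ord p (val l))%Z -> (2 %| ord p (val m))%Z -> (2 %| ord p (val (l - m)))%Z.
Proof.
move=> el em; rewrite /= ordM ?(valP l) ?invr_eq0 ?(valP m) // ordV ?(valP m) //.
exact: rpredB.
Qed.

Lemma singular0P x : singular fset0 x -> exists l, x = to_mod2 l /\ even_divisor (val l).
Proof. by move=> [l -> el]; exists l; split=> // p; apply: el; rewrite in_fset0. Qed.

Lemma combination_to_mod2 (I : finType) (l : I -> mulgrp K) (c : I -> 'F_2) :
  \sum_i c i *: (to_mod2 (l i) : sqclass K) = to_mod2 (\sum_i l i *+ c i).
Proof. by rewrite raddf_sum; apply: eq_bigr => i _; rewrite scale_to_mod2. Qed.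

Lemma F2_odd_eq0 (c : 'F_2) : odd c = false -> c = 0.
Proof. by move=> e; rewrite [c]bool_of_F2 e. Qed.

Lemma odd_F2 (a : bool) : odd ((a%:R : 'F_2) : nat) = a.
Proof. by case: a. Qed.

Lemma nat_F2 (a : bool) : nat_of_ord (a%:R : 'F_2) = a.
Proof. by case: a. Qed.

Section CompatibleBasis.
Variables (n : nat) (b : 'I_n -> place K).
Hypothesis basis_b : is_basis classical_sets.setT (fun i => place_class2 (b i)).

(** Prescribe the Kronecker delta as symbols at the [b i]. The symbols of a combination are then its
    coefficients, whence independence; and an even element differs from the combination with its own
    symbols by an element with trivial symbols, a square. *)
Lemma ex_compatible_basis : exists beta : 'I_n -> sqclass K,
  is_basis (singular fset0) beta /\ compatible b beta.
Proof.
have [_ indep span] := basis_b.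
have span' p : exists c : 'I_n -> 'F_2, place_class2 p = \sum_i c i *: place_class2 (b i).
  exact: span.
have /choice[l hl] i : exists l : mulgrp K, even_divisor (val l) /\
    forall j, nonsquare_at (b j) (val l) = (i == j).
  have [x [x0 ex hx]] := ex_even_element ffK odd_char full_const indep span' [ffun j => i == j].
  by exists (exist _ x x0); split=> // j; rewrite hx ffunE.
exists (fun i => to_mod2 (l i)); split; last first.
  split=> [i|i j ij]; rewrite legendre_classE (legendre_even (proj1 (hl i) (b _))).
    by rewrite (proj2 (hl i)) eqxx.
  by rewrite (proj2 (hl i)) (negbTE ij).
have sym j (c : 'I_n -> 'F_2) : nonsquare_at (b j) (val (\sum_i l i *+ c i)) = odd (c j).
  rewrite (proj2 (symbol_combination _ (fun i => proj1 (hl i) (b j)))).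
  rewrite (bigD1 j) //= (proj2 (hl j)) eqxx andbT big1 ?addbF // => i ij.
  by rewrite (proj2 (hl i)) (negbTE ij) andbF.
split=> [i|c|x /singular0P[m [-> em]]].
- by exists (l i) => // p _; apply: (proj1 (hl i)).
- rewrite combination_to_mod2 => /class_square[m e] j; apply: F2_odd_eq0.
  rewrite -sym e -[val m ^+ 2]mul1r nonsquare_atMsq ?(valP m) //.
  have := symbol_combination (p := b j) (l := fun i : 'I_0 => 0) (fun=> 0%N).
  by rewrite !big_ord0 => /(_ (fun i => False_ind _ (notF (ltn_ord i))))[_ ->].
exists (fun i => (nonsquare_at (b i) (val m))%:R); rewrite combination_to_mod2.
set s := \sum_i _; apply/eqP; rewrite -subr_eq0 -raddfB; apply/eqP/class_square.
have es p : (2 %| ord p (val s))%Z.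
  by apply: (proj1 (symbol_combination _ _)) => i; apply: (proj1 (hl i)).
have [|i|y ey] := square_of_symbols ffK odd_char full_const (valP (m - s)) _ span' _.
- by move=> p; apply: evenB.
- have e0 := nonsquare_atM_even ffK odd_char (valP (m - s)) (valP s) (evenB (em (b i)) (es (b i))) (es (b i)).
  have em' : val (m - s) * val s = val m by rewrite -[LHS]/(val (m - s + s)) subrK.
  by move: e0; rewrite em' sym odd_F2; case: (nonsquare_at _ _); case: (nonsquare_at _ _).
have y0 : y != 0 by have := valP (m - s); rewrite ey; apply: contra_neq => ->; rewrite expr0n.
by exists (exist _ y y0).
Qed.

(** By reciprocity the symbol of [beta j] at [s] is the product of its symbols at the [b i], raised
    to the coordinates of [s]; compatibility leaves the coordinate of index [j]. *)
Lemma coordinates_of_symbols beta s (c : 'I_n -> 'F_2) :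
  (forall i, singular fset0 (beta i)) -> compatible b beta ->
  (forall j, (-1) ^+ c j = legendre_class (beta j) s) ->
  place_class2 s = \sum_j c j *: place_class2 (b j).
Proof.
move=> hb [c1 c2] hc; have [_ _ span] := basis_b.
have [d hd] : exists d : 'I_n -> 'F_2, place_class2 s = \sum_i d i *: place_class2 (b i).
  exact: span.
rewrite hd; apply: eq_bigr => j _; congr (_ *: _).
have [l [el evl]] := singular0P (hb j).
have sgn (a a' : bool) : (-1) ^+ a = (-1) ^+ a' :> int -> a = a' by case: a; case: a'.
have nb i : nonsquare_at (b i) (val l) = (i == j).
  have [->|ij] := eqVneq i j.
    have := c1 j; rewrite el legendre_classE legendre_even //.
    by move=> e; apply: sgn.
  have := c2 j i; rewrite eq_sym => /(_ ij); rewrite el legendre_classE legendre_even //.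
  by move=> e; apply: sgn.
have := hc j; rewrite el legendre_classE legendre_even //.
rewrite (symbol_of_combination ffK odd_char (valP l) evl hd).
rewrite (bigD1 j) //= nb eqxx andbT big1 ?addbF => [|i ij]; last by rewrite nb (negbTE ij) andbF.
rewrite -signr_odd => /sgn e.
by rewrite [LHS]bool_of_F2 [RHS]bool_of_F2 e.
Qed.

Lemma ex_symbol_exponents beta : (forall i, singular fset0 (beta i)) ->
  exists c : place K -> 'I_n -> 'F_2,
    forall s j, (-1) ^+ c s j = legendre_class (beta j) s.
Proof.
move=> hb; have /choice[l hl] j := singular0P (hb j).
exists (fun s j => (nonsquare_at s (val (l j)))%:R) => s j.
rewrite (proj1 (hl j)) legendre_classE legendre_even; last exact: (proj2 (hl j)).
by case: nonsquare_at.
Qed.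

End CompatibleBasis.

Lemma even_half D : (forall p, (2 %| coeff p D)%Z) -> exists E, D = E *+ 2.
Proof.
move=> h; exists (\sum_(p <- dom D) << (coeff p D %/ 2)%Z *g p >>).
apply: divisorP => p; rewrite coeffMn coeff_sumU ?uniq_dom // mulr2n.
have /divzK e := h p; case: ifPn => hp; first by rewrite -{1}e; ring.
by rewrite coeff_outdom // addr0.
Qed.

(** Let [D] be the sum of the places of [S] where [l] has odd order. Then div l - D is twice a
    divisor, so [D] is trivial in Pic modulo 2, and independence makes it empty. *)
Lemma even_of_independent (S : {fset place K}) l : fset_indep (@place_class2 K) S ->
  (forall p, p \notin S -> (2 %| ord p (val l))%Z) -> even_divisor (val l).
Proof.
move=> hS hl; pose c (s : S) : 'F_2 := (odd (absz (ord (val s) (val l))))%:R.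
pose D := \sum_s << (c s : nat)%:Z *g val s >>.
have cD p : odd (absz (coeff p D)) = odd (absz (ord p (val l))).
  have eD : D = \sum_(q <- S) << (odd (absz (ord q (val l))) : nat)%:Z *g q >>.
    by rewrite big_seq_fsetE; apply: eq_bigr => s _; rewrite /c nat_F2.
  rewrite eD coeff_sumU ?fset_uniq //; case: ifPn => [_|/hl]; first by rewrite /= oddb.
  by rewrite dvd2_odd => /negbTE ->.
have [E eE] : exists E, divx ffK (val l) - D = E *+ 2.
  apply: even_half => p; rewrite coeffB coeff_divx dvd2_odd.
  by have := cD p; clear; move: (coeff p D) (ord p _) => u v; lia.
have e0 : class2 D = 0.
  apply/(class2_eq0 ffK); exists (- E), (val l); split; first exact: (valP l).
  by rewrite mulNrn -eE opprB subrK.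
have hc := hS c (etrans (class2_comb _ _) e0).
move=> p; have [pS|/hl//] := boolP (p \in S).
have /(congr1 (fun a : 'F_2 => odd a)) := hc [` pS]%fset.
by rewrite dvd2_odd /c odd_F2 /= => ->.
Qed.

(** Passes from a basis indexed by [J] to the positions of a list, the form of the output; the
    enumeration [e] without repetition is the bijection. *)
Lemma is_basis_enum (V : lmodType 'F_2) (U : classical_sets.set V) (J : finType) (w : J -> V)
  (e : seq J) : uniq e -> (forall j, j \in e) -> is_basis U w ->
  is_basis U (fun i : 'I_(size [seq w j | j <- e]) => [seq w j | j <- e]`_i).
Proof.
move=> ue me [mU iw sw]; pose g (i : 'I_(size [seq w j | j <- e])) : J :=
  tnth (in_tuple e) (cast_ord (size_map w e) i).
have ge (i : 'I_(size [seq w j | j <- e])) : [seq w j | j <- e]`_i = w (g i).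
  have ie : (i < size e)%N by apply: leq_trans (ltn_ord i) _; rewrite size_map.
  rewrite (nth_map (g i)) //; congr (w _).
  exact: esym (tnth_nth (g i) (in_tuple e) (cast_ord (size_map w e) i)).
have jg : injective g.
  by move=> i j /(tuple_uniqP (in_tuple e) ue)/cast_ord_inj.
have bg : bijective g.
  apply: inj_card_bij => //; rewrite card_ord size_map.
  by rewrite cardE; apply: uniq_leq_size; [exact: enum_uniq|].
have [h gh hg] := bg.
split=> [i|c e0 i|x /sw[c ->]]; first by rewrite ge.
  rewrite -[i]gh; apply: (iw (c \o h)); rewrite -[RHS]e0.
  rewrite (reindex g) /=; last by exists h => j _.
  by apply: eq_bigr => j _; rewrite gh ge.
exists (c \o g); rewrite (reindex g) /=; last by exists h => j _.
by apply: eq_bigr => j _; rewrite ge.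
Qed.

Section Output.
Variables (S S' : {fset place K}) (n : nat) (beta : 'I_n -> sqclass K).
Hypothesis basis_beta : is_basis (singular fset0) beta.
Hypothesis max_S' : max_indep (@place_class2 K) S S'.

Lemma output_basis_indep : S' = S -> is_basis (singular S) beta.
Proof.
move=> e; have [_ iS _] := max_S'; have [mb ib sb] := basis_beta; split=> //.
  by move=> i; have [l -> el] := mb i; exists l => // p _; apply: el; rewrite in_fset0.
move=> x [l -> el]; apply: sb; exists l => // p _.
by apply: (even_of_independent iS) => q; rewrite e; apply: el.
Qed.

(** The parity of the order at a place of [S] outside [S'] singles out one coefficient, hence
    independence. For generation, dividing a singular element by the [m p] with [p] a place of odd
    order outside [S'] leaves an [S']-singular element, which has even divisor since [S'] is
    independent. *)
Lemma output_basis (m : place K -> mulgrp K) :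
  (forall p, p \in (S `\` S')%fset -> ~~ (2 %| ord p (val (m p)))%Z) ->
  (forall p q, p \in (S `\` S')%fset -> q \notin S -> (2 %| ord q (val (m p)))%Z) ->
  (forall p q, p \in (S `\` S')%fset -> q \in (S `\` S')%fset -> q != p ->
     (2 %| ord q (val (m p)))%Z) ->
  is_basis (singular S) (fun j : 'I_n + (S `\` S')%fset =>
    match j with inl i => beta i | inr u => to_mod2 (m (val u)) end).
Proof.
move=> h1 h2 h3; have [S'S iS' _] := max_S'; have [mb ib sb] := basis_beta.
have /choice[l hl] i := singular0P (mb i).
have mu (u : (S `\` S')%fset) : val u \in (S `\` S')%fset by exact: valP.
split.
- case=> [i|u]; last by exists (m (val u)) => // q; apply: h2.
  by exists (l i) => [|p _]; [exact: (proj1 (hl i))|exact: (proj2 (hl i))].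
- move=> c e; pose k (j : 'I_n + (S `\` S')%fset) := match j with inl i => l i | inr u => m (val u) end.
  have e' : to_mod2 (\sum_j k j *+ c j) = 0.
    rewrite -combination_to_mod2 -[RHS]e; apply: eq_bigr => -[i|u] _ //=.
    by rewrite (proj1 (hl i)).
  have cu u : c (inr u) = 0.
    apply: F2_odd_eq0; have /class_square[y ey] := e'.
    have := ord_parity_combination (val u) k (fun j => c j); rewrite ey ordX ?(valP y) //.
    rewrite big_sumType /= big1 => [|i _]; last first.
      by have := proj2 (hl i) (val u); rewrite dvd2_odd => /negbTE ->; rewrite andbF.
    rewrite (bigD1 u) //= big1 => [|v vu]; last first.
      have := @h3 (val v) (val u) (mu v) (mu u); rewrite (inj_eq val_inj) eq_sym vu => /(_ isT).
      by rewrite dvd2_odd => /negbTE ->; rewrite andbF.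
    have := h1 _ (mu u); rewrite dvd2_odd negbK => ->; rewrite andbT addbF /= mulr2n => <-.
    by clear; move: (ord _ _) => d; lia.
  case=> [i|u]; last exact: cu.
  apply: (ib (fun i => c (inl i))); move: e; rewrite big_sumType /=.
  by rewrite [X in _ + X]big1 ?addr0 // => u _; rewrite cu scale0r.
move=> x [y -> ey]; pose cR (u : (S `\` S')%fset) : 'F_2 := (odd (absz (ord (val u) (val y))))%:R.
pose z := y - \sum_u m (val u) *+ cR u.
have par q : odd (absz (ord q (val z))) = odd (absz (ord q (val y))) (+)
    \big[addb/false]_u (odd (cR u) && odd (absz (ord q (val (m (val u)))))).
  rewrite -ord_parity_combination; set s := \sum_u _ in z *.
  have -> : val y = val z * val s by rewrite -[RHS]/(val (z + s)) subrK.
  rewrite ordM ?(valP z) ?(valP s) //.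
  by clear; move: (ord q _) (ord q _) => a d; lia.
have [c hc] : exists c, to_mod2 z = \sum_i c i *: beta i.
  apply: sb; exists z => // q _; apply: (even_of_independent iS') => p pS'.
  rewrite dvd2_odd par; have [pS|pS] := boolP (p \in S); last first.
    have := ey p pS; rewrite dvd2_odd => /negbTE ->.
    rewrite big1 // => u _; have := h2 _ p (mu u) pS.
    by rewrite dvd2_odd => /negbTE ->; rewrite andbF.
  have pR : p \in (S `\` S')%fset by rewrite inE pS' pS.
  rewrite (bigD1 [` pR]%fset) //= big1 => [|u up]; last first.
    have := h3 _ p (mu u) pR; rewrite -[p]/(val [` pR]%fset) (inj_eq val_inj) eq_sym up => /(_ isT).
    by rewrite dvd2_odd => /negbTE ->; rewrite andbF.
  have := h1 p pR; rewrite dvd2_odd negbK => ->; rewrite andbT addbF /cR odd_F2 /= addbb.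
  by [].
exists (fun j => match j with inl i => c i | inr u => cR u end).
rewrite big_sumType /= -hc combination_to_mod2 -raddfD; congr to_mod2.
by rewrite subrK.
Qed.

End Output.
End SquareClasses.

(** * The elements lambda_p *)

Section LambdaStep.
Variables (F : finFieldType) (K : fieldExtType {fraction {poly F}}).
Hypotheses (full : full_constant_field K) (odd_char : (2%:R : F) != 0).
Implicit Types (p q : place K) (D : divisor K) (l : mulgrp K).

Let ffK := ffield_of_fieldExt K.
Let full_const z (ntr : ~ transc (kconst K) z) := const_of_algebraic full ntr.

Lemma div_classU (k : int) p : div_class << k *g p >> = place_class p *~ k.
Proof.
rewrite -raddfMz; congr (div_class _).
by apply: divisorP => q; rewrite raddfMz /= !coeffU mul1r -mulrzr intz mulrC.
Qed.

Lemma psiE p T m (b : 'I_m -> place K) (v : exponents T m) :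
  psi p b v = div_class (exponents_div p b v).
Proof.
case: v => [[v0 vT] vb]; rewrite /psi /exponents_div !raddfD !raddf_sum /= div_classU.
by congr (_ + _ + _); apply: eq_bigr => i _; rewrite div_classU.
Qed.

(** The generator is [f^-1]: for [x] in the space, [x * f] has no poles and is therefore a
    constant. *)
Lemma RR_generator_principal D f (f0 : f != 0) : D = divx ffK f ->
  exists l, RR_generator D l.
Proof.
move=> eD; have fV0 : f^-1 != 0 by rewrite invr_eq0.
exists (exist (fun x => x != 0) f^-1 fV0); apply/funext => x; apply/propext; split=> /=.
  case=> [->|hx]; first by exists 0; rewrite kconstE rmorph0 mul0r.
  have [->|x0] := eqVneq x 0; first by exists 0; rewrite kconstE rmorph0 mul0r.
  have [c hc] : exists c, x * f = kconst K c.
    apply: full_const => /(ex_pole ffK)[p]; rewrite ordM //.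
    by have := hx p; rewrite eD coeff_divx; clear; lia.
  by exists c; rewrite kconstE -hc mulfK.
move=> [c ->]; have [->|c0] := eqVneq c 0; first by left; rewrite kconstE rmorph0 mul0r.
right=> p; rewrite kconstE ordM ?fmorph_eq0 // ord_kap // add0r ordV // eD.
by rewrite coeff_divx.
Qed.

Lemma ord_RR_generator D l : div_class D = 0 -> RR_generator D l ->
  forall q, ord q (val l) = - coeff q D.
Proof.
move=> /(div_class_eq0 ffK)[f f0 eD] hl q.
have : RiemannRoch D f^-1 by right=> r; rewrite ordV // eD coeff_divx.
rewrite hl => -[c e].
have c0 : c != 0.
  apply: contra_neq f0 => c0; apply/eqP; rewrite -invr_eq0 e c0 kconstE rmorph0.
  by rewrite mul0r.
have := congr1 (ord q) e; rewrite ordV // kconstE ordM ?fmorph_eq0 ?(valP l) //.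
by rewrite ord_kap // add0r eD coeff_divx => <-.
Qed.

Section Data.
Variables (S S' : {fset place K}) (b : places K) (beta : 'I_(dimB b) -> sqclass K) (p : place K).
Hypotheses (gen_b : generating_places S b) (beta_even : forall i, singular fset0 (beta i)).
Hypotheses (max_S' : max_indep (@place_class2 K) S S') (pS : p \in S) (pS' : p \notin S').

Let support (eps : S' -> 'F_2) := [fset val s | s : S' & eps s == 1]%fset.

Lemma support_sub eps q : q \in support eps -> q \in S'.
Proof. by move=> /imfsetP[s _ ->]; apply: (valP s). Qed.

Lemma sum_support (eps : S' -> 'F_2) (V : zmodType) (f : place K -> V) :
  \sum_(t : support eps) f (val t) = \sum_(s : S') f (val s) *+ eps s.
Proof.
transitivity (\sum_(t <- support eps) f t); first by rewrite big_seq_fsetE.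
transitivity (\sum_(t <- [seq val s | s <- enum [pred s | eps s == 1]]) f t).
  apply: perm_big; apply: uniq_perm; first exact: fset_uniq.
    by rewrite map_inj_uniq ?enum_uniq //; apply: val_inj.
  move=> q; apply/imfsetP/mapP => [[s /= hs ->]|[s hs ->]]; exists s => //.
    by rewrite mem_enum.
  by rewrite mem_enum in hs.
rewrite big_map big_enum /= big_mkcond; apply: eq_bigr => s _.
rewrite inE; case: eqP => [-> //|ne]; suff -> : eps s = 0 by [].
apply: F2_odd_eq0; apply/negP => o; apply: ne.
by rewrite [eps s]bool_of_F2 o.
Qed.

(** The relation modulo 2 means that [p] minus the places of [T] is twice a divisor [E] plus a
    principal one. Writing the class of [E] in the generating places, the exponents are 1 at [p], -1
    on [T], and the negated coefficients of [E]. *)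
Lemma ex_exponents (eps : S' -> 'F_2) :
  place_class2 p = \sum_(s : S') eps s *: place_class2 (val s) ->
  exists v : exponents (support eps) (dimB b + numB' b), psi p b v = 0 /\ ~~ (2 %| v.1.1)%Z.
Proof.
rewrite class2_comb => /eqP; rewrite -subr_eq0 -[place_class2 p]/(class2 << p >>) -raddfB.
move=> /eqP/(class2_eq0 ffK)[E [y [y0 eD]]].
have [_ _ _ /(_ (div_class E))[c hc]] := gen_b.
exists (1, [ffun=> -1], [ffun i => - c i]); split=> //=.
have -> : \sum_(t : support eps) place_class (val t) *~ [ffun=> -1] t =
    - \sum_(s : S') place_class (val s) *+ eps s.
  by rewrite -sum_support -sumrN; apply: eq_bigr => t _; rewrite ffunE mulrN1z.
have -> : \sum_i place_class (b i) *~ (2 * [ffun i => - c i] i) = - (div_class E *+ 2).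
  rewrite hc -sumrMnl -sumrN; apply: eq_bigr => i _.
  by rewrite ffunE mulrN mulrNz [2 * _]mulrC mulrzA.
have e : div_class (<< p >> - \sum_(s : S') << (eps s : nat)%:Z *g val s >>) = div_class E *+ 2.
  rewrite eD raddfD raddfMn /= [X in _ + X](_ : _ = 0) ?addr0 //.
  by apply/(div_class_eq0 ffK); exists y.
have -> : \sum_(s : S') place_class (val s) *+ eps s =
    div_class (\sum_(s : S') << (eps s : nat)%:Z *g val s >>).
  by rewrite raddf_sum; apply: eq_bigr => s _; rewrite /= div_classU.
by rewrite -e raddfB /= mulr1z subrr.
Qed.

(** The integer [k] is half the contribution of the generating places, which avoid [S]. *)
Lemma coeff_exponents (eps : S' -> 'F_2) (v : exponents (support eps) (dimB b + numB' b)) q :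
  exists k, coeff q (exponents_div p b v) =
    v.1.1 * (p == q)%:R + \sum_(t : support eps) v.1.2 t * (val t == q)%:R + 2 * k /\
    (q \in S -> k = 0).
Proof.
case: v => [[v0 vT] vb] /=; exists (\sum_i vb i * (b i == q)%:R); split.
  rewrite !coeffD !raddf_sum /= coeffU mulr_sumr; congr (_ + _ + _).
    by apply: eq_bigr => t _; rewrite coeffU.
  by apply: eq_bigr => i _; rewrite coeffU mulrA.
move=> qS; rewrite big1 // => i _; have [_ /(_ i) bS _ _] := gen_b.
by case: eqP => [e|_]; [rewrite e qS in bS|rewrite mulr0].
Qed.

Lemma generator_parity (eps : S' -> 'F_2) (v : exponents (support eps) (dimB b + numB' b)) l :
  psi p b v = 0 -> ~~ (2 %| v.1.1)%Z -> RR_generator (exponents_div p b v) l ->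
  [/\ ~~ (2 %| ord p (val l))%Z, forall q, q \notin S -> (2 %| ord q (val l))%Z &
      forall q, q \in (S `\` S')%fset -> q != p -> (2 %| ord q (val l))%Z].
Proof.
rewrite psiE => hv ov hl; have ol := ord_RR_generator hv hl.
have [S'S _ _] := max_S'.
have out q : q \notin S' -> \sum_(t : support eps) v.1.2 t * (val t == q)%:R = 0.
  move=> qS'; rewrite big1 // => t _; case: eqP => [e|_]; last exact: mulr0.
  by have := support_sub (valP t); rewrite e (negbTE qS').
split.
- have [k [ek /(_ pS) k0]] := coeff_exponents v p.
  by rewrite ol ek out // eqxx k0 mulr1 mulr0 !addr0 rpredN.
- move=> q qS; have [k [ek _]] := coeff_exponents v q.
  have pq : (p == q) = false by apply: contraNF qS => /eqP <-.
  rewrite ol ek out ?pq ?mulr0 ?add0r ?rpredN ?dvdz_mulr //.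
  by apply: contra qS => /(fsubsetP S'S).
- move=> q; rewrite inE => /andP[qS' qS] qp; have [k [ek /(_ qS) k0]] := coeff_exponents v q.
  by rewrite ol ek out // k0 [p == q]eq_sym (negbTE qp) !mulr0 !addr0 oppr0.
Qed.

Lemma lambda_feasible : feasible (lambda beta S' p).
Proof.
split; first exact: max_indep_span max_S' pS.
move=> eps heps; split; first exact: ex_exponents.
move=> v [hv ov]; split.
  have /(div_class_eq0 ffK)[f f0 ef] : div_class (exponents_div p b v) = 0 by rewrite -psiE.
  exact: RR_generator_principal f0 ef.
move=> l hl; split=> //; have [_ hev _] := generator_parity hv ov hl.
exists (fun i => (nonsquare_at (placeB b i) (val l))%:R) => i.
rewrite legendre_even; first by case: nonsquare_at.
by apply: hev; have [_ bS _ _] := gen_b; apply: bS.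
Qed.

(** The [beta i] have even divisors, so the correcting factor changes no parity of an order. *)
Lemma lambda_outcome x : outcome (lambda beta S' p) x -> exists m : mulgrp K, [/\ x = to_mod2 m,
  ~~ (2 %| ord p (val m))%Z, forall q, q \notin S -> (2 %| ord q (val m))%Z &
  forall q, q \in (S `\` S')%fset -> q != p -> (2 %| ord q (val m))%Z].
Proof.
move=> [eps heps [v [hv ov] [l hl [e _ ->]]]].
have [h1 h2 h3] := generator_parity hv ov hl.
have /choice[g hg] i := singular0P (beta_even i).
pose s := \sum_i g i *+ e i.
have es q : ord q (val (l + s)) = ord q (val l) + ord q (val s).
  by rewrite /= ordM ?(valP l) ?(valP s).
have even_s q : (2 %| ord q (val s))%Z.
  rewrite dvd2_odd ord_parity_combination big1 // => i _.
  by have := proj2 (hg i) q; rewrite dvd2_odd => /negbTE ->; rewrite andbF.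
exists (l + s); split.
- rewrite raddfD /= -combination_to_mod2; congr (_ + _).
  by apply: eq_bigr => i _; rewrite (proj1 (hg i)).
- by rewrite es rpredDr.
- by move=> q /h2 h; rewrite es rpredDr.
- by move=> q hq /(h3 q hq) h; rewrite es rpredDr.
Qed.

End Data.
End LambdaStep.

Theorem mainTheorem3 (F : finFieldType) (K : fieldExtType {fraction {poly F}})
    (p : nat) (p_char : p \in [pchar K]) (p_odd : odd p)
    (F_full : full_constant_field K) (S : {fset place K}) :
  correct (procedure S) (fun out : seq (sqclass K) =>
    is_basis (singular S) (fun i : 'I_(size out) => out`_i)).
Proof.
have odd_char := odd_char_base p_char p_odd; have ffK := ffield_of_fieldExt K.
have full z (ntr : ~ transc (kconst K) z) := const_of_algebraic F_full ntr.
split=> [|out [b hb [beta [bb cb] [c hc [_ _ [S' hS']]]]]].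
- split; first exact: ex_generating_places ffK S.
  move=> b hb; have [_ _ basis_b _] := hb.
  split; first by have h := @ex_compatible_basis F K _ ffK odd_char full _ (@placeB K b) basis_b.
  move=> beta [bb cb]; have [beta_even _ _] := bb; split.
    by have [c hc] := ex_symbol_exponents beta_even; exists c => s _ j; apply: hc.
  move=> c hc; split.
    by move=> s sS; apply: (coordinates_of_symbols ffK odd_char basis_b beta_even cb (hc s sS)).
  move=> _ _; split; first exact: ex_max_indep.
  move=> S' hS'; case: ifP => // _; split=> // q.
  by rewrite inE => /andP[qS' qS]; have h := lambda_feasible F_full beta hb hS' qS qS'; exact: h.
have [beta_even _ _] := bb.
case: ifP => [/eqP eS ->|_ [lam hlam ->]].
  have h := output_basis_indep ffK bb hS' eS.
  have me (j : 'I_(dimB b)) : j \in enum 'I_(dimB b) by rewrite mem_enum.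
  by have := is_basis_enum (enum_uniq _) me h; rewrite -codomE.
have /choice[m hm] q : exists m : mulgrp K, q \in (S `\` S')%fset -> [/\ lam q = to_mod2 m,
    ~~ (2 %| ord q (val m))%Z, forall r, r \notin S -> (2 %| ord r (val m))%Z &
    forall r, r \in (S `\` S')%fset -> r != q -> (2 %| ord r (val m))%Z].
  have [qR|_] := boolP (q \in (S `\` S')%fset); last by exists 0.
  have [qS' qS] : q \notin S' /\ q \in S by apply/andP; rewrite -in_fsetD.
  by have [m hm] := lambda_outcome hb beta_even hS' qS qS' (hlam q qR); exists m.
pose w (j : 'I_(dimB b) + (S `\` S')%fset) : sqclass K :=
  match j with inl i => beta i | inr u => lam (val u) end.
(* The list is rewritten as the image of an enumeration of the disjoint union that indexes the
   basis. *)
have -> : codom beta ++ [seq lam q | q <- (S `\` S')%fset] =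
    [seq w j | j <- map inl (enum 'I_(dimB b)) ++ map inr (enum {: (S `\` S')%fset})].
  rewrite map_cat -(map_comp w inl) -(map_comp w inr) codomE; congr (_ ++ _).
  have eR := @enum_fsetE _ (S `\` S')%fset; rewrite -[in LHS]/(enum_fset _).
  by rewrite [in LHS]eR -map_comp.
apply: is_basis_enum.
- rewrite cat_uniq; apply/and3P; split; first by rewrite map_inj_uniq ?enum_uniq // => i j [].
    by apply/hasPn => _ /mapP[u _ ->]; apply/mapP => -[].
  by rewrite map_inj_uniq ?enum_uniq // => i j [].
- by case=> j; rewrite mem_cat; [rewrite map_f ?mem_enum|rewrite [X in _ || X]map_f ?mem_enum ?orbT].
have := output_basis ffK bb hS' (m := m).
have -> : w = fun j => match j with inl i => beta i | inr u => to_mod2 (m (val u)) end.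
  by apply/funext => -[i|u] //=; have [] := hm (val u) (valP u).
apply.
- by move=> q /hm[].
- by move=> q r /hm[_ _ h _] /h.
- by move=> q r /hm[_ _ _ h] hr /(h r hr).
Qed.
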